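(* Let $J(z)=\sum_{n=0}^{\infty}\frac{a_{2n}}{(2n)!}z^{2n}$ with complex coefficients, and suppose there are real numbers $\nu_a,\nu_J$ and a constant $C$ such that (1) $|a_n|\le C(1+n)^{\nu_a}$ for all (even) $n$; (2) $|J(z)|\le C\,\mathrm{e}^{|\mathrm{Im}\,z|}(1+|z|)^{\nu_J}$ for $\mathrm{Re}\,z>0$. Let $b\in\mathbb{C}$. Then: 1. If $\nu_a,\nu_J<0$, then $$(\mathrm{MS})\text{-}\sum_{n=1/4}^{-1/4}\frac{J(\sqrt{b^2+(2\pi n)^2})}{n}=\pi J(b),\qquad \sum_{n=0}^{\infty}\frac{(-1)^n}{n+\frac12}J\left(\sqrt{b^2+\pi^2(n+1/2)^2}\right)=\frac{\pi}{2}J(b).$$ 2. If $\nu_a,\nu_J<1$, then $$(\mathrm{MS})\text{-}\sum_{n=1}^{-1/2}\frac{J(\sqrt{b^2+(2\pi n)^2})}{n^2}=-\frac{\pi^2J(b)}{3}-\frac{\pi^2J'(b)}{b},\qquad \sum_{n=1}^{\infty}\frac{(-1)^n}{n^2}J\left(\sqrt{b^2+\pi^2n^2}\right)=-\frac{\pi^2J(b)}{12}-\frac{\pi^2J'(b)}{4b}.$$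
   Context: Since $J$ is even, $J(\sqrt{w})$ does not depend on the branch of the square root, and $J'(b)/b$ at $b=0$ is understood by continuity. **Müller–Schleicher (MS) fractional sum.** Let $U\subseteq\mathbb{C}$ with $U+1\subseteq U$ and $1\in U$, and $f:U\to\mathbb{C}$ (here $U=\{z\in\mathbb{C}:\mathrm{Re}\,z>0\}$). Suppose there is a sequence of polynomials $(P_n)_{n\in\mathbb{N}}$ such that: (i) the degrees of the $P_n$ are uniformly bounded; (ii) for all $y$ with $y+1\in U$ the limit $\lim_{n\to\infty}\left(\sum_{k=1}^n(f(k+y)-f(k))-P_n(y)\right)=:-Q(y)$ exists; (iii) for all $y$ with $y+1\in U$, $Q(y+1)-Q(y)=f(y+1)$. Then $(\mathrm{MS})\text{-}\sum_{k=x}^{y}f(k):=Q(y)-Q(x-1)$ for $x,y+1\in U$ (this does not depend on the choice of $(P_n)$). *)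

(* Defs.v *)
From Stdlib Require Import Reals.
From Coquelicot Require Import Coquelicot.

Open Scope C_scope.

Definition right_half_plane (z : C) : Prop := (0 < Re z)%R.

Definition poly_degree_le (d : nat) (p : C -> C) : Prop :=
  exists c : nat -> C, forall y : C, p y = sum_n (fun j : nat => c j * y ^ j) d.

(* Mueller-Schleicher fractional sum: [is_MS_sum U f x y s] says that the sum of
   f(k) for k = x, ..., y exists and equals s.  The values of f outside U and of
   Q outside U - 1 are irrelevant, so both are taken as total functions. *)
Definition is_MS_sum (U : C -> Prop) (f : C -> C) (x y s : C) : Prop :=
  (forall z : C, U z -> U (z + 1)) /\ U 1 /\ U x /\ U (y + 1) /\
  exists (P : nat -> C -> C) (Q : C -> C),
    (exists d : nat, forall n : nat, poly_degree_le d (P n)) /\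
    (forall w : C, U (w + 1) ->
       filterlim
         (fun n : nat =>
            sum_n_m (fun k : nat => f (RtoC (INR k) + w) - f (RtoC (INR k))) 1 n - P n w)
         eventually (locally (- Q w))) /\
    (forall w : C, U (w + 1) -> Q (w + 1) - Q w = f (w + 1)) /\
    s = Q y - Q (x - 1).

(* J'(b)/b, with the value at b = 0 given by continuity. *)
Definition derive_over_id (J : C -> C) (b : C) : C :=
  if Ceq_dec b 0 then C_lim (fun z : C => C_derive J z / z) 0
  else C_derive J b / b.

(* Main.v *)
(** Write [j w] for the entire function with [J z = j (z ^ 2)], and put
    [H z = j (b ^ 2 + z ^ 2)].  Since a square root of [b ^ 2 + z ^ 2] stays within
    bounded distance of [z] or [- z], [H] grows at most like
    [exp |Im z| (1 + |z|) ^ nu_J].  The functions [F z = (H z - H 0) / z] (odd) and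
    [F z = (H z - H 0) / z ^ 2] (even) are entire, and on every vertical line
    [F / cosh (Im z)] is integrable with an integral tending to 0 as the line moves
    to infinity.  Cauchy's theorem in a strip of width [PI], applied to
    [(F (p + u) + F (p - u) - 2 F p) / sin u], gives
    [2 PI F p = W (p + PI / 2) + W (p - PI / 2)] with
    [W c = int F (c + i y) / cosh y dy], so the alternating sums of [F (p + n PI)]
    telescope to [W (p - PI / 2) / (2 PI)], and parity evaluates this integral:
    it is 0 for the odd function at [p = PI / 2], and [PI F 0] for the even one at
    [p = PI].  What remains is [H 0] times the Leibniz series, respectively times
    [sum (-1) ^ n / n ^ 2]; the latter is obtained by applying the even formula to
    [J = cos], [b = 0].  Finally the terms of the fractional sums are absolutely
    summable, so the polynomials [P n] may be taken to be 0, and the fractional sums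
    are the alternating series with consecutive terms paired. *)
Require Import Defs.
From Stdlib Require Import Arith Factorial Reals Lra Lia.
From Coquelicot Require Import Coquelicot.

Open Scope C_scope.

(** * Complex derivatives and continuity *)

(** The second difference is what lets Cauchy's theorem be used without residues. It is even in [u],
    hence vanishes at 0 together with its derivative, so its quotient by [sin u] has no pole; and
    this quotient is odd, so its integral over the imaginary axis vanishes. Only the half strip
    between the real parts 0 and [PI / 2] is therefore needed, and on the right edge [sin u] is
    [cosh y]. The term [2 PI F p] is nothing but [2 F p] times the integral of [1 / cosh].
    Subtracting [H 0] removes the pole of [H z / z ^ m], for [m] equal to 1 or 2. With
    [nu_J < m - 1] the quotient [H z / z ^ m], freed of its exponential factor, has order below -1;
    the surplus over integrability on vertical lines is spent on decay in the real direction. The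
    correction [H 0 / z ^ m] decays more slowly, but it has no exponential factor, and this makes up
    for the difference. Integrals are taken of real parts only; imaginary parts follow by replacing
    [F] with [- i F]. *)

Lemma im_le_Cmod (z : C) : (Rabs (Im z) <= Cmod z)%R.
Proof.
  replace (Im z) with (Re (- Ci * z)%C) by (unfold Ci, Re, Im; simpl; ring).
  replace (Cmod z) with (Cmod (- Ci * z)%C); [apply re_le_Cmod|].
  rewrite Cmod_mult, Cmod_opp, Cmod_Ci; ring.
Qed.

(* Spelled out with epsilons because the topologies that Coquelicot attaches to [C]
   as an absolute ring and as a normed module are not convertible. *)
Definition cderiv (f : C -> C) (z l : C) : Prop :=
  forall eps : R, (0 < eps)%R -> exists d : R, (0 < d)%R /\
    forall h : C, (Cmod h < d)%R ->
      (Cmod (f (z + h) - f z - l * h)%C <= eps * Cmod h)%R.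

Definition ccont (f : C -> C) (z : C) : Prop :=
  forall eps : R, (0 < eps)%R -> exists d : R, (0 < d)%R /\
    forall h : C, (Cmod h < d)%R -> (Cmod (f (z + h) - f z)%C <= eps)%R.

Lemma cderiv_ext f g z l : (forall w, f w = g w) -> cderiv f z l -> cderiv g z l.
Proof.
  intros H Hf eps He; destruct (Hf eps He) as [d [Hd Hf']].
  exists d; split; trivial; intros h Hh; rewrite <- !H; auto.
Qed.

Lemma cderiv_const k z : cderiv (fun _ => k) z 0.
Proof.
  intros eps He; exists 1%R; split; [lra|]; intros h _.
  replace (k - k - 0 * h) with (RtoC 0) by ring.
  rewrite Cmod_0; apply Rmult_le_pos; [lra | apply Cmod_ge_0].
Qed.

Lemma cderiv_id z : cderiv (fun w => w) z 1.
Proof.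
  intros eps He; exists 1%R; split; [lra|]; intros h _.
  replace (z + h - z - 1 * h) with (RtoC 0) by ring.
  rewrite Cmod_0; apply Rmult_le_pos; [lra | apply Cmod_ge_0].
Qed.

Lemma cderiv_plus f g z l m :
  cderiv f z l -> cderiv g z m -> cderiv (fun w => f w + g w) z (l + m).
Proof.
  intros Hf Hg eps He.
  destruct (Hf (eps / 2)%R) as [d1 [Hd1 H1]]; [lra|].
  destruct (Hg (eps / 2)%R) as [d2 [Hd2 H2]]; [lra|].
  exists (Rmin d1 d2); split; [now apply Rmin_pos|]; intros h Hh.
  specialize (H1 h (Rlt_le_trans _ _ _ Hh (Rmin_l _ _))).
  specialize (H2 h (Rlt_le_trans _ _ _ Hh (Rmin_r _ _))).
  replace (f (z + h) + g (z + h) - (f z + g z) - (l + m) * h) with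
    ((f (z + h) - f z - l * h) + (g (z + h) - g z - m * h)) by ring.
  eapply Rle_trans; [apply Cmod_triangle|]; lra.
Qed.

Lemma cderiv_lipschitz f z l : cderiv f z l -> exists d : R, (0 < d)%R /\
  forall h, (Cmod h < d)%R -> (Cmod (f (z + h) - f z)%C <= (Cmod l + 1) * Cmod h)%R.
Proof.
  intros Hf; destruct (Hf 1%R) as [d [Hd H]]; [lra|].
  exists d; split; trivial; intros h Hh; specialize (H h Hh).
  replace (f (z + h) - f z) with (l * h + (f (z + h) - f z - l * h)) by ring.
  eapply Rle_trans; [apply Cmod_triangle|]; rewrite Cmod_mult; lra.
Qed.

Lemma cderiv_ccont f z l : cderiv f z l -> ccont f z.
Proof.
  intros Hf eps He; destruct (cderiv_lipschitz f z l Hf) as [d [Hd H]].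
  pose proof (Cmod_ge_0 l).
  exists (Rmin d (eps / (Cmod l + 1))); split.
  - apply Rmin_pos; trivial; apply Rdiv_lt_0_compat; lra.
  - intros h Hh.
    eapply Rle_trans; [apply H, (Rlt_le_trans _ _ _ Hh (Rmin_l _ _))|].
    assert (Cmod h <= eps / (Cmod l + 1))%R as K.
    { left; apply (Rlt_le_trans _ _ _ Hh (Rmin_r _ _)). }
    apply Rmult_le_compat_l with (r := (Cmod l + 1)%R) in K; [|lra].
    replace ((Cmod l + 1) * (eps / (Cmod l + 1)))%R with eps in K by (field; lra).
    exact K.
Qed.

Lemma cderiv_mult f g z l m :
  cderiv f z l -> cderiv g z m -> cderiv (fun w => f w * g w) z (l * g z + f z * m).
Proof.
  intros Hf Hg eps He.
  destruct (cderiv_lipschitz f z l Hf) as [d0 [Hd0 H0]].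
  pose proof (Cmod_ge_0 l) as Pl; pose proof (Cmod_ge_0 m) as Pm.
  pose proof (Cmod_ge_0 (f z)) as Pf; pose proof (Cmod_ge_0 (g z)) as Pg.
  set (e1 := (eps / (3 * (Cmod (g z)%C + 1)))%R).
  set (e2 := (eps / (3 * (Cmod (f z)%C + 1)))%R).
  assert (0 < e1)%R as He1 by (apply Rdiv_lt_0_compat; lra).
  assert (0 < e2)%R as He2 by (apply Rdiv_lt_0_compat; lra).
  assert (e1 * (Cmod (g z)%C + 1) = eps / 3)%R as E1 by (unfold e1; field; lra).
  assert (e2 * (Cmod (f z)%C + 1) = eps / 3)%R as E2 by (unfold e2; field; lra).
  destruct (Hf e1 He1) as [d1 [Hd1 H1]].
  destruct (Hg e2 He2) as [d2 [Hd2 H2]].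
  destruct (cderiv_lipschitz g z m Hg) as [d3 [Hd3 H3]].
  set (k := ((Cmod l + 1) * (Cmod m + 1))%R).
  assert (0 < k)%R as Hk by (apply Rmult_lt_0_compat; lra).
  set (d4 := (eps / (3 * k))%R).
  assert (0 < d4)%R as Hd4 by (apply Rdiv_lt_0_compat; lra).
  assert (k * d4 = eps / 3)%R as E4 by (unfold d4; field; lra).
  exists (Rmin (Rmin d0 d1) (Rmin (Rmin d2 d3) d4)); split.
  { repeat apply Rmin_pos; trivial. }
  intros h Hh.
  apply Rmin_Rgt_l in Hh; destruct Hh as [Ha Hb].
  apply Rmin_Rgt_l in Ha; destruct Ha as [h0 h1].
  apply Rmin_Rgt_l in Hb; destruct Hb as [Hb h4].
  apply Rmin_Rgt_l in Hb; destruct Hb as [h2 h3].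
  specialize (H0 h h0); specialize (H1 h h1).
  specialize (H2 h h2); specialize (H3 h h3).
  replace (f (z + h) * g (z + h) - f z * g z - (l * g z + f z * m) * h) with
    (g z * (f (z + h) - f z - l * h) + f z * (g (z + h) - g z - m * h)
     + (f (z + h) - f z) * (g (z + h) - g z)) by ring.
  eapply Rle_trans; [apply Cmod_triangle|].
  eapply Rle_trans; [apply Rplus_le_compat_r, Cmod_triangle|].
  rewrite !Cmod_mult.
  pose proof (Cmod_ge_0 h).
  assert (Cmod (g z)%C * Cmod (f (z + h) - f z - l * h)%C <= eps / 3 * Cmod h)%R.
  { eapply Rle_trans; [apply Rmult_le_compat_l; [lra | exact H1]|].
    rewrite <- E1; nra. }
  assert (Cmod (f z)%C * Cmod (g (z + h) - g z - m * h)%C <= eps / 3 * Cmod h)%R.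
  { eapply Rle_trans; [apply Rmult_le_compat_l; [lra | exact H2]|].
    rewrite <- E2; nra. }
  assert (Cmod (f (z + h) - f z)%C * Cmod (g (z + h) - g z)%C <= eps / 3 * Cmod h)%R.
  { eapply Rle_trans; [apply Rmult_le_compat; [apply Cmod_ge_0 | apply Cmod_ge_0 | exact H0 | exact H3]|].
    rewrite <- E4.
    replace ((Cmod l + 1) * Cmod h * ((Cmod m + 1) * Cmod h))%R
      with (k * Cmod h * Cmod h)%R by (unfold k; ring).
    apply Rmult_le_compat_r; trivial; apply Rmult_le_compat_l; lra. }
  lra.
Qed.

Lemma cderiv_comp f g z l m :
  cderiv f (g z) l -> cderiv g z m -> cderiv (fun w => f (g w)) z (l * m).
Proof.
  intros Hf Hg eps He.
  pose proof (Cmod_ge_0 l) as Pl; pose proof (Cmod_ge_0 m) as Pm.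
  set (e1 := (eps / (2 * (Cmod m + 1)))%R).
  set (e2 := (eps / (2 * (Cmod l + 1)))%R).
  assert (0 < e1)%R as He1 by (apply Rdiv_lt_0_compat; lra).
  assert (0 < e2)%R as He2 by (apply Rdiv_lt_0_compat; lra).
  assert (e1 * (Cmod m + 1) = eps / 2)%R as E1 by (unfold e1; field; lra).
  assert (e2 * (Cmod l + 1) = eps / 2)%R as E2 by (unfold e2; field; lra).
  destruct (Hf e1 He1) as [d1 [Hd1 H1]].
  destruct (Hg e2 He2) as [d2 [Hd2 H2]].
  destruct (cderiv_lipschitz g z m Hg) as [d3 [Hd3 H3]].
  assert (0 < d1 / (Cmod m + 1))%R as Hd4 by (apply Rdiv_lt_0_compat; lra).
  exists (Rmin (d1 / (Cmod m + 1)) (Rmin d2 d3)); split.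
  { repeat apply Rmin_pos; trivial. }
  intros h Hh.
  apply Rmin_Rgt_l in Hh; destruct Hh as [h1 Hb].
  apply Rmin_Rgt_l in Hb; destruct Hb as [h2 h3].
  specialize (H2 h h2); specialize (H3 h h3).
  pose proof (Cmod_ge_0 h).
  set (k := g (z + h) - g z) in *.
  assert (Cmod k < d1)%R as Hk.
  { eapply Rle_lt_trans; [exact H3|].
    apply Rmult_lt_compat_l with (r := (Cmod m + 1)%R) in h1; [|lra].
    replace ((Cmod m + 1) * (d1 / (Cmod m + 1)))%R with d1 in h1 by (field; lra).
    exact h1. }
  specialize (H1 k Hk).
  replace (g z + k) with (g (z + h)) in H1 by (unfold k; ring).
  replace (f (g (z + h)) - f (g z) - l * m * h) with
    ((f (g (z + h)) - f (g z) - l * k) + l * (k - m * h)) by ring.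
  eapply Rle_trans; [apply Cmod_triangle|]; rewrite Cmod_mult.
  assert (e1 * Cmod k <= eps / 2 * Cmod h)%R.
  { rewrite <- E1, Rmult_assoc; apply Rmult_le_compat_l; lra. }
  assert (Cmod l * Cmod (k - m * h)%C <= eps / 2 * Cmod h)%R.
  { eapply Rle_trans; [apply Rmult_le_compat_l; [lra | exact H2]|].
    rewrite <- E2; nra. }
  lra.
Qed.

Lemma ccont_ext f g z : (forall w, f w = g w) -> ccont f z -> ccont g z.
Proof.
  intros H Hf eps He; destruct (Hf eps He) as [d [Hd Hf']].
  exists d; split; trivial; intros h Hh; rewrite <- !H; auto.
Qed.

Lemma ccont_plus f g z : ccont f z -> ccont g z -> ccont (fun w => f w + g w) z.
Proof.
  intros Hf Hg eps He.
  destruct (Hf (eps / 2)%R) as [d1 [Hd1 H1]]; [lra|].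
  destruct (Hg (eps / 2)%R) as [d2 [Hd2 H2]]; [lra|].
  exists (Rmin d1 d2); split; [now apply Rmin_pos|]; intros h Hh.
  specialize (H1 h (Rlt_le_trans _ _ _ Hh (Rmin_l _ _))).
  specialize (H2 h (Rlt_le_trans _ _ _ Hh (Rmin_r _ _))).
  replace (f (z + h) + g (z + h) - (f z + g z)) with
    ((f (z + h) - f z) + (g (z + h) - g z)) by ring.
  eapply Rle_trans; [apply Cmod_triangle|]; lra.
Qed.

Lemma ccont_mult f g z : ccont f z -> ccont g z -> ccont (fun w => f w * g w) z.
Proof.
  intros Hf Hg eps He.
  pose proof (Cmod_ge_0 (f z)) as Pf; pose proof (Cmod_ge_0 (g z)) as Pg.
  set (k := (Cmod (f z)%C + Cmod (g z)%C + 1)%R).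
  set (e := Rmin 1 (eps / k)).
  assert (0 < k)%R as Hk by (unfold k; lra).
  assert (0 < e)%R as Hpe by (apply Rmin_pos; [lra | apply Rdiv_lt_0_compat; lra]).
  assert (e <= 1)%R as Hle by apply Rmin_l.
  assert (k * e <= eps)%R as Hke.
  { apply Rle_trans with (k * (eps / k))%R.
    - apply Rmult_le_compat_l; [lra | apply Rmin_r].
    - right; field; lra. }
  destruct (Hf e Hpe) as [d1 [Hd1 H1]].
  destruct (Hg e Hpe) as [d2 [Hd2 H2]].
  exists (Rmin d1 d2); split; [now apply Rmin_pos|]; intros h Hh.
  specialize (H1 h (Rlt_le_trans _ _ _ Hh (Rmin_l _ _))).
  specialize (H2 h (Rlt_le_trans _ _ _ Hh (Rmin_r _ _))).
  replace (f (z + h) * g (z + h) - f z * g z) with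
    (g z * (f (z + h) - f z) + f z * (g (z + h) - g z)
     + (f (z + h) - f z) * (g (z + h) - g z)) by ring.
  eapply Rle_trans; [apply Cmod_triangle|].
  eapply Rle_trans; [apply Rplus_le_compat_r, Cmod_triangle|].
  rewrite !Cmod_mult.
  pose proof (Cmod_ge_0 (f (z + h) - f z)); pose proof (Cmod_ge_0 (g (z + h) - g z)).
  unfold k in Hke; nra.
Qed.

Lemma ccont_comp f g z : ccont f (g z) -> ccont g z -> ccont (fun w => f (g w)) z.
Proof.
  intros Hf Hg eps He.
  destruct (Hf eps He) as [d1 [Hd1 H1]].
  destruct (Hg (d1 / 2)%R) as [d2 [Hd2 H2]]; [lra|].
  exists d2; split; trivial; intros h Hh; specialize (H2 h Hh).
  replace (g (z + h)) with (g z + (g (z + h) - g z)) by ring.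
  apply H1; lra.
Qed.

Lemma cderiv_Re_x f x y l : cderiv f (x, y) l ->
  is_derive (fun s : R => Re (f (s, y))%C) x (Re l) /\
  is_derive (fun s : R => Im (f (s, y))%C) x (Im l).
Proof.
  intros Hf; split; apply is_derive_Reals; intros eps He;
    (destruct (Hf (eps / 2)%R) as [d [Hd H]]; [lra|]);
    exists (mkposreal d Hd); simpl; intros h Hh0 Hh;
    (assert (Cmod (h, 0%R)%C = Rabs h) as Eh
       by (change (h, 0%R) with (RtoC h); apply Cmod_R));
    specialize (H (h, 0%R)); rewrite Eh in H; specialize (H Hh);
    replace ((x, y) + (h, 0%R)) with ((x + h)%R, y) in H
      by (unfold Cplus; simpl; f_equal; ring);
    (assert (0 < Rabs h)%R by now apply Rabs_pos_lt).
  - pose proof (re_le_Cmod (f (x + h, y)%R - f (x, y) - l * (h, 0%R))) as K.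
    replace (Re (f ((x + h)%R, y) - f (x, y) - l * (h, 0%R))%C)
      with (((Re (f ((x + h)%R, y))%C - Re (f (x, y))%C) / h - Re l) * h)%R in K.
    2: { unfold Re, Im, Cminus, Cplus, Copp, Cmult; simpl; field; trivial. }
    rewrite Rabs_mult in K.
    apply Rmult_lt_reg_r with (Rabs h); trivial; nra.
  - pose proof (im_le_Cmod (f (x + h, y)%R - f (x, y) - l * (h, 0%R))) as K.
    replace (Im (f ((x + h)%R, y) - f (x, y) - l * (h, 0%R))%C)
      with (((Im (f ((x + h)%R, y))%C - Im (f (x, y))%C) / h - Im l) * h)%R in K.
    2: { unfold Re, Im, Cminus, Cplus, Copp, Cmult; simpl; field; trivial. }
    rewrite Rabs_mult in K.
    apply Rmult_lt_reg_r with (Rabs h); trivial; nra.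
Qed.

(** Together with [cderiv_Re_x] these are the Cauchy-Riemann equations. Since
    [i (y - i x) = x + i y], the vertical derivatives of [f] are the horizontal ones of
    [w |-> f (i w)] at [y - i x]. *)
Lemma cderiv_Re_y f x y l : cderiv f (x, y) l ->
  is_derive (fun s : R => Re (f (x, s))%C) y (- Im l)%R /\
  is_derive (fun s : R => Im (f (x, s))%C) y (Re l).
Proof.
  intros Hf.
  assert (cderiv (fun w => f (Ci * w)) (y, (- x)%R) (l * Ci)) as Hg.
  { apply cderiv_comp with (f := f) (g := fun w => Ci * w).
    - replace (Ci * (y, (- x)%R)) with (x, y); trivial.
      unfold Cmult, Ci; simpl; f_equal; ring.
    - pose proof (cderiv_mult _ _ (y, (- x)%R) _ _
        (cderiv_const Ci (y, (- x)%R)) (cderiv_id (y, (- x)%R))) as K; cbv beta in K.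
      replace (0 * (y, (- x)%R) + Ci * 1) with Ci in K by ring; exact K. }
  destruct (cderiv_Re_x _ _ _ _ Hg) as [H1 H2].
  assert (forall s : R, Ci * (s, (- x)%R) = (x, s)) as E.
  { intros s; unfold Cmult, Ci; simpl; f_equal; ring. }
  split.
  - apply is_derive_ext with (fun s => Re (f (Ci * (s, (- x)%R)))%C).
    { intros t; now rewrite E. }
    replace (- Im l)%R with (Re (l * Ci)%C); trivial.
    unfold Cmult, Ci, Re, Im; simpl; ring.
  - apply is_derive_ext with (fun s => Im (f (Ci * (s, (- x)%R)))%C).
    { intros t; now rewrite E. }
    replace (Re l) with (Im (l * Ci)%C); trivial.
    unfold Cmult, Ci, Re, Im; simpl; ring.
Qed.

Lemma ccont_continuity_2d f x y : ccont f (x, y) ->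
  continuity_2d_pt (fun u v => Re (f (u, v))%C) x y /\
  continuity_2d_pt (fun u v => Im (f (u, v))%C) x y.
Proof.
  intros Hf.
  assert (forall eps : posreal, exists d : posreal, forall u v : R,
    (Rabs (u - x) < d)%R -> (Rabs (v - y) < d)%R ->
    (Cmod (f (u, v) - f (x, y))%C < eps)%R) as K.
  { intros [eps He]; destruct (Hf (eps / 2)%R) as [d [Hd H]]; [lra|].
    assert (0 < d / 2)%R as Hd2 by lra.
    exists (mkposreal _ Hd2); simpl; intros u v Hu Hv.
    specialize (H ((u - x)%R, (v - y)%R)).
    replace ((x, y) + ((u - x)%R, (v - y)%R)) with (u, v) in H
      by (unfold Cplus; simpl; f_equal; ring).
    eapply Rle_lt_trans; [apply H|lra].
    pose proof (Cmod_triangle (RtoC (u - x)) (Ci * RtoC (v - y))) as T.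
    rewrite Cmod_mult, !Cmod_R in T.
    replace (RtoC (u - x) + Ci * RtoC (v - y)) with ((u - x)%R, (v - y)%R) in T
      by (unfold Cplus, Cmult, Ci, RtoC; simpl; f_equal; ring).
    rewrite Cmod_Ci in T; lra. }
  split; intros eps; destruct (K eps) as [d Hd]; exists d; intros u v Hu Hv;
    specialize (Hd u v Hu Hv).
  - eapply Rle_lt_trans; [|exact Hd].
    apply (re_le_Cmod (f (u, v) - f (x, y))).
  - eapply Rle_lt_trans; [|exact Hd].
    apply (im_le_Cmod (f (u, v) - f (x, y))).
Qed.

(** * Entire power series *)

Notation is_Cseries := (is_series (V := C_NormedModule)).

Lemma sum_n_components (a : nat -> C) n :
  sum_n (G := C_AbelianMonoid) a n = (sum_n (fun k => Re (a k)%C) n, sum_n (fun k => Im (a k)%C) n).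
Proof.
  induction n as [|n IH].
  - rewrite !sum_O; apply surjective_pairing.
  - rewrite !sum_Sn, IH; reflexivity.
Qed.

Lemma is_Cseries_components (a : nat -> C) (l : C) :
  is_Cseries a l <->
  is_series (fun k => Re (a k)%C) (Re l) /\ is_series (fun k => Im (a k)%C) (Im l).
Proof.
  unfold is_series; split.
  - intros H; split; apply filterlim_locally; intros eps;
      generalize (proj1 (filterlim_locally _ _) H eps);
      apply filter_imp; intros n Hn;
      (change (ball (M := prod_UniformSpace R_UniformSpace R_UniformSpace) l eps
         (sum_n (G := C_AbelianMonoid) a n)) in Hn);
      rewrite sum_n_components in Hn; apply Hn.
  - intros [H1 H2]; apply filterlim_locally; intros eps.
    generalize (filter_and _ _ (proj1 (filterlim_locally _ _) H1 eps)
      (proj1 (filterlim_locally _ _) H2 eps)).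
    apply filter_imp; intros n Hn.
    change (ball (M := prod_UniformSpace R_UniformSpace R_UniformSpace) l eps
         (sum_n (G := C_AbelianMonoid) a n)).
    rewrite sum_n_components; exact Hn.
Qed.

Lemma is_Cseries_unique (a : nat -> C) l m : is_Cseries a l -> is_Cseries a m -> l = m.
Proof.
  intros H1 H2; apply is_Cseries_components in H1; apply is_Cseries_components in H2.
  destruct H1 as [A1 A2], H2 as [B1 B2].
  apply is_series_unique in A1; apply is_series_unique in A2.
  apply is_series_unique in B1; apply is_series_unique in B2.
  destruct l, m; unfold Re, Im in *; simpl in *; congruence.
Qed.

(* Restated with the operations of [C] itself, which [ring] recognises. *)
Lemma is_Cseries_ext (a b : nat -> C) l :
  (forall n, a n = b n) -> is_Cseries a l -> is_Cseries b l.
Proof. exact (is_series_ext (V := C_NormedModule) a b l). Qed.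

Lemma is_Cseries_decr_1 (a : nat -> C) l :
  is_Cseries (fun n => a (S n)) (l - a 0%nat) -> is_Cseries a l.
Proof. exact (is_series_decr_1 (V := C_NormedModule) a l). Qed.

Lemma is_Cseries_plus (a b : nat -> C) l m : is_Cseries a l -> is_Cseries b m ->
  is_Cseries (fun n => a n + b n) (l + m).
Proof. exact (is_series_plus (V := C_NormedModule) a b l m). Qed.

Lemma is_Cseries_minus (a b : nat -> C) l m : is_Cseries a l -> is_Cseries b m ->
  is_Cseries (fun n => a n - b n) (l - m).
Proof. exact (is_series_minus (V := C_NormedModule) a b l m). Qed.

Lemma is_Cseries_scal (k : C) (a : nat -> C) l : is_Cseries a l ->
  is_Cseries (fun n => k * a n) (k * l).
Proof. exact (is_series_scal (V := C_NormedModule) k a l). Qed.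

Definition Cseries (a : nat -> C) : C :=
  (Series (fun k => Re (a k)%C), Series (fun k => Im (a k)%C)).

Lemma Cseries_correct (a : nat -> C) (b : nat -> R) :
  (forall n, (Cmod (a n)%C <= b n)%R) -> ex_series b -> is_Cseries a (Cseries a).
Proof.
  intros H Hb; apply is_Cseries_components; split; apply Series_correct;
    apply (ex_series_le (V := R_CompleteNormedModule) _ b); trivial;
    intros n; unfold norm; simpl; unfold abs; simpl;
    (eapply Rle_trans; [|apply H]); [apply re_le_Cmod | apply im_le_Cmod].
Qed.

Lemma is_Cseries_le (a : nat -> C) l (b : nat -> R) M :
  is_Cseries a l -> (forall n, (Cmod (a n)%C <= b n)%R) -> is_series b M -> (Cmod l <= M)%R.
Proof.
  intros Ha H Hb.
  assert (forall n, Cmod (sum_n (G := C_AbelianMonoid) a n)%C <= sum_n b n)%R as K.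
  { induction n as [|n IH].
    - rewrite !sum_O; apply H.
    - rewrite !sum_Sn; eapply Rle_trans; [apply Cmod_triangle|].
      apply Rplus_le_compat; trivial. }
  apply (filterlim_le (F := eventually)
    (fun n => Cmod (sum_n (G := C_AbelianMonoid) a n)%C) (sum_n b) (Cmod l) M).
  - now apply filter_forall.
  - apply (filterlim_comp _ _ _ _ Cmod _ _ _ Ha).
    apply (filterlim_norm (K := C_AbsRing) (V := C_NormedModule)).
  - exact Hb.
Qed.

Lemma is_series_zero : is_series (fun _ : nat => 0%R) 0%R.
Proof.
  unfold is_series; apply filterlim_ext with (fun _ : nat => 0%R).
  - intros n; rewrite sum_n_const; ring.
  - apply filterlim_const.
Qed.

(** Infinite radius of convergence, stated as boundedness of the terms on every circle: in this form
    it passes to shifts, derivatives and difference quotients by a mere change of [r]. *)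
Definition entire_coef (c : nat -> C) : Prop :=
  forall r : R, (0 < r)%R -> exists M : R, forall n, (Cmod (c n)%C * r ^ n <= M)%R.

Definition power_series (c : nat -> C) (z : C) : C := Cseries (fun n => c n * z ^ n).

Lemma Cmod_pow_le z r n : (Cmod z <= r)%R -> (Cmod (z ^ n)%C <= r ^ n)%R.
Proof.
  intros H; rewrite Cmod_pow; apply pow_incr; split; trivial; apply Cmod_ge_0.
Qed.

Lemma is_series_half M : is_series (fun n => M * (1 / 2) ^ n)%R (2 * M)%R.
Proof.
  replace (2 * M)%R with (scal M (/ (1 - 1 / 2)))%R.
  - apply (is_series_scal (K := R_AbsRing) (V := R_NormedModule) M
      (fun n => (1 / 2) ^ n)%R), is_series_geom.
    rewrite Rabs_pos_eq; lra.
  - unfold scal; simpl; unfold mult; simpl; field.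
Qed.

Lemma entire_term_bound c r : entire_coef c -> (0 <= r)%R ->
  exists M : R, forall n z, (Cmod z <= r)%R -> (Cmod (c n * z ^ n)%C <= M * (1 / 2) ^ n)%R.
Proof.
  (* Doubling the radius yields the geometric factor; the 1 keeps the radius positive when
     [r = 0]. *)
  intros Hc Hr; destruct (Hc (2 * r + 1)%R) as [M HM]; [lra|].
  exists M; intros n z Hz; rewrite Cmod_mult.
  apply Rle_trans with (Cmod (c n)%C * (2 * r + 1) ^ n * (1 / 2) ^ n)%R.
  - rewrite Rmult_assoc, <- Rpow_mult_distr.
    apply Rmult_le_compat_l; [apply Cmod_ge_0|].
    apply Cmod_pow_le; lra.
  - apply Rmult_le_compat_r; [apply pow_le; lra | apply HM].
Qed.

Lemma power_series_correct c z : entire_coef c -> is_Cseries (fun n => c n * z ^ n) (power_series c z).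
Proof.
  intros Hc.
  destruct (entire_term_bound c (Cmod z) Hc (Cmod_ge_0 z)) as [M HM].
  apply Cseries_correct with (fun n => M * (1 / 2) ^ n)%R.
  - intros n; apply HM; lra.
  - eexists; apply is_series_half.
Qed.

(** The terms of a convergent series are bounded, and the series may be evaluated at the positive
    real number [r]. *)
Lemma entire_coef_of_series c (f : C -> C) :
  (forall z, is_Cseries (fun n => c n * z ^ n) (f z)) -> entire_coef c.
Proof.
  intros H r Hr.
  assert (ex_series (fun n => Re (c n * RtoC r ^ n)%C)) as E1
    by (eexists; apply (proj1 (is_Cseries_components _ _) (H r))).
  assert (ex_series (fun n => Im (c n * RtoC r ^ n)%C)) as E2
    by (eexists; apply (proj1 (is_Cseries_components _ _) (H r))).
  assert (forall u : nat -> R, ex_series u -> exists M, forall n, Rabs (u n) <= M)%R as B.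
  { intros u Hu; apply ex_series_lim_0 in Hu.
    destruct (filterlim_bounded u) as [M HM]; [now exists 0%R|].
    now exists M. }
  destruct (B _ E1) as [M1 H1], (B _ E2) as [M2 H2].
  exists (M1 + M2)%R; intros n.
  replace (Cmod (c n)%C * r ^ n)%R with (Cmod (c n * RtoC r ^ n)%C).
  - specialize (H1 n); specialize (H2 n); revert H1 H2.
    generalize (c n * RtoC r ^ n)%C; intros w H1 H2.
    replace w with (RtoC (Re w) + Ci * RtoC (Im w)) at 1.
    + eapply Rle_trans; [apply Cmod_triangle|].
      rewrite Cmod_mult, !Cmod_R, Cmod_Ci; lra.
    + destruct w; unfold Cplus, Cmult, Ci, RtoC, Re, Im; simpl; f_equal; ring.
  - rewrite Cmod_mult, Cmod_pow, Cmod_R, (Rabs_pos_eq r); lra.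
Qed.

Definition deriv_coef (c : nat -> C) (n : nat) : C := RtoC (INR (S n)) * c (S n).

Lemma INR_le_pow2 n : (INR n <= 2 ^ n)%R.
Proof.
  induction n as [|n IH]; [simpl; lra|].
  rewrite S_INR; simpl.
  assert (1 <= 2 ^ n)%R by (apply pow_R1_Rle; lra); lra.
Qed.

Lemma entire_deriv_coef c : entire_coef c -> entire_coef (deriv_coef c).
Proof.
  intros Hc r Hr; destruct (Hc (2 * r)%R) as [M HM]; [lra|].
  exists (M / r)%R; intros n; unfold deriv_coef.
  rewrite Cmod_mult, Cmod_R, Rabs_pos_eq by apply pos_INR.
  specialize (HM (S n)); rewrite Rpow_mult_distr in HM.
  apply Rmult_le_reg_r with r; trivial.
  replace (M / r * r)%R with M by (field; lra).
  eapply Rle_trans; [|exact HM].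
  replace (INR (S n) * Cmod (c (S n))%C * r ^ n * r)%R
    with (Cmod (c (S n))%C * (INR (S n) * r ^ S n))%R by (simpl; ring).
  apply Rmult_le_compat_l; [apply Cmod_ge_0|].
  apply Rmult_le_compat_r; [apply pow_le; lra | apply INR_le_pow2].
Qed.

Definition monomial_derivative (z : C) (n : nat) : C :=
  match n with O => 0 | S m => RtoC (INR n) * z ^ m end.

Lemma monomial_derivative_S z n : monomial_derivative z (S n) = z ^ n + z * monomial_derivative z n.
Proof.
  destruct n as [|n]; [simpl; ring|].
  unfold monomial_derivative; rewrite (S_INR (S n)), RtoC_plus; simpl (z ^ S n); ring.
Qed.

(** With remainder [E n] and [d n] the derivative of the monomial,
    [E (n + 1) = (z + h) * E n + d n * h ^ 2]. The crude factor [n ^ 2] survives the induction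
    because [n ^ 2 * r + n <= (n + 1) ^ 2 * r] for [r >= 1]. *)
Lemma pow_taylor_bound z h r n : (1 <= r)%R -> (Cmod z + Cmod h <= r)%R ->
  (Cmod ((z + h) ^ n - z ^ n - monomial_derivative z n * h)%C <= INR n ^ 2 * r ^ n * Cmod h ^ 2)%R.
Proof.
  intros Hr Hz.
  pose proof (Cmod_ge_0 z) as Pz; pose proof (Cmod_ge_0 h) as Ph.
  assert (forall n, Cmod (monomial_derivative z n)%C <= INR n * r ^ n)%R as Hd.
  { intros [|m]; [simpl; rewrite Cmod_0; lra|].
    unfold monomial_derivative; rewrite Cmod_mult, Cmod_R, Rabs_pos_eq by apply pos_INR.
    apply Rmult_le_compat_l; [apply pos_INR|].
    apply Rle_trans with (r ^ m)%R; [apply Cmod_pow_le; lra|].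
    apply Rle_pow; [trivial | lia]. }
  induction n as [|n IH].
  - simpl; replace (1 - 1 - 0 * h) with (RtoC 0) by ring.
    rewrite Cmod_0; lra.
  - rewrite monomial_derivative_S.
    replace ((z + h) ^ S n - z ^ S n - (z ^ n + z * monomial_derivative z n) * h) with
      ((z + h) * ((z + h) ^ n - z ^ n - monomial_derivative z n * h) + monomial_derivative z n * (h * h))
      by (simpl; ring).
    eapply Rle_trans; [apply Cmod_triangle|].
    rewrite !Cmod_mult.
    assert (0 < r ^ n)%R as Hrn by (apply pow_lt; lra).
    assert (Cmod (z + h)%C <= r)%R as Hzh by (eapply Rle_trans; [apply Cmod_triangle | lra]).
    pose proof (pos_INR n) as Pn.
    apply Rle_trans with (r * (INR n ^ 2 * r ^ n * Cmod h ^ 2)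
       + (INR n * r ^ n) * (Cmod h * Cmod h))%R.
    + apply Rplus_le_compat.
      * apply Rmult_le_compat; trivial; apply Cmod_ge_0.
      * apply Rmult_le_compat_r; [nra | apply Hd].
    + rewrite S_INR; simpl (r ^ S n)%R.
      assert (0 <= r ^ n * Cmod h ^ 2)%R as P by (apply Rmult_le_pos; [lra | nra]).
      replace (r * (INR n ^ 2 * r ^ n * Cmod h ^ 2) + INR n * r ^ n * (Cmod h * Cmod h))%R
        with ((INR n ^ 2 * r + INR n) * (r ^ n * Cmod h ^ 2))%R by ring.
      replace ((INR n + 1) ^ 2 * (r * r ^ n) * Cmod h ^ 2)%R
        with ((INR n + 1) ^ 2 * r * (r ^ n * Cmod h ^ 2))%R by ring.
      apply Rmult_le_compat_r; trivial; nra.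
Qed.

Lemma power_series_derive c z : entire_coef c -> cderiv (power_series c) z (power_series (deriv_coef c) z).
Proof.
  intros Hc eps He.
  pose proof (Cmod_ge_0 z) as Pz.
  set (r := (Cmod z + 1)%R).
  (* Of the three factors [2 ^ n] in [8 ^ n], two absorb the [n ^ 2] of the Taylor bound and the
     third leaves a geometric series. *)
  destruct (Hc (8 * r)%R) as [M HM]; [unfold r; lra|].
  assert (0 <= M)%R as PM.
  { eapply Rle_trans; [|apply (HM 0%nat)].
    apply Rmult_le_pos; [apply Cmod_ge_0 | simpl; lra]. }
  exists (Rmin 1 (eps / (2 * M + 1))); split.
  { apply Rmin_pos; [lra | apply Rdiv_lt_0_compat; lra]. }
  intros h Hh; apply Rmin_Rgt_l in Hh; destruct Hh as [Hh1 Hh2].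
  pose proof (Cmod_ge_0 h) as Ph.
  assert (is_Cseries (fun n => c n * ((z + h) ^ n - z ^ n - monomial_derivative z n * h))
            (power_series c (z + h) - power_series c z - power_series (deriv_coef c) z * h)) as HS.
  { assert (is_Cseries (fun n => c n * monomial_derivative z n) (power_series (deriv_coef c) z)) as Hd.
    { apply is_Cseries_decr_1.
      apply is_Cseries_ext with (fun n => deriv_coef c n * z ^ n).
      { intros n; unfold deriv_coef, monomial_derivative; ring. }
      replace (power_series (deriv_coef c) z - c 0%nat * monomial_derivative z 0) with (power_series (deriv_coef c) z)
        by (simpl; ring).
      apply power_series_correct, entire_deriv_coef, Hc. }
    apply is_Cseries_ext with (fun n =>
      c n * (z + h) ^ n - c n * z ^ n - h * (c n * monomial_derivative z n)).
    { intros n; ring. }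
    replace (power_series c (z + h) - power_series c z - power_series (deriv_coef c) z * h) with
      (power_series c (z + h) - power_series c z - h * power_series (deriv_coef c) z) by ring.
    apply is_Cseries_minus.
    - apply is_Cseries_minus; apply power_series_correct, Hc.
    - apply is_Cseries_scal, Hd. }
  apply Rle_trans with (2 * (M * Cmod h ^ 2))%R.
  - refine (is_Cseries_le _ _ _ _ HS _ (is_series_half _)).
    intros n; rewrite Cmod_mult.
    eapply Rle_trans.
    { apply Rmult_le_compat_l; [apply Cmod_ge_0|].
      apply (pow_taylor_bound z h r n); unfold r; lra. }
    specialize (HM n); rewrite Rpow_mult_distr in HM.
    replace (8 ^ n)%R with (2 ^ n * 2 ^ n * 2 ^ n)%R in HM
      by (rewrite <- !Rpow_mult_distr; f_equal; ring).
    replace (1 / 2)%R with (/ 2)%R by field; rewrite pow_inv.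
    assert (0 < 2 ^ n)%R as P2 by (apply pow_lt; lra).
    apply Rmult_le_reg_r with (2 ^ n)%R; trivial.
    replace (M * Cmod h ^ 2 * / 2 ^ n * 2 ^ n)%R with (M * Cmod h ^ 2)%R by (field; lra).
    apply Rle_trans with (Cmod (c n)%C * (2 ^ n * 2 ^ n * 2 ^ n * r ^ n) * Cmod h ^ 2)%R.
    + replace (Cmod (c n)%C * (INR n ^ 2 * r ^ n * Cmod h ^ 2) * 2 ^ n)%R
        with (Cmod (c n)%C * (INR n ^ 2 * 2 ^ n * r ^ n) * Cmod h ^ 2)%R by ring.
      apply Rmult_le_compat_r; [nra|].
      apply Rmult_le_compat_l; [apply Cmod_ge_0|].
      apply Rmult_le_compat_r; [apply pow_le; unfold r; lra|].
      apply Rmult_le_compat_r; [lra|].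
      pose proof (INR_le_pow2 n); pose proof (pos_INR n); nra.
    + apply Rmult_le_compat_r; [nra | exact HM].
  - assert (Cmod h * (2 * M + 1) <= eps)%R as K.
    { apply Rmult_lt_compat_r with (r := (2 * M + 1)%R) in Hh2; [|lra].
      replace (eps / (2 * M + 1) * (2 * M + 1))%R with eps in Hh2 by (field; lra). lra. }
    nra.
Qed.

Lemma power_series_ccont c z : entire_coef c -> ccont (power_series c) z.
Proof.
  intros Hc; eapply cderiv_ccont, power_series_derive, Hc.
Qed.

(* The Taylor coefficients at 0 of the difference quotient
   [s |-> (power_series c s - power_series c t) / (s - t)]. *)
Definition quot_coef (c : nat -> C) (t : C) (i : nat) : C :=
  power_series (fun n => c (S (n + i))) t.

Lemma entire_shift c i : entire_coef c -> entire_coef (fun n => c (S (n + i))).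
Proof.
  intros Hc r Hr; destruct (Hc r Hr) as [M HM].
  exists (M / r ^ S i)%R; intros n.
  assert (0 < r ^ S i)%R by now apply pow_lt.
  apply Rmult_le_reg_r with (r ^ S i)%R; trivial.
  replace (M / r ^ S i * r ^ S i)%R with M by (field; lra).
  rewrite Rmult_assoc, <- pow_add.
  replace (n + S i)%nat with (S (n + i)) by lia; apply HM.
Qed.

Lemma entire_quot_coef c t : entire_coef c -> entire_coef (quot_coef c t).
Proof.
  intros Hc r Hr.
  pose proof (Cmod_ge_0 t) as Pt.
  (* Chosen so that both [r <= R0] and [Cmod t <= R0 / 2]: the first controls the power of [r], the
     second gives the geometric factor of the inner series. *)
  set (R0 := (r + 2 * Cmod t)%R).
  assert (0 < R0)%R as HR by (unfold R0; lra).
  destruct (Hc R0 HR) as [M HM].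
  exists (2 * (M / R0))%R; intros i; unfold quot_coef.
  assert (0 < r ^ i)%R as Pri by now apply pow_lt.
  replace (Cmod (power_series (fun n => c (S (n + i))) t)%C * r ^ i)%R
    with (Cmod (RtoC (r ^ i) * power_series (fun n => c (S (n + i))) t)%C).
  2: rewrite Cmod_mult, Cmod_R, Rabs_pos_eq; lra.
  refine (is_Cseries_le _ _ _ _
    (is_Cseries_scal _ _ _ (power_series_correct _ t (entire_shift c i Hc))) _ (is_series_half _)).
  intros n; rewrite !Cmod_mult, Cmod_R, Rabs_pos_eq by lra.
  specialize (HM (S (n + i))).
  apply Rmult_le_reg_r with R0; trivial.
  replace (M / R0 * (1 / 2) ^ n * R0)%R with (M * (1 / 2) ^ n)%R by (field; lra).
  eapply Rle_trans; [|apply Rmult_le_compat_r; [apply pow_le; lra | exact HM]].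
  replace (r ^ i * (Cmod (c (S (n + i)))%C * Cmod (t ^ n)%C) * R0)%R
    with (Cmod (c (S (n + i)))%C * (r ^ i * (Cmod (t ^ n)%C * R0)))%R by ring.
  rewrite Rmult_assoc; apply Rmult_le_compat_l; [apply Cmod_ge_0|].
  replace (R0 ^ S (n + i) * (1 / 2) ^ n)%R with (R0 ^ i * ((R0 * (1 / 2)) ^ n * R0))%R
    by (rewrite Rpow_mult_distr; simpl; rewrite pow_add; ring).
  apply Rmult_le_compat.
  - lra.
  - apply Rmult_le_pos; [apply Cmod_ge_0 | lra].
  - apply pow_incr; unfold R0; lra.
  - apply Rmult_le_compat_r; [lra|]; apply Cmod_pow_le; unfold R0; lra.
Qed.

Lemma power_series_shift c t : entire_coef c ->
  power_series c t = c 0%nat + t * power_series (fun n => c (S n)) t.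
Proof.
  intros Hc.
  apply is_Cseries_unique with (fun n => c n * t ^ n); [now apply power_series_correct|].
  apply is_Cseries_decr_1.
  apply is_Cseries_ext with (fun n => t * (c (S n) * t ^ n)).
  { intros n; simpl; ring. }
  replace (c 0%nat + t * power_series (fun n => c (S n)) t - c 0%nat * t ^ 0)
    with (t * power_series (fun n => c (S n)) t) by (simpl; ring).
  apply is_Cseries_scal, power_series_correct.
  intros r Hr; destruct (entire_shift c 0 Hc r Hr) as [M HM].
  exists M; intros n; specialize (HM n); rewrite Nat.add_0_r in HM; exact HM.
Qed.

Lemma power_series_ext c d z : (forall n, c n = d n) -> power_series c z = power_series d z.
Proof.
  intros H; unfold power_series, Cseries; f_equal; apply Series_ext; intros n; now rewrite H.
Qed.

Lemma quot_coef_rec c t i : entire_coef c ->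
  quot_coef c t i = c (S i) + t * quot_coef c t (S i).
Proof.
  intros Hc; unfold quot_coef at 1; rewrite power_series_shift by now apply entire_shift.
  unfold quot_coef; do 2 f_equal.
  apply power_series_ext; intros n; f_equal; lia.
Qed.

(** Synthetic division by [s - t]: [quot_coef_rec] is Horner's recursion, so that after multiplying
    out, all coefficients of positive index agree and the constant one differs by the value at
    [t]. *)
Lemma power_series_quotient c s t : entire_coef c ->
  power_series c s - power_series c t = (s - t) * power_series (quot_coef c t) s.
Proof.
  intros Hc.
  pose proof (entire_quot_coef c t Hc) as Hq.
  assert (quot_coef c t 0 * t = power_series c t - c 0%nat) as E0.
  { rewrite (power_series_shift c t Hc).
    replace (quot_coef c t 0) with (power_series (fun n => c (S n)) t); [ring|].
    apply power_series_ext; intros n; do 2 f_equal; lia. }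
  apply is_Cseries_unique with
    (fun n => c n * s ^ n - match n with O => power_series c t | _ => 0 end).
  - apply is_Cseries_minus; [now apply power_series_correct|].
    apply is_Cseries_decr_1; replace (power_series c t - power_series c t) with (RtoC 0) by ring.
    apply is_Cseries_components; split; apply is_series_zero.
  - replace ((s - t) * power_series (quot_coef c t) s) with
      (s * power_series (quot_coef c t) s - t * power_series (quot_coef c t) s) by ring.
    apply is_Cseries_ext with (fun n =>
      match n with O => 0 | S m => quot_coef c t m * s ^ n end - t * (quot_coef c t n * s ^ n)).
    { intros [|n]; simpl.
      - replace (t * (quot_coef c t 0 * 1)) with (quot_coef c t 0 * t) by ring.
        rewrite E0; ring.
      - rewrite (quot_coef_rec c t n Hc); ring. }
    apply is_Cseries_minus.
    + apply is_Cseries_decr_1.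
      apply is_Cseries_ext with (fun n => s * (quot_coef c t n * s ^ n)).
      { intros n; simpl; ring. }
      replace (s * power_series (quot_coef c t) s - 0) with (s * power_series (quot_coef c t) s) by ring.
      apply is_Cseries_scal; now apply power_series_correct.
    + apply is_Cseries_scal; now apply power_series_correct.
Qed.

Lemma cderiv_unique f z l m : cderiv f z l -> cderiv f z m -> l = m.
Proof.
  intros Hl Hm; destruct z as [x y].
  destruct (cderiv_Re_x _ _ _ _ Hl) as [L1 L2].
  destruct (cderiv_Re_x _ _ _ _ Hm) as [M1 M2].
  apply is_derive_unique in L1; apply is_derive_unique in L2.
  apply is_derive_unique in M1; apply is_derive_unique in M2.
  destruct l, m; unfold Re, Im in *; simpl in *; congruence.
Qed.

(** Both sides are the derivative at [s = t] of the function written as its value at [t] plus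
    [s - t] times the difference quotient. *)
Lemma power_series_derive_quotient c t : entire_coef c -> power_series (deriv_coef c) t = power_series (quot_coef c t) t.
Proof.
  intros Hc; apply (cderiv_unique (power_series c) t); [now apply power_series_derive|].
  pose proof (power_series_derive _ t (entire_quot_coef c t Hc)) as Hq.
  apply cderiv_ext with (fun s => power_series c t + (s + (- t)) * power_series (quot_coef c t) s).
  { intros w; pose proof (power_series_quotient c w t Hc) as E.
    replace (w + - t) with (w - t) by ring; rewrite <- E; ring. }
  pose proof (cderiv_plus _ _ _ _ _ (cderiv_const (power_series c t) t)
    (cderiv_mult _ _ _ _ _ (cderiv_plus _ _ _ _ _ (cderiv_id t) (cderiv_const (- t) t)) Hq)) as K.
  cbv beta in K.
  replace (0 + ((1 + 0) * power_series (quot_coef c t) t + (t + - t) * power_series (deriv_coef (quot_coef c t)) t))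
    with (power_series (quot_coef c t) t) in K by ring.
  exact K.
Qed.

Open Scope R_scope.

(** * Cauchy's theorem for a rectangle *)

Lemma continuity_2d_continuous_y (f : R -> R -> R) x y :
  continuity_2d_pt f x y -> continuous (f x) y.
Proof.
  intros H; apply filterlim_locally; intros eps.
  destruct (H eps) as [d Hd]; exists d; intros z Hz.
  apply Hd; [rewrite Rminus_eq_0, Rabs_R0; apply cond_pos | exact Hz].
Qed.

Lemma ex_RInt_2d (f : R -> R -> R) x a b :
  (forall y, continuity_2d_pt f x y) -> ex_RInt (f x) a b.
Proof.
  intros H; apply (ex_RInt_continuous (V := R_CompleteNormedModule)); intros y _.
  apply continuity_2d_continuous_y, H.
Qed.

Lemma RInt_odd (f : R -> R) Y :
  ex_RInt f (- Y) Y -> (forall y, f (- y) = - f y) -> RInt f (- Y) Y = 0.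
Proof.
  intros Hf Ho.
  assert (RInt f (- Y) Y = RInt f Y (- Y)) as E.
  { apply is_RInt_unique, (is_RInt_ext (fun y => opp (f (- y)))).
    - intros y _; rewrite Ho; unfold opp; simpl; ring.
    - apply (is_RInt_comp_opp (V := R_NormedModule)); rewrite Ropp_involutive.
      apply (RInt_correct (V := R_CompleteNormedModule)), ex_RInt_swap, Hf. }
  pose proof (opp_RInt_swap (V := R_CompleteNormedModule) f _ _ Hf) as S.
  unfold opp in S; simpl in S; lra.
Qed.

Section Rectangle.

Variables (u v w : R -> R -> R) (X : R).
Hypothesis Hux : forall x y, 0 < x < X -> is_derive (fun s => u s y) x (w x y).
Hypothesis Hvy : forall x y, 0 < x < X -> is_derive (fun s => v x s) y (w x y).
Hypothesis Hw : forall x y, 0 < x < X -> continuity_2d_pt w x y.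
Hypothesis Hu : forall x y, 0 <= x < X -> continuity_2d_pt u x y.

(** Cauchy's theorem in differential form: by the equation [u_x = v_y], the derivative under the
    integral sign is an exact derivative in [y], and only the end values of [v] remain. *)
Lemma vertical_integral_derive Y x : 0 < x < X ->
  is_derive (fun s => RInt (u s) (- Y) Y) x (v x Y - v x (- Y)).
Proof.
  intros Hx.
  assert (locally x (fun s => 0 < s < X)) as L.
  { apply (locally_interval _ x 0 X); simpl; tauto. }
  replace (v x Y - v x (- Y)) with (RInt (fun t => Derive (fun s => u s t) x) (- Y) Y).
  - apply (is_derive_RInt_param u (- Y) Y x).
    + generalize L; apply filter_imp; intros s Hs t _; eexists; now apply Hux.
    + intros t _; apply (continuity_2d_pt_ext_loc w); [|now apply Hw].
      destruct L as [d Hd]; exists d; intros s t' Hs _.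
      symmetry; apply is_derive_unique, Hux, Hd, Hs.
    + generalize L; apply filter_imp; intros s Hs.
      apply ex_RInt_2d; intros y; apply Hu; lra.
  - rewrite (RInt_ext _ (w x)).
    + apply is_RInt_unique, (is_RInt_derive (fun s => v x s)).
      * intros y _; now apply Hvy.
      * intros y _; now apply continuity_2d_continuous_y, Hw.
    + intros y _; now apply is_derive_unique, Hux.
Qed.

(** Oddness makes the integral over the edge [x = 0] vanish. On that edge, where the cancelled pole
    sits, [u] is only known to be continuous; hence the mean value theorem is applied from a small
    positive abscissa [c], at which uniform continuity makes the integral at most [eps]. *)
Lemma odd_vertical_integral_le Y e x0 : 0 < Y -> 0 < x0 < X ->
  (forall y, u 0 (- y) = - u 0 y) ->
  (forall x, 0 < x <= x0 -> Rabs (v x Y) <= e /\ Rabs (v x (- Y)) <= e) ->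
  Rabs (RInt (u x0) (- Y) Y) <= 2 * e * x0.
Proof.
  intros HY Hx0 Hodd He.
  assert (forall x, 0 <= x < X -> ex_RInt (u x) (- Y) Y) as Ex.
  { intros x Hx; apply ex_RInt_2d; intros y; now apply Hu. }
  assert (0 <= e) as Pe.
  { apply Rle_trans with (Rabs (v x0 Y)); [apply Rabs_pos | apply He; lra]. }
  apply le_epsilon; intros eps Heps.
  set (I := fun s => RInt (u s) (- Y) Y).
  assert (exists c, 0 < c < x0 /\ Rabs (I c) <= eps) as [c [Hc Ic]].
  { assert (0 < eps / (2 * Y)) as Pd by (apply Rdiv_lt_0_compat; lra).
    destruct (uniform_continuity_2d_1d' u (- Y) Y 0) with (mkposreal _ Pd) as [d Hd].
    { intros y Hy; apply Hu; lra. }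
    set (c := Rmin (d / 2) (x0 / 2)).
    pose proof (cond_pos d) as Pdd.
    assert (0 < c) by (apply Rmin_pos; lra).
    assert (c <= d / 2) by apply Rmin_l.
    assert (c <= x0 / 2) by apply Rmin_r.
    exists c; split; [lra|].
    assert (I 0 = 0) as I0 by (apply RInt_odd; trivial; apply Ex; lra).
    replace (I c) with (RInt (fun y => minus (u c y) (u 0 y)) (- Y) Y).
    - replace eps with ((Y - - Y) * (eps / (2 * Y))) by (field; lra).
      apply abs_RInt_le_const; [lra| |].
      + apply (ex_RInt_minus (V := R_NormedModule)); apply Ex; lra.
      + intros y Hy; left; unfold minus, plus, opp; simpl.
        apply (Hd y 0 y c); try lra.
        rewrite Rminus_eq_0, Rabs_R0; lra.
    - rewrite (RInt_minus (V := R_CompleteNormedModule)) by (apply Ex; lra).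
      fold (I c) (I 0); rewrite I0; unfold minus, plus, opp; simpl; ring. }
  destruct (MVT_gen I c x0 (fun x => v x Y - v x (- Y))) as [z [Hz E]].
  { intros x Hx; rewrite Rmin_left, Rmax_right in Hx by lra.
    apply vertical_integral_derive; lra. }
  { intros x Hx; rewrite Rmin_left, Rmax_right in Hx by lra.
    apply continuity_pt_filterlim, (ex_derive_continuous I).
    eexists; apply vertical_integral_derive; lra. }
  rewrite Rmin_left, Rmax_right in Hz by lra.
  destruct (He z) as [H1 H2]; [lra|].
  fold (I x0); replace (I x0) with (I c + (v z Y - v z (- Y)) * (x0 - c)) by lra.
  eapply Rle_trans; [apply Rabs_triang|].
  rewrite Rabs_mult, (Rabs_pos_eq (x0 - c)) by lra.
  pose proof (Rabs_triang (v z Y) (- v z (- Y))) as T; rewrite Rabs_Ropp in T.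
  unfold Rminus in *.
  assert (Rabs (v z Y + - v z (- Y)) * (x0 + - c) <= 2 * e * x0).
  { apply Rmult_le_compat; try lra; apply Rabs_pos. }
  lra.
Qed.

End Rectangle.

(** * The cosecant kernel *)

Lemma cosh_sinh_sqr y : cosh y * cosh y = 1 + sinh y * sinh y.
Proof.
  unfold cosh, sinh; rewrite exp_Ropp; pose proof (exp_pos y); field; lra.
Qed.

Lemma cosh_pos y : 0 < cosh y.
Proof.
  unfold cosh; pose proof (exp_pos y); pose proof (exp_pos (- y)); lra.
Qed.

Lemma is_derive_cosh y : is_derive cosh y (sinh y).
Proof. apply is_derive_Reals, derivable_pt_lim_cosh. Qed.

Lemma is_derive_sinh y : is_derive sinh y (cosh y).
Proof. apply is_derive_Reals, derivable_pt_lim_sinh. Qed.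

Lemma cosh_opp y : cosh (- y) = cosh y.
Proof. unfold cosh; rewrite Ropp_involutive; field. Qed.

Lemma sinh_opp y : sinh (- y) = - sinh y.
Proof. unfold sinh; rewrite Ropp_involutive; field. Qed.

Lemma sinh_ge_id y : 0 <= y -> y <= sinh y.
Proof.
  intros Hy; destruct (Req_dec y 0) as [->|Hy0]; [rewrite sinh_0; lra|].
  destruct (MVT_gen sinh 0 y cosh) as [z [Hz E]].
  - intros x _; apply is_derive_sinh.
  - intros x _; apply continuity_pt_filterlim, (ex_derive_continuous sinh).
    eexists; apply is_derive_sinh.
  - rewrite sinh_0, Rminus_0_r in E.
    assert (1 <= cosh z).
    { pose proof (cosh_sinh_sqr z); pose proof (cosh_pos z); nra. }
    rewrite E; nra.
Qed.

Lemma sinh_sqr_ge y : y * y <= sinh y * sinh y.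
Proof.
  destruct (Rle_dec 0 y) as [Hy|Hy].
  - pose proof (sinh_ge_id y Hy); nra.
  - pose proof (sinh_ge_id (- y)) as K; rewrite sinh_opp in K; nra.
Qed.

(** With [sinh_sqr_ge] this gives [|sin z| >= |z| / 2] near 0, which measures the pole of the
    cosecant. *)
Lemma sin_sqr_ge x : Rabs x <= 1 -> x * x / 4 <= sin x * sin x.
Proof.
  intros Hx.
  assert (forall t, 0 <= t <= 1 -> t / 2 <= sin t) as K.
  { intros t Ht; destruct (Req_dec t 0) as [->|Ht0]; [rewrite sin_0; lra|].
    destruct (SIN t) as [L _]; [lra | pose proof PI2_1; lra |].
    unfold sin_lb, sin_approx, sin_term in L; simpl in L.
    assert (t * t <= 1) by nra. assert (t * t * t <= t) by nra.
    assert (0 <= t * t * t) by nra.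
    assert (t * t * (t * t * t) >= 0) by nra.
    assert (t * t * (t * t * t) * (t * t) <= t * t * (t * t * t)) by nra.
    lra. }
  destruct (Rle_dec 0 x) as [Px|Px].
  - rewrite Rabs_pos_eq in Hx by trivial; pose proof (K x ltac:(lra)); nra.
  - rewrite Rabs_left in Hx by lra; pose proof (K (- x) ltac:(lra)) as L.
    rewrite sin_neg in L; nra.
Qed.

(* [csc_re] and [csc_im] are the real and imaginary parts of 1 / sin (x + i y). *)
Definition sin_norm2 (x y : R) : R := sin x * sin x + sinh y * sinh y.
Definition csc_re (x y : R) : R := sin x * cosh y / sin_norm2 x y.
Definition csc_im (x y : R) : R := - (cos x * sinh y) / sin_norm2 x y.

(** The real and, below, imaginary part of [- cos z / sin z ^ 2] at [z = x + i y]. *)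
Definition csc'_re (x y : R) : R :=
  cos x * cosh y * (sinh y * sinh y - sin x * sin x) / (sin_norm2 x y * sin_norm2 x y).
Definition csc'_im (x y : R) : R :=
  sin x * sinh y * (sin_norm2 x y + 2 * (cos x * cos x)) / (sin_norm2 x y * sin_norm2 x y).

Lemma csc_partial x y : sin_norm2 x y <> 0 ->
  is_derive (fun s => csc_re s y) x (csc'_re x y) /\
  is_derive (fun s => csc_im s y) x (csc'_im x y) /\
  is_derive (fun s => csc_re x s) y (- csc'_im x y) /\
  is_derive (fun s => csc_im x s) y (csc'_re x y).
Proof.
  intros Hn.
  assert (sin x * sin x + cos x * cos x = 1) as T
    by (pose proof (sin2_cos2 x) as T; unfold Rsqr in T; exact T).
  pose proof (cosh_sinh_sqr y) as H.
  unfold csc_re, csc_im, csc'_re, csc'_im, sin_norm2 in *.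
  split; [|split; [|split]]; auto_derive; trivial; try (field; trivial).
  replace (cos x * cos x) with (1 - sin x * sin x) by lra.
  transitivity (sin x * sinh y * (sin x * sin x + sinh y * sinh y - 2 * (cosh y * cosh y)) /
    ((sin x * sin x + sinh y * sinh y) * (sin x * sin x + sinh y * sinh y))).
  - field; trivial.
  - rewrite H; field; trivial.
Qed.

Lemma sin_norm2_pos x y : 0 < x < PI -> 0 < sin_norm2 x y.
Proof.
  intros Hx; pose proof (sin_gt_0 x) as S; unfold sin_norm2; nra.
Qed.

Lemma csc_sqr x y : sin_norm2 x y <> 0 ->
  csc_re x y * csc_re x y + csc_im x y * csc_im x y = / sin_norm2 x y.
Proof.
  intros Hn; unfold csc_re, csc_im.
  replace (sin x * cosh y / sin_norm2 x y * (sin x * cosh y / sin_norm2 x y) +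
    - (cos x * sinh y) / sin_norm2 x y * (- (cos x * sinh y) / sin_norm2 x y))
    with ((sin x * sin x * (cosh y * cosh y) + cos x * cos x * (sinh y * sinh y))
       / (sin_norm2 x y * sin_norm2 x y)) by (field; trivial).
  replace (sin x * sin x * (cosh y * cosh y) + cos x * cos x * (sinh y * sinh y))
    with (sin_norm2 x y); [field; trivial|].
  rewrite cosh_sinh_sqr; pose proof (sin2_cos2 x) as T; unfold Rsqr in T.
  replace (cos x * cos x) with (1 - sin x * sin x) by lra.
  unfold sin_norm2; ring.
Qed.

Lemma continuity_2d_comp1 (f : R -> R) x y : continuous f x ->
  continuity_2d_pt (fun u _ => f u) x y.
Proof.
  intros H; apply (continuity_1d_2d_pt_comp f (fun u _ => u)).
  - now apply continuity_pt_filterlim.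
  - apply continuity_2d_pt_id1.
Qed.

Lemma continuity_2d_comp2 (f : R -> R) x y : continuous f y ->
  continuity_2d_pt (fun _ v => f v) x y.
Proof.
  intros H; apply (continuity_1d_2d_pt_comp f (fun _ v => v)).
  - now apply continuity_pt_filterlim.
  - apply continuity_2d_pt_id2.
Qed.

Lemma csc_continuity x y : sin_norm2 x y <> 0 ->
  continuity_2d_pt csc_re x y /\ continuity_2d_pt csc_im x y /\
  continuity_2d_pt csc'_re x y /\ continuity_2d_pt csc'_im x y.
Proof.
  intros Hn.
  assert (continuity_2d_pt (fun u _ => sin u) x y) as Cs
    by apply continuity_2d_comp1, continuous_sin.
  assert (continuity_2d_pt (fun u _ => cos u) x y) as Cc
    by apply continuity_2d_comp1, continuous_cos.
  assert (continuity_2d_pt (fun _ v => sinh v) x y) as Csh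
    by (apply continuity_2d_comp2, (ex_derive_continuous sinh); eexists; apply is_derive_sinh).
  assert (continuity_2d_pt (fun _ v => cosh v) x y) as Cch
    by (apply continuity_2d_comp2, (ex_derive_continuous cosh); eexists; apply is_derive_cosh).
  assert (continuity_2d_pt sin_norm2 x y) as Cn
    by (apply continuity_2d_pt_plus; apply continuity_2d_pt_mult; trivial).
  assert (continuity_2d_pt (fun u v => / sin_norm2 u v) x y) as Ci
    by now apply continuity_2d_pt_inv.
  assert (continuity_2d_pt (fun u v => / (sin_norm2 u v * sin_norm2 u v)) x y) as Ci2.
  { apply (continuity_2d_pt_inv (fun u v => sin_norm2 u v * sin_norm2 u v)).
    - now apply continuity_2d_pt_mult.
    - now apply Rmult_integral_contrapositive. }
  unfold csc_re, csc_im, csc'_re, csc'_im, Rdiv.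
  repeat match goal with |- _ /\ _ => split end;
    repeat (assumption || apply continuity_2d_pt_mult || apply continuity_2d_pt_plus
    || apply continuity_2d_pt_minus || apply continuity_2d_pt_opp
    || apply continuity_2d_pt_const).
Qed.

(** The antiderivative is the Gudermannian [atan (sinh y)]; its limits [PI / 2] and [- PI / 2] are
    the source of the factor [PI] in the strip formula. *)
Lemma RInt_sech Y : is_RInt (fun y => / cosh y) (- Y) Y (2 * atan (sinh Y)).
Proof.
  replace (2 * atan (sinh Y)) with (minus (atan (sinh Y)) (atan (sinh (- Y)))).
  2: { rewrite sinh_opp, atan_opp; unfold minus, plus, opp; simpl; ring. }
  apply (is_RInt_derive (fun y => atan (sinh y))).
  - intros x _; evar_last.
    + apply (is_derive_comp atan sinh); [apply is_derive_atan | apply is_derive_sinh].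
    + unfold scal; simpl; unfold mult; simpl.
      pose proof (cosh_pos x); pose proof (cosh_sinh_sqr x) as E.
      unfold Rsqr; replace (1 + sinh x * sinh x) with (cosh x * cosh x) by lra.
      field; lra.
  - intros x _; apply (ex_derive_continuous (fun y => / cosh y)).
    eexists; apply is_derive_inv; [apply is_derive_cosh|].
    pose proof (cosh_pos x); lra.
Qed.

(** * The strip formula *)

Lemma csc_le_sinh x y : y <> 0 -> sqrt (/ sin_norm2 x y) <= / Rabs (sinh y).
Proof.
  intros Hy.
  assert (0 < sinh y * sinh y) as P by (pose proof (sinh_sqr_ge y); nra).
  assert (sinh y <> 0) as Hs by (intros E; rewrite E in P; lra).
  rewrite <- Rabs_inv, <- sqrt_Rsqr_abs; apply sqrt_le_1_alt.
  unfold Rsqr; rewrite <- Rinv_mult.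
  apply Rinv_le_contravar; trivial; unfold sin_norm2; nra.
Qed.

Lemma real_plus (p x y : R) : (RtoC p + (x, y))%C = (p + x, y).
Proof. unfold Cplus; simpl; f_equal; ring. Qed.

Lemma real_minus (p x y : R) : (RtoC p - (x, y))%C = (p - x, - y).
Proof. unfold Cminus, Cplus, Copp; simpl; f_equal; ring. Qed.

Lemma cderiv_translate (p z : C) : cderiv (fun w => p + w)%C z 1%C.
Proof.
  replace (1%C : C) with (0 + 1)%C by ring.
  apply (cderiv_plus (fun _ => p) (fun w => w)); [apply cderiv_const | apply cderiv_id].
Qed.

Lemma cderiv_reflect (p z : C) : cderiv (fun w => p - w)%C z (- (1))%C.
Proof.
  replace (- (1))%C with (0 + (0 * z + - (1) * 1))%C by ring.
  apply (cderiv_ext (fun w => p + - (1) * w)%C); [intros w; ring|].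
  apply (cderiv_plus (fun _ => p) (fun w => - (1) * w)%C); [apply cderiv_const|].
  apply (cderiv_mult (fun _ => - (1))%C (fun w => w)); [apply cderiv_const | apply cderiv_id].
Qed.

Section Strip.

Variables (F F' : C -> C) (p : R).
Hypothesis HF : forall z, cderiv F z (F' z).
Hypothesis HF' : forall z, ccont F' z.

Definition second_diff (z : C) : C := (F (p + z) + F (p - z) - 2 * F p)%C.
Definition second_diff' (z : C) : C := (F' (p + z) - F' (p - z))%C.

Lemma second_diff_cderiv z : cderiv second_diff z (second_diff' z).
Proof.
  pose proof (cderiv_plus _ _ _ _ _
    (cderiv_plus _ _ _ _ _ (cderiv_comp F _ z _ _ (HF _) (cderiv_translate p z))
      (cderiv_comp F _ z _ _ (HF _) (cderiv_reflect p z)))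
    (cderiv_const (- (2 * F p))%C z)) as K.
  cbv beta in K.
  replace (F' (p + z) * 1 + F' (p - z) * - (1) + 0)%C with (second_diff' z) in K
    by (unfold second_diff'; ring).
  exact K.
Qed.

Lemma second_diff'_ccont z : ccont second_diff' z.
Proof.
  pose proof (cderiv_ccont _ _ _ (cderiv_translate p z)) as H1.
  pose proof (cderiv_ccont _ _ _ (cderiv_reflect p z)) as H2.
  apply (ccont_ext (fun w => F' (p + w) + - (1) * F' (p - w))%C).
  { intros w; unfold second_diff'; ring. }
  apply (ccont_plus (fun w => F' (p + w))%C (fun w => - (1) * F' (p - w))%C).
  - exact (ccont_comp F' _ z (HF' _) H1).
  - apply (ccont_mult (fun _ => - (1))%C (fun w => F' (p - w))%C).
    + eapply cderiv_ccont, cderiv_const.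
    + exact (ccont_comp F' _ z (HF' _) H2).
Qed.

Lemma second_diff_even z : second_diff (- z)%C = second_diff z.
Proof.
  unfold second_diff; replace (p + - z)%C with (p - z)%C by ring.
  replace (p - - z)%C with (p + z)%C by ring; ring.
Qed.

Let A1 x y := Re (second_diff (x, y)).
Let A2 x y := Im (second_diff (x, y)).
Let A1' x y := Re (second_diff' (x, y)).
Let A2' x y := Im (second_diff' (x, y)).
(** Here [u + i v] is [second_diff z / sin z], and [w] is the real part of its derivative. *)
Let u x y := A1 x y * csc_re x y - A2 x y * csc_im x y.
Let v x y := A1 x y * csc_im x y + A2 x y * csc_re x y.
Let w x y := A1' x y * csc_re x y + A1 x y * csc'_re x y
  - (A2' x y * csc_im x y + A2 x y * csc'_im x y).

Lemma strip_partial_x x y : 0 < x < PI -> is_derive (fun s => u s y) x (w x y).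
Proof.
  intros Hx; pose proof (sin_norm2_pos x y Hx) as Hn.
  destruct (csc_partial x y) as [B1 [B2 _]]; [lra|].
  destruct (cderiv_Re_x _ _ _ _ (second_diff_cderiv (x, y))) as [D1 D2].
  apply (is_derive_minus (fun s => A1 s y * csc_re s y) (fun s => A2 s y * csc_im s y)).
  - apply (is_derive_mult (fun s => A1 s y) (fun s => csc_re s y)); trivial.
    intros; apply Rmult_comm.
  - apply (is_derive_mult (fun s => A2 s y) (fun s => csc_im s y)); trivial.
    intros; apply Rmult_comm.
Qed.

Lemma strip_partial_y x y : 0 < x < PI -> is_derive (fun s => v x s) y (w x y).
Proof.
  intros Hx; pose proof (sin_norm2_pos x y Hx) as Hn.
  destruct (csc_partial x y) as [_ [_ [B1 B2]]]; [lra|].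
  destruct (cderiv_Re_y _ _ _ _ (second_diff_cderiv (x, y))) as [D1 D2].
  replace (w x y) with
    ((- A2' x y * csc_im x y + A1 x y * csc'_re x y)
     + (A1' x y * csc_re x y + A2 x y * (- csc'_im x y))) by (unfold w; ring).
  apply (is_derive_plus (fun s => A1 x s * csc_im x s) (fun s => A2 x s * csc_re x s)).
  - apply (is_derive_mult (fun s => A1 x s) (fun s => csc_im x s)); trivial.
    intros; apply Rmult_comm.
  - apply (is_derive_mult (fun s => A2 x s) (fun s => csc_re x s)); trivial.
    intros; apply Rmult_comm.
Qed.

Lemma strip_w_continuity x y : 0 < x < PI -> continuity_2d_pt w x y.
Proof.
  intros Hx; pose proof (sin_norm2_pos x y Hx) as Hn.
  destruct (csc_continuity x y) as [B1 [B2 [B1' B2']]]; [lra|].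
  destruct (ccont_continuity_2d _ x y (cderiv_ccont _ _ _ (second_diff_cderiv (x, y)))) as [D1 D2].
  destruct (ccont_continuity_2d _ x y (second_diff'_ccont (x, y))) as [D1' D2'].
  apply continuity_2d_pt_minus; apply continuity_2d_pt_plus; now apply continuity_2d_pt_mult.
Qed.

Lemma kernel_product_le x y a b : sqrt (/ sin_norm2 x y) <= b ->
  sin_norm2 x y <> 0 -> Cmod (second_diff (x, y)) <= a ->
  Rabs (u x y) <= a * b /\ Rabs (v x y) <= a * b.
Proof.
  intros Hb Hn Ha.
  assert (Cmod (second_diff (x, y) * (csc_re x y, csc_im x y))%C <= a * b) as K.
  { rewrite Cmod_mult; apply Rmult_le_compat; trivial; try apply Cmod_ge_0.
    replace (Cmod (csc_re x y, csc_im x y)) with (sqrt (/ sin_norm2 x y)); trivial.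
    unfold Cmod; f_equal; simpl; rewrite !Rmult_1_r; symmetry; now apply csc_sqr. }
  split; (eapply Rle_trans; [|exact K]).
  - exact (re_le_Cmod (second_diff (x, y) * (csc_re x y, csc_im x y))%C).
  - exact (im_le_Cmod (second_diff (x, y) * (csc_re x y, csc_im x y))%C).
Qed.

Lemma second_diff_zero : second_diff 0 = 0%C.
Proof.
  unfold second_diff; replace (p + 0)%C with (RtoC p) by ring.
  replace (p - 0)%C with (RtoC p) by ring; ring.
Qed.

(* The derivative of the even function [second_diff] vanishes at 0, which
   compensates the simple pole of the cosecant. *)
Lemma strip_continuity_origin : continuity_2d_pt u 0 0.
Proof.
  (* At the pole both cosecant parts contain a division by 0, but they are multiplied by the
     vanishing numerator, so the value is 0 whatever that division returns. *)
  assert (u 0 0 = 0) as U0.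
  { unfold u, A1, A2; replace ((0, 0) : C) with (RtoC 0) by reflexivity.
    rewrite second_diff_zero; simpl; ring. }
  intros eps; rewrite U0.
  destruct (second_diff_cderiv 0 (eps / 4)) as [d [Hd H]].
  { pose proof (cond_pos eps); lra. }
  assert (0 < Rmin (d / 2) 1) as Pd by (apply Rmin_pos; lra).
  exists (mkposreal _ Pd); simpl; intros x y Hx Hy.
  rewrite Rminus_0_r in *.
  apply Rmin_Rgt_l in Hx; destruct Hx as [Hx1 Hx2].
  apply Rmin_Rgt_l in Hy; destruct Hy as [Hy1 Hy2].
  assert (second_diff' 0 = 0%C) as E0.
  { unfold second_diff'; replace (p + 0)%C with (RtoC p) by ring.
    replace (p - 0)%C with (RtoC p) by ring; ring. }
  set (m := Cmod (x, y)).
  assert (m * m = x * x + y * y) as Em.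
  { unfold m, Cmod; rewrite sqrt_sqrt; simpl; [ring|].
    rewrite !Rmult_1_r; nra. }
  assert (0 <= m) as Pm by apply Cmod_ge_0.
  specialize (H (x, y)).
  rewrite second_diff_zero, E0 in H.
  rewrite Cplus_0_l in H.
  replace (second_diff (x, y) - 0 - 0 * (x, y))%C with (second_diff (x, y)) in H
    by (generalize ((x, y) : C); intros z; ring).
  destruct (Req_dec (sin_norm2 x y) 0) as [Hn|Hn].
  { assert (x = 0 /\ y = 0) as [-> ->].
    { pose proof (sinh_sqr_ge y); pose proof (sin_sqr_ge x (Rlt_le _ _ Hx2)).
      unfold sin_norm2 in Hn; split; nra. }
    rewrite U0, Rabs_R0; apply cond_pos. }
  destruct (Req_dec m 0) as [Hm|Hm].
  { exfalso; apply Hn; rewrite Hm in Em; replace x with 0 by nra; replace y with 0 by nra.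
    unfold sin_norm2; rewrite sin_0, sinh_0; ring. }
  apply Rle_lt_trans with (pos eps / 2); [|pose proof (cond_pos eps); lra].
  (* The numerator is at most [eps / 4 * m] because its derivative at 0 is 0; the cosecant is at
     most [2 / m] because [sin_norm2 x y >= m ^ 2 / 4]. *)
  replace (pos eps / 2) with (pos eps / 4 * m * (2 / m)) by (field; trivial).
  apply kernel_product_le; trivial.
  - rewrite <- (sqrt_Rsqr (2 / m)) by (apply Rlt_le, Rdiv_lt_0_compat; lra).
    apply sqrt_le_1_alt; unfold Rsqr.
    replace (2 / m * (2 / m)) with (/ ((x * x + y * y) / 4))
      by (rewrite <- Em; field; trivial).
    pose proof (sinh_sqr_ge y); pose proof (sin_sqr_ge x (Rlt_le _ _ Hx2)).
    apply Rinv_le_contravar; [nra | unfold sin_norm2; nra].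
  - apply H; fold m.
    assert (Rabs x * Rabs x = x * x) by (rewrite <- Rabs_mult; apply Rabs_pos_eq; nra).
    assert (Rabs y * Rabs y = y * y) by (rewrite <- Rabs_mult; apply Rabs_pos_eq; nra).
    pose proof (Rabs_pos x); pose proof (Rabs_pos y); nra.
Qed.

Lemma strip_continuity x y : 0 <= x < PI -> continuity_2d_pt u x y.
Proof.
  intros Hx.
  destruct (Req_dec (sin_norm2 x y) 0) as [Hn|Hn].
  - assert (x = 0 /\ y = 0) as [-> ->]; [|apply strip_continuity_origin].
    destruct (Req_dec x 0) as [->|Hx0].
    + split; trivial; pose proof (sinh_sqr_ge y); unfold sin_norm2 in Hn; nra.
    + pose proof (sin_norm2_pos x y); lra.
  - destruct (csc_continuity x y) as [B1 [B2 _]]; trivial.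
    destruct (ccont_continuity_2d _ x y (cderiv_ccont _ _ _ (second_diff_cderiv (x, y)))) as [D1 D2].
    apply continuity_2d_pt_minus; now apply continuity_2d_pt_mult.
Qed.

Lemma strip_odd y : u 0 (- y) = - u 0 y.
Proof.
  unfold u, A1, A2.
  replace ((0, - y) : C) with (- (0, y))%C by (unfold Copp; simpl; f_equal; ring).
  rewrite second_diff_even; unfold csc_re, csc_im, sin_norm2.
  rewrite sin_0, sinh_opp; unfold Rdiv.
  replace (0 * 0 + - sinh y * - sinh y) with (0 * 0 + sinh y * sinh y) by ring; ring.
Qed.

(** The integral [W c], truncated at height [Y] and restricted to the real part. Only its limit for
    large [Y] matters. *)
Definition line_integral (G : C -> C) (c Y : R) : R :=
  RInt (fun y => Re (G (c, y)) / cosh y) (- Y) Y.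

(** This is [odd_vertical_integral_le] at [x0 = PI / 2]. On the horizontal edges the numerator is at
    most [2 M + 2 |F p|] and the cosecant at most [1 / sinh Y]. *)
Lemma strip_formula Y M : 0 < Y ->
  (forall x, - (PI / 2) <= x <= PI / 2 ->
    Cmod (F (p + x, Y)) <= M /\ Cmod (F (p + x, - Y)) <= M) ->
  Rabs (line_integral F (p + PI / 2) Y + line_integral F (p - PI / 2) Y
    - 4 * atan (sinh Y) * Re (F p)) <= 2 * (M + Cmod (F p)) * PI / sinh Y.
Proof.
  intros HY HM; pose proof PI_RGT_0 as Hpi.
  assert (0 < sinh Y) as Hs by (pose proof (sinh_ge_id Y); lra).
  assert (forall c, ex_RInt (fun y => Re (F (c, y)) / cosh y) (- Y) Y) as Ex.
  { intros c.
    apply (ex_RInt_2d (fun c y => Re (F (c, y)) / cosh y)); intros y.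
    apply continuity_2d_pt_mult.
    - apply (ccont_continuity_2d F), (cderiv_ccont _ _ _ (HF _)).
    - apply (continuity_2d_comp2 (fun y => / cosh y)), (ex_derive_continuous (fun y => / cosh y)).
      eexists; apply is_derive_inv; [apply is_derive_cosh|].
      pose proof (cosh_pos y); lra. }
  assert (RInt (u (PI / 2)) (- Y) Y = line_integral F (p + PI / 2) Y
    + line_integral F (p - PI / 2) Y - 4 * atan (sinh Y) * Re (F p)) as E.
  { apply is_RInt_unique.
    (* The term with [p - PI / 2] is reflected by [y |-> - y]; the inner [opp] is the sign produced
       by this substitution, the outer one cancels it. *)
    apply (is_RInt_ext (fun y => minus (plus (Re (F (p + PI / 2, y)) / cosh y)
       (opp (opp (Re (F (p - PI / 2, - y)) / cosh (- y)))))
       (scal (2 * Re (F p)) (/ cosh y)))).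
    - intros y _; unfold u, A1, A2, second_diff, csc_re, csc_im, sin_norm2.
      rewrite sin_PI2, cos_PI2, cosh_opp.
      rewrite real_plus, real_minus.
      replace (1 * 1 + sinh y * sinh y) with (cosh y * cosh y)
        by (rewrite cosh_sinh_sqr; ring).
      pose proof (cosh_pos y).
      destruct (F (p + PI / 2, y)) as [f1 f1'], (F (p - PI / 2, - y)) as [f2 f2'],
        (F p) as [f3 f3'].
      unfold minus, plus, opp, scal, Re, Im; simpl; unfold mult; simpl; field; lra.
    - replace (line_integral F (p + PI / 2) Y + line_integral F (p - PI / 2) Y
        - 4 * atan (sinh Y) * Re (F p)) with
        (minus (plus (line_integral F (p + PI / 2) Y) (opp (opp (line_integral F (p - PI / 2) Y))))
         (scal (2 * Re (F p)) (2 * atan (sinh Y))))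
        by (unfold minus, plus, opp, scal; simpl; unfold mult; simpl; ring).
      apply (is_RInt_minus (V := R_NormedModule)).
      + apply (is_RInt_plus (V := R_NormedModule)).
        * apply (RInt_correct (V := R_CompleteNormedModule)), Ex.
        * apply (is_RInt_opp (V := R_NormedModule)).
          apply (is_RInt_comp_opp (V := R_NormedModule)
            (fun y => Re (F (p - PI / 2, y)) / cosh y)).
          rewrite Ropp_involutive; apply (is_RInt_swap (V := R_NormedModule)).
          apply (RInt_correct (V := R_CompleteNormedModule)), Ex.
      + apply (is_RInt_scal (V := R_NormedModule)), RInt_sech. }
  rewrite <- E.
  replace (2 * (M + Cmod (F p)) * PI / sinh Y)
    with (2 * ((2 * M + 2 * Cmod (F p)) * / sinh Y) * (PI / 2)) by (field; lra).
  apply (odd_vertical_integral_le u v w PI); trivial.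
  - apply strip_partial_x.
  - apply strip_partial_y.
  - apply strip_w_continuity.
  - apply strip_continuity.
  - lra.
  - apply strip_odd.
  - intros x Hx.
    assert (forall s, s = Y \/ s = - Y ->
      Cmod (second_diff (x, s)) <= 2 * M + 2 * Cmod (F p)) as K.
    { intros s Hs'; unfold second_diff.
      rewrite real_plus, real_minus.
      unfold Cminus, Rminus; eapply Rle_trans; [apply Cmod_triangle|].
      eapply Rle_trans; [apply Rplus_le_compat_r, Cmod_triangle|].
      rewrite Cmod_opp, Cmod_mult, Cmod_R, (Rabs_pos_eq 2) by lra.
      destruct (HM x) as [H1 H2]; [lra|]; destruct (HM (- x)) as [H3 H4]; [lra|].
      destruct Hs' as [-> | ->]; rewrite ?Ropp_involutive; lra. }
    assert (forall s, s = Y \/ s = - Y -> Rabs (sinh s) = sinh Y) as Ks.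
    { intros s [-> | ->]; rewrite ?sinh_opp, ?Rabs_Ropp; apply Rabs_pos_eq; lra. }
    split; apply kernel_product_le; auto;
      try (pose proof (sin_norm2_pos x Y); pose proof (sin_norm2_pos x (- Y)); lra).
    + rewrite <- (Ks Y) by auto; apply csc_le_sinh; lra.
    + rewrite <- (Ks (- Y)) by auto; apply csc_le_sinh; lra.
Qed.

End Strip.

(** * Telescoping of alternating sums *)

Lemma Rpower_pos x a : 0 < Rpower x a.
Proof. apply exp_pos. Qed.

Lemma Rpower_neg_le x y a : 0 <= a -> 0 < x <= y -> Rpower y (- a) <= Rpower x (- a).
Proof.
  intros Ha Hx; rewrite !Rpower_Ropp.
  apply Rinv_le_contravar; [apply Rpower_pos | now apply Rle_Rpower_l].
Qed.

Lemma Rpower_neg_le_1 x a : 0 <= a -> 1 <= x -> Rpower x (- a) <= 1.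
Proof.
  intros Ha Hx; rewrite <- (Rpower_O x) by lra; apply Rle_Rpower; lra.
Qed.

Lemma is_lim_seq_Rpower_neg (s : R) (u : nat -> R) : 0 < s -> is_lim_seq u p_infty ->
  is_lim_seq (fun n => Rpower (u n) (- s)) 0.
Proof.
  intros Hs Hu; unfold Rpower.
  apply (is_lim_comp_seq exp (fun n => - s * ln (u n)) m_infty 0).
  - apply is_lim_exp_m.
  - now exists 0%nat.
  - replace m_infty with (Rbar_mult (- s) p_infty).
    + apply is_lim_seq_scal_l.
      apply (is_lim_comp_seq ln u p_infty p_infty); trivial; [apply is_lim_ln_p | now exists 0%nat].
    + simpl; destruct (Rle_dec 0 (- s)) as [H|H]; [exfalso; lra | trivial].
Qed.

Lemma atan_le_id t : 0 <= t -> atan t <= t.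
Proof.
  intros Ht; destruct (MVT_gen atan 0 t (fun x => / (1 + x ^ 2))) as [z [_ E]].
  - intros x _; replace (x ^ 2) with (Rsqr x) by (unfold Rsqr; ring); apply is_derive_atan.
  - intros x _; apply derivable_continuous_pt, derivable_pt_atan.
  - rewrite atan_0, !Rminus_0_r in E; rewrite E.
    assert (/ (1 + z ^ 2) <= 1) by (rewrite <- Rinv_1; apply Rinv_le_contravar; nra).
    nra.
Qed.

Lemma atan_sinh_bounds Y : 1 <= Y -> PI / 2 - / Y <= atan (sinh Y) <= PI / 2.
Proof.
  intros HY; split; [|left; apply atan_bound].
  pose proof (sinh_ge_id Y) as K.
  apply Rle_trans with (atan Y).
  - pose proof (atan_inv Y); pose proof (atan_le_id (/ Y)).
    assert (0 < / Y) by (apply Rinv_0_lt_compat; lra); lra.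
  - destruct (Req_dec Y (sinh Y)) as [<-|N]; [lra|].
    left; apply atan_increasing; lra.
Qed.

Lemma exp_le_4_sinh Y : 1 <= Y -> exp Y <= 4 * sinh Y.
Proof.
  intros HY; unfold sinh.
  pose proof (exp_ineq1_le Y); pose proof (exp_ineq1_le (- Y)).
  assert (exp (- Y) <= 1) by (rewrite <- exp_0; left; apply exp_increasing; lra); lra.
Qed.

Lemma exp_abs_le_2_cosh y : exp (Rabs y) <= 2 * cosh y.
Proof.
  unfold cosh; pose proof (exp_pos y); pose proof (exp_pos (- y)).
  destruct (Rle_dec 0 y); [rewrite Rabs_pos_eq | rewrite Rabs_left]; lra.
Qed.

Lemma RInt_decay s Y : 0 < s -> 0 <= Y ->
  exists I, is_RInt (fun y => Rpower (1 + Rabs y) (- (1 + s))) (- Y) Y I /\ I <= 2 / s.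
Proof.
  intros Hs HY.
  assert (forall x, 0 <= x ->
    is_derive (fun y => - / s * Rpower (1 + y) (- s)) x (Rpower (1 + x) (- (1 + s)))) as D.
  { intros x Hx; unfold Rpower; auto_derive; [lra|].
    replace (exp (- (1 + s) * ln (1 + x))) with (exp (- s * ln (1 + x)) * / (1 + x)).
    - field; lra.
    - replace (- (1 + s) * ln (1 + x)) with (- s * ln (1 + x) + - ln (1 + x)) by ring.
      rewrite exp_plus, exp_Ropp, exp_ln by lra; trivial. }
  assert (is_RInt (fun y => Rpower (1 + Rabs y) (- (1 + s))) 0 Y
    (/ s - / s * Rpower (1 + Y) (- s))) as H.
  { apply (is_RInt_ext (fun y => Rpower (1 + y) (- (1 + s)))).
    - intros x Hx; rewrite Rmin_left, Rmax_right in Hx by lra.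
      rewrite Rabs_pos_eq; [trivial | lra].
    - evar_last.
      + apply (is_RInt_derive (fun y => - / s * Rpower (1 + y) (- s))).
        * intros x Hx; rewrite Rmin_left in Hx by lra; apply D; lra.
        * intros x Hx; rewrite Rmin_left in Hx by lra.
          apply (ex_derive_continuous (fun y => Rpower (1 + y) (- (1 + s)))).
          unfold Rpower; auto_derive; lra.
      + unfold minus, plus, opp; simpl; rewrite Rplus_0_r.
        replace (Rpower 1 (- s)) with 1; [ring|].
        unfold Rpower; rewrite ln_1, Rmult_0_r, exp_0; trivial. }
  assert (is_RInt (fun y => Rpower (1 + Rabs y) (- (1 + s))) (- Y) 0
    (/ s - / s * Rpower (1 + Y) (- s))) as H'.
  { apply (is_RInt_ext (fun y => opp (opp (Rpower (1 + Rabs (- y)) (- (1 + s)))))).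
    - intros x _; rewrite Rabs_Ropp; unfold opp; simpl; ring.
    - replace (/ s - / s * Rpower (1 + Y) (- s))
        with (opp (opp (/ s - / s * Rpower (1 + Y) (- s)))) by (unfold opp; simpl; ring).
      apply (is_RInt_opp (V := R_NormedModule)).
      apply (is_RInt_comp_opp (V := R_NormedModule) (fun y => Rpower (1 + Rabs y) (- (1 + s)))).
      rewrite Ropp_involutive, Ropp_0.
      apply (is_RInt_swap (V := R_NormedModule)), H. }
  exists (plus (/ s - / s * Rpower (1 + Y) (- s)) (/ s - / s * Rpower (1 + Y) (- s))); split.
  - apply (is_RInt_Chasles (V := R_NormedModule) _ _ 0); trivial.
  - unfold plus; simpl.
    assert (0 < / s) by now apply Rinv_0_lt_compat.
    pose proof (Rpower_pos (1 + Y) (- s)); unfold Rdiv; nra.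
Qed.

Lemma pow_m1_sqr n : (-1) ^ n * (-1) ^ n = 1.
Proof.
  rewrite <- Rpow_mult_distr; replace (-1 * -1) with 1 by ring; apply pow1.
Qed.

Section Telescoping.

Variables (F F' : C -> C) (A s : R).
Hypothesis HF : forall z, cderiv F z (F' z).
Hypothesis HF' : forall z, ccont F' z.
Hypothesis Hs : 0 < s.
Hypothesis HA : 0 <= A.
(** The two directions play different roles: the power [- (1 + s)] makes vertical integrals
    converge, the power [- s] drives them to 0 as the line moves away. Asking for the bound only
    outside the unit disc keeps clear of the removable singularity of the later applications. *)
Hypothesis Hdecay : forall z, 1 <= Cmod z ->
  Cmod (F z) <= A * exp (Rabs (Im z)) * Rpower (1 + Rabs (Re z)) (- s)
    * Rpower (1 + Rabs (Im z)) (- (1 + s)).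

Lemma ex_line_integral c Y : ex_RInt (fun y => Re (F (c, y)) / cosh y) (- Y) Y.
Proof.
  apply (ex_RInt_2d (fun c y => Re (F (c, y)) / cosh y)); intros y.
  apply continuity_2d_pt_mult.
  - apply (ccont_continuity_2d F), (cderiv_ccont _ _ _ (HF _)).
  - apply (continuity_2d_comp2 (fun y => / cosh y)), (ex_derive_continuous (fun y => / cosh y)).
    eexists; apply is_derive_inv; [apply is_derive_cosh|].
    pose proof (cosh_pos y); lra.
Qed.

(** Since [exp |y| <= 2 cosh y], the weight absorbs the exponential growth and leaves [RInt_decay],
    whose bound [2 / s] is uniform in [Y]. *)
Lemma line_integral_bound c Y : 1 <= Rabs c -> 0 <= Y ->
  Rabs (line_integral F c Y) <= 4 * A / s * Rpower (1 + Rabs c) (- s).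
Proof.
  intros Hc HY.
  destruct (RInt_decay s Y Hs HY) as [I [HI LI]].
  set (k := 2 * A * Rpower (1 + Rabs c) (- s)).
  assert (0 <= k) as Pk.
  { unfold k; pose proof (Rpower_pos (1 + Rabs c) (- s)); apply Rmult_le_pos; lra. }
  eapply Rle_trans; [apply abs_RInt_le; [lra | apply ex_line_integral]|].
  apply Rle_trans with (RInt (fun y => scal k (Rpower (1 + Rabs y) (- (1 + s)))) (- Y) Y).
  - apply RInt_le; [lra| | |].
    + apply (ex_RInt_norm (fun y => Re (F (c, y)) / cosh y)), ex_line_integral.
    + apply (ex_RInt_scal (V := R_NormedModule)); now exists I.
    + intros y _; unfold scal; simpl; unfold mult; simpl.
      pose proof (cosh_pos y) as Pc.
      rewrite Rabs_div, (Rabs_pos_eq (cosh y)) by lra.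
      apply Rmult_le_reg_r with (cosh y); trivial.
      unfold Rdiv; rewrite Rmult_assoc, Rinv_l, Rmult_1_r by lra.
      eapply Rle_trans; [apply re_le_Cmod|].
      eapply Rle_trans; [apply Hdecay|].
      { eapply Rle_trans; [exact Hc | apply (re_le_Cmod (c, y))]. }
      simpl Re; simpl Im; unfold k.
      pose proof (Rpower_pos (1 + Rabs c) (- s)).
      pose proof (Rpower_pos (1 + Rabs y) (- (1 + s))).
      replace (2 * A * Rpower (1 + Rabs c) (- s) * Rpower (1 + Rabs y) (- (1 + s)) * cosh y)
        with (A * (2 * cosh y) * Rpower (1 + Rabs c) (- s) * Rpower (1 + Rabs y) (- (1 + s))) by ring.
      repeat apply Rmult_le_compat_r; try lra.
      apply Rmult_le_compat_l; [trivial | apply exp_abs_le_2_cosh].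
  - rewrite (RInt_scal (V := R_CompleteNormedModule)) by now exists I.
    rewrite (is_RInt_unique _ _ _ _ HI); unfold scal; simpl; unfold mult; simpl.
    replace (4 * A / s * Rpower (1 + Rabs c) (- s)) with (k * (2 / s)) by (unfold k; field; lra).
    now apply Rmult_le_compat_l.
Qed.

Lemma strip_limit p :
  is_lim (fun Y => line_integral F (p + PI / 2) Y + line_integral F (p - PI / 2) Y)
    p_infty (2 * PI * Re (F p)).
Proof.
  pose proof PI_RGT_0 as Hpi.
  set (k := Cmod (F p)).
  assert (0 <= k) as Pk by apply Cmod_ge_0.
  (* The first summand comes from the horizontal edges with [M = A * exp Y / Y] and
     [exp Y <= 4 sinh Y], the second from replacing [atan (sinh Y)] by [PI / 2], an error of at most
     [/ Y]. *)
  set (K := 2 * (4 * A + k) * PI + 4 * k).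
  assert (is_lim (fun Y => K * / Y) p_infty 0) as L0.
  { replace (Finite 0) with (Rbar_mult K (Rbar_inv p_infty)) by (simpl; f_equal; ring).
    apply is_lim_scal_l, is_lim_inv; [apply is_lim_id | discriminate]. }
  apply (is_lim_le_le_loc (fun Y => 2 * PI * Re (F p) - K * / Y) (fun Y => 2 * PI * Re (F p) + K * / Y)).
  - exists 1; intros Y HY.
    assert (0 < sinh Y) as Psh by (pose proof (sinh_ge_id Y); lra).
    pose proof (strip_formula F F' p HF HF' Y (A * exp Y * / Y)) as S.
    assert (Rabs (line_integral F (p + PI / 2) Y + line_integral F (p - PI / 2) Y
      - 4 * atan (sinh Y) * Re (F p)) <= 2 * (4 * A + k) * PI * / Y) as S'.
    { eapply Rle_trans; [apply S; [lra|]|].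
      - assert (forall x t, (t = Y \/ t = - Y) -> Cmod (F (p + x, t)) <= A * exp Y * / Y) as B.
        { intros x t Ht.
          assert (Rabs t = Y) as At
            by (destruct Ht as [-> | ->]; rewrite ?Rabs_Ropp; apply Rabs_pos_eq; lra).
          eapply Rle_trans; [apply Hdecay|].
          - apply Rle_trans with (Rabs t); [lra | apply (im_le_Cmod (p + x, t))].
          - simpl Re; simpl Im; rewrite At.
            pose proof (exp_pos Y).
            assert (0 < / Y) by (apply Rinv_0_lt_compat; lra).
            assert (Rpower (1 + Rabs (p + x)) (- s) <= 1) as R1.
            { apply Rpower_neg_le_1; [lra | pose proof (Rabs_pos (p + x)); lra]. }
            assert (Rpower (1 + Y) (- (1 + s)) <= / Y) as R2.
            { apply Rle_trans with (Rpower (1 + Y) (- (1))).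
              - apply Rle_Rpower; lra.
              - rewrite Rpower_Ropp, Rpower_1 by lra; apply Rinv_le_contravar; lra. }
            pose proof (Rpower_pos (1 + Rabs (p + x)) (- s)).
            pose proof (Rpower_pos (1 + Y) (- (1 + s))).
            apply Rmult_le_compat; try lra.
            + apply Rmult_le_pos; [apply Rmult_le_pos|]; lra.
            + rewrite <- (Rmult_1_r (A * exp Y)) at 2.
              apply Rmult_le_compat_l; trivial; apply Rmult_le_pos; lra. }
        intros x _; split; apply B; auto.
      - fold k.
        replace (2 * (A * exp Y * / Y + k) * PI / sinh Y)
          with ((2 * PI) * ((A * exp Y * / Y + k) / sinh Y)) by (field; lra).
        replace (2 * (4 * A + k) * PI * / Y) with ((2 * PI) * ((4 * A + k) * / Y)) by (field; lra).
        apply Rmult_le_compat_l; [lra|].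
        apply Rmult_le_reg_r with (sinh Y); trivial.
        unfold Rdiv; rewrite (Rmult_assoc _ (/ sinh Y)), Rinv_l, Rmult_1_r by lra.
        apply Rmult_le_reg_r with Y; [lra|].
        replace ((A * exp Y * / Y + k) * Y) with (A * exp Y + k * Y) by (field; lra).
        replace ((4 * A + k) * / Y * sinh Y * Y) with (A * (4 * sinh Y) + k * sinh Y)
          by (field; lra).
        apply Rplus_le_compat; apply Rmult_le_compat_l; trivial.
        + apply exp_le_4_sinh; lra.
        + apply sinh_ge_id; lra. }
    pose proof (atan_sinh_bounds Y) as T.
    pose proof (re_le_Cmod (F p)) as Rp; fold k in Rp.
    assert (Rabs ((4 * atan (sinh Y) - 2 * PI) * Re (F p)) <= 4 * k * / Y) as Q.
    { rewrite Rabs_mult.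
      replace (4 * k * / Y) with ((4 * / Y) * k) by ring.
      apply Rmult_le_compat; try apply Rabs_pos; trivial.
      rewrite Rabs_left1; lra. }
    apply Rabs_le_between in S'; apply Rabs_le_between in Q.
    unfold K; lra.
  - replace (Finite (2 * PI * Re (F p)))
      with (Rbar_minus (2 * PI * Re (F p)) 0) by (simpl; f_equal; ring).
    apply is_lim_minus'; [apply is_lim_const | exact L0].
  - replace (Finite (2 * PI * Re (F p)))
      with (Rbar_plus (2 * PI * Re (F p)) 0) by (simpl; f_equal; ring).
    apply is_lim_plus'; [apply is_lim_const | exact L0].
Qed.

Lemma alternating_series_Re p L :
  is_lim (fun Y => line_integral F (p - PI / 2) Y) p_infty (Finite L) ->
  is_series (fun n => (-1) ^ n * Re (F (p + INR n * PI)%R)) (L / (2 * PI)).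
Proof.
  intros HL; pose proof PI_RGT_0 as Hpi.
  set (a := fun n => (-1) ^ n * Re (F (p + INR n * PI)%R)).
  (* The strip formula reads [W (c + PI / 2) = 2 PI F c - W (c - PI / 2)]; [tail n] is the closed
     form of this recursion started from [L]. That it tends to 0 is the convergence of the
     series. *)
  set (tail := fun n => (-1) ^ n * (2 * PI * sum_n a n - L)).
  assert (forall n, is_lim (fun Y => line_integral F (p + PI / 2 + INR n * PI) Y)
    p_infty (tail n)) as HT.
  { induction n as [|n IH].
    - replace (tail 0%nat) with (2 * PI * Re (F p) - L).
      + apply (is_lim_ext (fun Y => (line_integral F (p + PI / 2) Y
          + line_integral F (p - PI / 2) Y) - line_integral F (p - PI / 2) Y)).
        { intros Y; simpl; rewrite Rmult_0_l, Rplus_0_r; ring. }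
        apply is_lim_minus'; [apply strip_limit | exact HL].
      + unfold tail; rewrite sum_O; unfold a; simpl.
        rewrite Rmult_0_l, Rplus_0_r; ring.
    - set (c := p + INR (S n) * PI).
      replace (tail (S n)) with (2 * PI * Re (F c) - tail n).
      + apply (is_lim_ext (fun Y => (line_integral F (c + PI / 2) Y
          + line_integral F (c - PI / 2) Y) - line_integral F (p + PI / 2 + INR n * PI) Y)).
        { intros Y; replace (c - PI / 2) with (p + PI / 2 + INR n * PI)
            by (unfold c; rewrite S_INR; field).
          replace (p + PI / 2 + INR (S n) * PI) with (c + PI / 2)
            by (unfold c; rewrite S_INR; field).
          ring. }
        apply is_lim_minus'; [apply strip_limit | exact IH].
      + assert (sum_n a (S n) = sum_n a n + (-1) ^ S n * Re (F c)) as E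
          by (rewrite sum_Sn; reflexivity).
        unfold tail; rewrite E; simpl pow.
        pose proof (pow_m1_sqr n) as Sq.
        transitivity (2 * PI * ((-1) ^ n * (-1) ^ n) * Re (F c) - (-1) ^ n * (2 * PI * sum_n a n - L)).
        * rewrite Sq; ring.
        * ring. }
  assert (is_lim_seq tail 0) as T0.
  { apply is_lim_seq_abs_0.
    set (c := fun n => 1 + (p + PI / 2 + INR n * PI)).
    assert (is_lim_seq c p_infty) as Lc.
    { unfold c; apply (is_lim_seq_ext (fun n => (1 + p + PI / 2) + PI * INR n)).
      { intros n; ring. }
      eapply is_lim_seq_plus; [apply is_lim_seq_const | |].
      - apply is_lim_seq_scal_l, is_lim_seq_INR.
      - unfold is_Rbar_plus; simpl; destruct (Rle_dec 0 PI) as [H|H]; [|exfalso; lra].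
        destruct (Rle_lt_or_eq_dec 0 PI H); [reflexivity | exfalso; lra]. }
    apply (is_lim_seq_le_le_loc (fun _ => 0) _ (fun n => 4 * A / s * Rpower (c n) (- s))).
    (* From [c n > 2] on, the line lies to the right of abscissa 1, as [line_integral_bound]
       requires. *)
    - generalize (proj2 (is_lim_seq_spec c p_infty) Lc 2); simpl; apply filter_imp; intros n Hn.
      split; [apply Rabs_pos|].
      replace (c n) with (1 + Rabs (p + PI / 2 + INR n * PI))
        by (unfold c in *; rewrite Rabs_pos_eq; lra).
      apply (is_lim_le_loc (fun Y => Rabs (line_integral F (p + PI / 2 + INR n * PI) Y))
        (fun _ => 4 * A / s * Rpower (1 + Rabs (p + PI / 2 + INR n * PI)) (- s))
        p_infty (Rabs (tail n)) (Finite _)).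
      + exists 0; intros Y HY; apply line_integral_bound; [|lra].
        unfold c in Hn; rewrite Rabs_pos_eq; lra.
      + apply (is_lim_Rabs _ _ (tail n)), HT.
      + apply is_lim_const.
    - apply is_lim_seq_const.
    - replace (Finite 0) with (Rbar_mult (4 * A / s) 0) by (simpl; f_equal; ring).
      now apply is_lim_seq_scal_l, is_lim_seq_Rpower_neg. }
  change (is_lim_seq (sum_n a) (L / (2 * PI))).
  apply (is_lim_seq_ext (fun n => (L + (-1) ^ n * tail n) * / (2 * PI))).
  { intros n; unfold tail.
    pose proof (pow_m1_sqr n) as Sq.
    rewrite <- Rmult_assoc, Sq; field; lra. }
  replace (Finite (L / (2 * PI))) with (Rbar_mult (L + 0) (/ (2 * PI)))
    by (simpl; f_equal; field; lra).
  apply is_lim_seq_scal_r.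
  apply is_lim_seq_plus'; [apply is_lim_seq_const|].
  apply is_lim_seq_abs_0.
  apply (is_lim_seq_ext (fun n => Rabs (tail n))).
  - intros n; rewrite Rabs_mult, pow_1_abs; ring.
  - now apply is_lim_seq_abs_0 in T0.
Qed.

End Telescoping.

(** * Odd and even functions *)

Section Parity.

Variables (F F' : C -> C) (A s : R).
Hypothesis HF : forall z, cderiv F z (F' z).
Hypothesis HF' : forall z, ccont F' z.
Hypothesis Hs : 0 < s.
Hypothesis HA : 0 <= A.
Hypothesis Hdecay : forall z, 1 <= Cmod z ->
  Cmod (F z) <= A * exp (Rabs (Im z)) * Rpower (1 + Rabs (Re z)) (- s)
    * Rpower (1 + Rabs (Im z)) (- (1 + s)).

Lemma Copp_pair (x y : R) : (- (x, y))%C = (- x, - y).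
Proof. reflexivity. Qed.

Lemma alternating_series_odd_Re : (forall z, F (- z)%C = (- F z)%C) ->
  is_series (fun n => (-1) ^ n * Re (F (PI / 2 + INR n * PI)%R)) 0.
Proof.
  intros Hodd; pose proof PI_RGT_0 as Hpi.
  replace 0 with (0 / (2 * PI)) by (field; lra).
  apply (alternating_series_Re F F' A s); trivial.
  apply (is_lim_ext (fun _ => 0)); [|apply is_lim_const].
  intros Y; symmetry; rewrite Rminus_eq_0.
  apply RInt_odd; [now apply (ex_line_integral F F')|].
  intros y; replace ((0, - y) : C) with (- (0, y))%C
    by (rewrite Copp_pair; f_equal; ring).
  rewrite Hodd, cosh_opp; pose proof (cosh_pos y).
  destruct (F (0, y)); unfold Re; simpl; field; lra.
Qed.

(** The starting line has abscissa [PI / 2]. Evenness identifies its integral with that over the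
    abscissa [- PI / 2], and the strip formula at [p = 0] says that the two together give
    [2 PI F 0]. *)
Lemma alternating_series_even_Re : (forall z, F (- z)%C = F z) ->
  is_series (fun n => (-1) ^ n * Re (F (PI + INR n * PI)%R)) (Re (F 0) / 2).
Proof.
  intros Heven; pose proof PI_RGT_0 as Hpi.
  replace (Re (F 0) / 2) with (PI * Re (F 0) / (2 * PI)) by (field; lra).
  apply (alternating_series_Re F F' A s); trivial.
  apply (is_lim_ext (fun Y => / 2 * (line_integral F (0 + PI / 2) Y + line_integral F (0 - PI / 2) Y))).
  - intros Y; replace (line_integral F (0 - PI / 2) Y) with (line_integral F (0 + PI / 2) Y).
    + replace (PI - PI / 2) with (0 + PI / 2) by field; field.
    + symmetry; apply is_RInt_unique.
      apply (is_RInt_ext (fun y => opp (opp (Re (F (0 + PI / 2, - y)) / cosh (- y))))).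
      * intros y _; rewrite cosh_opp; unfold opp; simpl; rewrite Ropp_involutive.
        replace ((0 - PI / 2, y) : C) with (Copp ((0 + PI / 2)%R, (- y)%R))
          by (rewrite Copp_pair; f_equal; ring).
        now rewrite Heven.
      * unfold line_integral.
        replace (RInt (fun y => Re (F (0 + PI / 2, y)) / cosh y) (- Y) Y)
          with (opp (opp (RInt (fun y => Re (F (0 + PI / 2, y)) / cosh y) (- Y) Y)))
          by (unfold opp; simpl; ring).
        apply (is_RInt_opp (V := R_NormedModule)).
        apply (is_RInt_comp_opp (V := R_NormedModule)
          (fun y => Re (F (0 + PI / 2, y)) / cosh y)).
        rewrite Ropp_involutive; apply (is_RInt_swap (V := R_NormedModule)).
        apply (RInt_correct (V := R_CompleteNormedModule)).
        now apply (ex_line_integral F F').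
  - replace (Finite (PI * Re (F 0))) with (Rbar_mult (/ 2) (2 * PI * Re (F 0)))
      by (simpl; f_equal; field).
    apply is_lim_scal_l; exact (strip_limit F F' A s HF HF' Hs HA Hdecay 0).
Qed.

End Parity.

Section ComplexSeries.

Variables (F F' : C -> C) (A s : R).
Hypothesis HF : forall z, cderiv F z (F' z).
Hypothesis HF' : forall z, ccont F' z.
Hypothesis Hs : 0 < s.
Hypothesis HA : 0 <= A.
Hypothesis Hdecay : forall z, 1 <= Cmod z ->
  Cmod (F z) <= A * exp (Rabs (Im z)) * Rpower (1 + Rabs (Re z)) (- s)
    * Rpower (1 + Rabs (Im z)) (- (1 + s)).

(** A rotation by [- i] turns imaginary parts into real parts and preserves differentiability, decay
    and parity. *)
Let G (z : C) : C := (- Ci * F z)%C.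
Let G' (z : C) : C := (- Ci * F' z)%C.

Lemma Re_rotate (z : C) : Re (- Ci * z)%C = Im z.
Proof. unfold Ci, Re, Im; simpl; ring. Qed.

Lemma rotate_cderiv z : cderiv G z (G' z).
Proof.
  pose proof (cderiv_mult _ _ z _ _ (cderiv_const (- Ci)%C z) (HF z)) as K; cbv beta in K.
  replace (0 * F z + - Ci * F' z)%C with (G' z) in K by (unfold G'; ring); exact K.
Qed.

Lemma rotate_ccont z : ccont G' z.
Proof.
  apply (ccont_mult (fun _ => (- Ci)%C) F'); trivial.
  eapply cderiv_ccont, cderiv_const.
Qed.

Lemma rotate_decay z : 1 <= Cmod z ->
  Cmod (G z) <= A * exp (Rabs (Im z)) * Rpower (1 + Rabs (Re z)) (- s)
    * Rpower (1 + Rabs (Im z)) (- (1 + s)).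
Proof.
  unfold G; rewrite Cmod_mult, Cmod_opp, Cmod_Ci, Rmult_1_l; apply Hdecay.
Qed.

Lemma alternating_series_odd : (forall z, F (- z)%C = (- F z)%C) ->
  is_Cseries (fun n => RtoC ((-1) ^ n) * F (RtoC (PI / 2 + INR n * PI)))%C (RtoC 0).
Proof.
  intros Hodd; apply is_Cseries_components; split.
  - apply is_series_ext with (fun n => (-1) ^ n * Re (F (PI / 2 + INR n * PI)%R)).
    { intros n; unfold Re; simpl; ring. }
    now apply (alternating_series_odd_Re F F' A s).
  - apply is_series_ext with (fun n => (-1) ^ n * Re (G (PI / 2 + INR n * PI)%R)).
    { intros n; unfold G; rewrite Re_rotate; unfold Im; simpl; ring. }
    apply (alternating_series_odd_Re G G' A s); trivial.
    + apply rotate_cderiv.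
    + apply rotate_ccont.
    + apply rotate_decay.
    + intros z; unfold G; rewrite Hodd; ring.
Qed.

Lemma alternating_series_even : (forall z, F (- z)%C = F z) ->
  is_Cseries (fun n => RtoC ((-1) ^ n) * F (RtoC (PI + INR n * PI)))%C (F 0 / 2)%C.
Proof.
  intros Heven; apply is_Cseries_components; split.
  - apply is_series_ext with (fun n => (-1) ^ n * Re (F (PI + INR n * PI)%R)).
    { intros n; unfold Re; simpl; ring. }
    replace (Re (F 0 / 2)%C) with (Re (F 0) / 2).
    + now apply (alternating_series_even_Re F F' A s).
    + destruct (F 0); unfold Re; simpl; field.
  - apply is_series_ext with (fun n => (-1) ^ n * Re (G (PI + INR n * PI)%R)).
    { intros n; unfold G; rewrite Re_rotate; unfold Im; simpl; ring. }
    replace (Im (F 0 / 2)%C) with (Re (G 0) / 2).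
    + apply (alternating_series_even_Re G G' A s); trivial.
      * apply rotate_cderiv.
      * apply rotate_ccont.
      * apply rotate_decay.
      * intros z; unfold G; now rewrite Heven.
    + unfold G; rewrite Re_rotate; destruct (F 0); unfold Im; simpl; field.
Qed.

End ComplexSeries.

(** * Growth of the difference quotients *)

(** From [1 + a <= (1 + beta) * (1 + b)] and the same with [a] and [b] exchanged; the two
    inequalities serve the two signs of [nu]. *)
Lemma Rpower_shift_le a b beta nu : 0 <= a -> 0 <= b -> 0 <= beta ->
  a <= b + beta -> b <= a + beta ->
  Rpower (1 + a) nu <= Rpower (1 + beta) (Rabs nu) * Rpower (1 + b) nu.
Proof.
  intros Ha Hb Hbeta H1 H2; unfold Rpower; rewrite <- exp_plus.
  assert (ln (1 + a) <= ln (1 + beta) + ln (1 + b)) as L1.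
  { rewrite <- ln_mult by lra; apply ln_le; nra. }
  assert (ln (1 + b) <= ln (1 + beta) + ln (1 + a)) as L2.
  { rewrite <- ln_mult by lra; apply ln_le; nra. }
  assert (nu * ln (1 + a) <= Rabs nu * ln (1 + beta) + nu * ln (1 + b)) as L.
  { destruct (Rle_dec 0 nu); [rewrite Rabs_pos_eq | rewrite Rabs_left]; nra. }
  destruct L as [L | ->]; [left; now apply exp_increasing | lra].
Qed.

Lemma exp_le x y : x <= y -> exp x <= exp y.
Proof. intros [H | ->]; [left; now apply exp_increasing | lra]. Qed.

Lemma Cmod_sub_le (z w : C) : Cmod z <= Cmod w + Cmod (z - w)%C.
Proof.
  replace z with (w + (z - w))%C at 1 by ring; apply Cmod_triangle.
Qed.

Lemma Im_sub_le (z w : C) : Rabs (Im z) <= Rabs (Im w) + Cmod (z - w)%C.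
Proof.
  replace (Im z) with (Im w + Im (z - w)%C) by (destruct z, w; unfold Im; simpl; ring).
  eapply Rle_trans; [apply Rabs_triang|].
  apply Rplus_le_compat_l, im_le_Cmod.
Qed.

Section Growth.

Variables (c : nat -> C) (csqrt : C -> C) (K nu : R) (t : C).
Hypothesis Hc : entire_coef c.
Hypothesis Hsqrt : forall w : C, (csqrt w ^ 2)%C = w.
Hypothesis Hgrowth : forall z : C, 0 < Re z ->
  Cmod (power_series c (z ^ 2)%C) <= K * exp (Rabs (Im z)) * Rpower (1 + Cmod z) nu.

Lemma growth_const_nonneg : 0 <= K.
Proof.
  pose proof (Hgrowth 1 ltac:(simpl; lra)) as H.
  pose proof (Cmod_ge_0 (power_series c (1 ^ 2)%C)).
  pose proof (exp_pos (Rabs (Im 1))).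
  pose proof (Rpower_pos (1 + Cmod 1) nu).
  destruct (Rle_dec 0 K); trivial; exfalso.
  assert (0 < exp (Rabs (Im 1)) * Rpower (1 + Cmod 1) nu) by now apply Rmult_lt_0_compat.
  rewrite Rmult_assoc in H; nra.
Qed.

(** The growth hypothesis leaves out the imaginary axis. Moving right by a small [e <= 1] keeps
    [Im z], changes the power by a factor of at most [2 ^ |nu|], and changes the value by at most
    [eps] by continuity. *)
Lemma growth_closed_half_plane z : 0 <= Re z ->
  Cmod (power_series c (z ^ 2)%C) <=
    K * Rpower 2 (Rabs nu) * exp (Rabs (Im z)) * Rpower (1 + Cmod z) nu.
Proof.
  intros Hz; apply le_epsilon; intros eps Heps.
  assert (ccont (fun w => power_series c (w ^ 2)%C) z) as Cc.
  { apply (ccont_comp (power_series c) (fun w => w ^ 2)%C); [now apply power_series_ccont|].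
    apply (ccont_mult (fun w => w) (fun w => w ^ 1)%C); [eapply cderiv_ccont, cderiv_id|].
    apply (ccont_mult (fun w => w) (fun w => 1)%C); eapply cderiv_ccont;
      [apply cderiv_id | apply cderiv_const]. }
  destruct (Cc eps Heps) as [d [Hd H]].
  set (e := Rmin (d / 2) 1).
  assert (0 < e) as Pe by (apply Rmin_pos; lra).
  assert (e <= d / 2) by apply Rmin_l.
  assert (e <= 1) by apply Rmin_r.
  assert (Cmod e = e) as Ce by (rewrite Cmod_R, Rabs_pos_eq; lra).
  specialize (H e ltac:(lra)).
  pose proof (Hgrowth (z + e)%C) as G.
  replace (Im (z + e)%C) with (Im z) in G by (destruct z; unfold Im; simpl; ring).
  assert (0 < Re (z + e)%C) as Pz by (destruct z; unfold Re in *; simpl in *; lra).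
  specialize (G Pz).
  assert (Rpower (1 + Cmod (z + e)%C) nu <= Rpower 2 (Rabs nu) * Rpower (1 + Cmod z) nu) as S.
  { replace 2 with (1 + 1) by ring; apply Rpower_shift_le; try apply Cmod_ge_0; try lra.
    - eapply Rle_trans; [apply Cmod_triangle | lra].
    - pose proof (Cmod_sub_le z (z + e)%C) as T.
      replace (z - (z + e))%C with (- e)%C in T by ring.
      rewrite Cmod_opp in T; lra. }
  pose proof (Cmod_sub_le (power_series c (z ^ 2)%C) (power_series c ((z + e) ^ 2)%C)) as T.
  rewrite <- Cmod_opp in H.
  replace (- (power_series c ((z + e) ^ 2) - power_series c (z ^ 2)))%C
    with (power_series c (z ^ 2) - power_series c ((z + e) ^ 2))%C in H by ring.
  assert (K * exp (Rabs (Im z)) * Rpower (1 + Cmod (z + e)%C) nu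
    <= K * Rpower 2 (Rabs nu) * exp (Rabs (Im z)) * Rpower (1 + Cmod z) nu).
  { replace (K * Rpower 2 (Rabs nu) * exp (Rabs (Im z)) * Rpower (1 + Cmod z) nu)
      with (K * exp (Rabs (Im z)) * (Rpower 2 (Rabs nu) * Rpower (1 + Cmod z) nu)) by ring.
    apply Rmult_le_compat_l; trivial.
    apply Rmult_le_pos; [apply growth_const_nonneg | left; apply exp_pos]. }
  lra.
Qed.

Lemma growth_plane z : Cmod (power_series c (z ^ 2)%C) <=
    K * Rpower 2 (Rabs nu) * exp (Rabs (Im z)) * Rpower (1 + Cmod z) nu.
Proof.
  destruct (Rle_dec 0 (Re z)) as [H|H]; [now apply growth_closed_half_plane|].
  replace (z ^ 2)%C with ((- z) ^ 2)%C by (simpl; ring).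
  replace (Rabs (Im z)) with (Rabs (Im (- z)%C)) by (unfold Im; simpl; apply Rabs_Ropp).
  rewrite <- (Cmod_opp z).
  apply growth_closed_half_plane; destruct z; unfold Re in *; simpl in *; lra.
Qed.

Definition shifted (z : C) : C := power_series c (t + z ^ 2)%C.

(* With [w ^ 2 = t + z ^ 2] one has [(w - z) (w + z) = t], so that [w] lies
   within bounded distance of [z] or of [- z]. *)
Lemma shifted_growth : exists K1, 0 <= K1 /\ forall z,
  Cmod (shifted z) <= K1 * exp (Rabs (Im z)) * Rpower (1 + Cmod z) nu.
Proof.
  pose proof growth_const_nonneg as PK.
  set (beta := Cmod t + 1).
  pose proof (Cmod_ge_0 t) as Pt.
  assert (1 <= beta) as Pb by (unfold beta; lra).
  set (k := K * Rpower 2 (Rabs nu)).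
  assert (0 <= k) as Pk by (apply Rmult_le_pos; [trivial | left; apply Rpower_pos]).
  exists (k * exp beta * Rpower (1 + beta) (Rabs nu)); split.
  { repeat apply Rmult_le_pos; trivial; left; apply exp_pos. }
  intros z; unfold shifted; set (w := csqrt (t + z ^ 2)%C).
  assert (Cmod w <= Cmod z + beta /\ Cmod z <= Cmod w + beta
    /\ Rabs (Im w) <= Rabs (Im z) + beta) as [B1 [B2 B3]].
  { assert (Cmod (w - z)%C <= beta \/ Cmod (w - - z)%C <= beta) as [B|B].
    (* Were both factors larger than [beta], their product would exceed
       [beta ^ 2 >= beta > Cmod t]. *)
    { assert (Cmod (w - z)%C * Cmod (w - - z)%C = Cmod t) as E.
      { rewrite <- Cmod_mult; f_equal.
        replace ((w - z) * (w - - z))%C with (w ^ 2 - z ^ 2)%C by (simpl; ring).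
        unfold w; rewrite Hsqrt; ring. }
      destruct (Rle_dec (Cmod (w - z)%C) beta); [now left|].
      destruct (Rle_dec (Cmod (w - - z)%C) beta); [now right|].
      exfalso; unfold beta in *; nra. }
    - pose proof (Cmod_sub_le w z); pose proof (Cmod_sub_le z w); pose proof (Im_sub_le w z).
      replace (Cmod (z - w)%C) with (Cmod (w - z)%C) in *
        by (rewrite <- Cmod_opp; f_equal; ring).
      lra.
    - pose proof (Cmod_sub_le w (- z)%C); pose proof (Cmod_sub_le (- z)%C w).
      pose proof (Im_sub_le w (- z)%C).
      replace (Cmod (- z - w)%C) with (Cmod (w - - z)%C) in *
        by (rewrite <- Cmod_opp; f_equal; ring).
      replace (Rabs (Im (- z)%C)) with (Rabs (Im z)) in *
        by (unfold Im; simpl; symmetry; apply Rabs_Ropp).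
      rewrite Cmod_opp in *; lra. }
  replace (t + z ^ 2)%C with (w ^ 2)%C by apply Hsqrt.
  eapply Rle_trans; [apply growth_plane|]; fold k.
  assert (exp (Rabs (Im w)) <= exp (Rabs (Im z)) * exp beta)
    by (rewrite <- exp_plus; now apply exp_le).
  assert (Rpower (1 + Cmod w) nu <= Rpower (1 + beta) (Rabs nu) * Rpower (1 + Cmod z) nu)
    by (apply Rpower_shift_le; try apply Cmod_ge_0; lra).
  replace (k * exp beta * Rpower (1 + beta) (Rabs nu) * exp (Rabs (Im z)) * Rpower (1 + Cmod z) nu)
    with (k * (exp (Rabs (Im z)) * exp beta) * (Rpower (1 + beta) (Rabs nu) * Rpower (1 + Cmod z) nu))
    by ring.
  apply Rmult_le_compat; trivial.
  - apply Rmult_le_pos; [trivial | left; apply exp_pos].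
  - left; apply Rpower_pos.
  - now apply Rmult_le_compat_l.
Qed.

Lemma inv_pow_le z p : 1 <= Cmod z -> / Cmod z ^ p <= 2 ^ p * Rpower (1 + Cmod z) (- INR p).
Proof.
  intros Hz; rewrite Rpower_Ropp, Rpower_pow by lra.
  assert (0 < Cmod z ^ p) by (apply pow_lt; lra).
  assert (0 < (1 + Cmod z) ^ p) by (apply pow_lt; lra).
  apply Rmult_le_reg_r with (Cmod z ^ p); trivial; rewrite Rinv_l by lra.
  apply Rmult_le_reg_r with ((1 + Cmod z) ^ p); trivial.
  replace (2 ^ p * / (1 + Cmod z) ^ p * Cmod z ^ p * (1 + Cmod z) ^ p)
    with (2 ^ p * Cmod z ^ p) by (field; lra).
  rewrite Rmult_1_l, <- Rpow_mult_distr; apply pow_incr; lra.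
Qed.

Lemma shifted_div_growth p : nu < INR p - 1 -> exists s K2, 0 < s <= 1 /\ 0 <= K2 /\
  forall z, 1 <= Cmod z ->
  Cmod (shifted z) / Cmod z ^ p <= K2 * exp (Rabs (Im z)) * Rpower (1 + Cmod z) (- (1 + 2 * s)).
Proof.
  intros Hnu; destruct shifted_growth as [K1 [PK1 HK1]].
  (* Half of the gap, so that [nu - p <= - (1 + 2 * s)]; one [s] goes to the real direction and
     [1 + s] to the imaginary one. The cap 1 lets the powers -1 and -2 stand below [- s] and
     [- (1 + s)] when the constant term is estimated. *)
  set (s := Rmin ((INR p - 1 - nu) / 2) 1).
  assert (0 < s) as Ps by (apply Rmin_pos; lra).
  assert (s <= (INR p - 1 - nu) / 2) by apply Rmin_l.
  assert (s <= 1) by apply Rmin_r.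
  assert (0 < 2 ^ p) as P2 by (apply pow_lt; lra).
  exists s, (K1 * 2 ^ p); repeat split; trivial; [apply Rmult_le_pos; lra|].
  intros z Hz.
  assert (0 < Cmod z ^ p) by (apply pow_lt; lra).
  apply Rle_trans with (K1 * exp (Rabs (Im z)) * Rpower (1 + Cmod z) nu
    * (2 ^ p * Rpower (1 + Cmod z) (- INR p))).
  - apply Rmult_le_compat; trivial.
    + apply Cmod_ge_0.
    + left; now apply Rinv_0_lt_compat.
    + now apply inv_pow_le.
  - replace (K1 * exp (Rabs (Im z)) * Rpower (1 + Cmod z) nu * (2 ^ p * Rpower (1 + Cmod z) (- INR p)))
      with (K1 * 2 ^ p * exp (Rabs (Im z)) * (Rpower (1 + Cmod z) nu * Rpower (1 + Cmod z) (- INR p)))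
      by ring.
    rewrite <- Rpower_plus.
    apply Rmult_le_compat_l.
    + repeat apply Rmult_le_pos; try lra; left; apply exp_pos.
    + apply Rle_Rpower; lra.
Qed.

Lemma quotient_decay p : (1 <= p)%nat -> nu < INR p - 1 -> exists s A, 0 < s /\ 0 <= A /\
  forall z, 1 <= Cmod z ->
  Cmod (shifted z - power_series c t)%C / Cmod z ^ p <=
    A * exp (Rabs (Im z)) * Rpower (1 + Rabs (Re z)) (- s) * Rpower (1 + Rabs (Im z)) (- (1 + s)).
Proof.
  intros Hp Hnu; destruct (shifted_div_growth p Hnu) as [s [K2 [Ps [PK2 H]]]].
  pose proof (Cmod_ge_0 (power_series c t)) as P0.
  exists s, (K2 + 8 * Cmod (power_series c t)); split; [lra|]; split; [lra|].
  intros z Hz; specialize (H z Hz).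
  pose proof (re_le_Cmod z) as Rz; pose proof (im_le_Cmod z) as Iz.
  pose proof (Rabs_pos (Re z)); pose proof (Rabs_pos (Im z)).
  assert (0 < Cmod z ^ p) as Pz by (apply pow_lt; lra).
  set (X := Rpower (1 + Rabs (Re z)) (- s)).
  set (Y := Rpower (1 + Rabs (Im z)) (- (1 + s))).
  set (E := exp (Rabs (Im z))) in *.
  assert (0 < X) by apply Rpower_pos.
  assert (0 < Y) by apply Rpower_pos.
  assert (0 < E) by apply exp_pos.
  assert (Rpower (1 + Cmod z) (- (1 + 2 * s)) <= X * Y) as D1.
  { replace (- (1 + 2 * s)) with (- s + - (1 + s)) by ring; rewrite Rpower_plus.
    apply Rmult_le_compat; try (left; apply Rpower_pos); apply Rpower_neg_le; lra. }
  assert (/ Cmod z ^ p <= 2 * X) as D2.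
  { apply Rle_trans with (/ Cmod z ^ 1).
    - apply Rinv_le_contravar; [simpl; lra | now apply Rle_pow].
    - eapply Rle_trans; [now apply inv_pow_le|].
      rewrite pow_1; apply Rmult_le_compat_l; [lra|].
      apply Rle_trans with (Rpower (1 + Cmod z) (- s)).
      + apply Rle_Rpower; simpl; lra.
      + apply Rpower_neg_le; lra. }
  (* The constant term has no exponential growth, so [exp |Im z| >= (1 + |Im z|) ^ 2 / 4] supplies
     its missing decay in the imaginary direction; with the 2 of [D2] this explains the constant
     8. *)
  assert (1 <= 4 * E * Y) as D3.
  { assert (E >= (1 + Rabs (Im z)) ^ 2 / 4) as D4.
    { pose proof (exp_ineq1_le (Rabs (Im z) / 2)) as e.
      assert (E = exp (Rabs (Im z) / 2) * exp (Rabs (Im z) / 2)) as ->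
        by (unfold E; rewrite <- exp_plus; f_equal; field).
      nra. }
    assert (/ (1 + Rabs (Im z)) ^ 2 <= Y) as D5.
    { replace (/ (1 + Rabs (Im z)) ^ 2) with (Rpower (1 + Rabs (Im z)) (- INR 2)).
      - apply Rle_Rpower; simpl; lra.
      - rewrite Rpower_Ropp, Rpower_pow; lra. }
    assert (0 < (1 + Rabs (Im z)) ^ 2) as D6 by (apply pow_lt; lra).
    apply Rle_trans with ((1 + Rabs (Im z)) ^ 2 * / (1 + Rabs (Im z)) ^ 2).
    - right; field; lra.
    - apply Rmult_le_compat; try lra; left; now apply Rinv_0_lt_compat. }
  apply Rle_trans with (Cmod (shifted z) / Cmod z ^ p + Cmod (power_series c t) * / Cmod z ^ p).
  - unfold Rdiv; rewrite <- Rmult_plus_distr_r.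
    apply Rmult_le_compat_r; [left; now apply Rinv_0_lt_compat|].
    unfold Cminus; eapply Rle_trans; [apply Cmod_triangle | rewrite Cmod_opp; lra].
  - replace ((K2 + 8 * Cmod (power_series c t)) * E * X * Y)
      with (K2 * E * (X * Y) + Cmod (power_series c t) * (2 * X * (4 * E * Y))) by ring.
    apply Rplus_le_compat.
    + eapply Rle_trans; [exact H|]; apply Rmult_le_compat_l; trivial.
      apply Rmult_le_pos; lra.
    + apply Rmult_le_compat_l; trivial.
      eapply Rle_trans; [exact D2|].
      rewrite <- (Rmult_1_r (2 * X)) at 1; apply Rmult_le_compat_l; lra.
Qed.

(** The difference quotient of [j] at [t]: the functions [F] of the two cases are
    [z * q (t + z ^ 2)] and [q (t + z ^ 2)], visibly entire. *)
Let q : C -> C := power_series (quot_coef c t).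
Let q' : C -> C := power_series (deriv_coef (quot_coef c t)).

Lemma shifted_quotient z : (shifted z - power_series c t = z * z * q (t + z ^ 2))%C.
Proof.
  unfold shifted, q; rewrite power_series_quotient by trivial.
  f_equal; simpl; ring.
Qed.

Lemma square_cderiv z : cderiv (fun w => t + w ^ 2)%C z (2 * z)%C.
Proof.
  pose proof (cderiv_plus _ _ z _ _ (cderiv_const t z)
    (cderiv_mult _ _ z _ _ (cderiv_id z) (cderiv_id z))) as S.
  cbv beta in S; replace (0 + (1 * z + z * 1))%C with (2 * z)%C in S by ring.
  refine (cderiv_ext _ _ _ _ _ S); intros w; simpl; ring.
Qed.

Lemma quotient_cderiv z : cderiv (fun w => q (t + w ^ 2))%C z (q' (t + z ^ 2) * (2 * z))%C.
Proof.
  apply (cderiv_comp q (fun w => t + w ^ 2)%C).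
  - now apply power_series_derive, entire_quot_coef.
  - apply square_cderiv.
Qed.

Lemma quotient_derivative_ccont z : ccont (fun w => q' (t + w ^ 2) * (2 * w))%C z.
Proof.
  apply (ccont_mult (fun w => q' (t + w ^ 2))%C (fun w => 2 * w)%C).
  - apply (ccont_comp q' (fun w => t + w ^ 2)%C).
    + now apply power_series_ccont, entire_deriv_coef, entire_quot_coef.
    + eapply cderiv_ccont, square_cderiv.
  - apply (ccont_mult (fun _ => 2)%C (fun w => w)); eapply cderiv_ccont;
      [apply cderiv_const | apply cderiv_id].
Qed.

Lemma Cmod_gt_0_neq (z : C) : 1 <= Cmod z -> z <> 0%C.
Proof. intros H ->; rewrite Cmod_0 in H; lra. Qed.

Lemma quotient_series_odd : nu < 0 ->
  is_Cseries (fun n => RtoC ((-1) ^ n) *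
    ((shifted (RtoC (PI / 2 + INR n * PI)) - power_series c t) / RtoC (PI / 2 + INR n * PI)))%C (RtoC 0).
Proof.
  intros Hnu; destruct (quotient_decay 1) as [s [A [Ps [PA HA]]]]; [lia | simpl; lra |].
  pose proof PI_RGT_0 as Hpi.
  apply is_Cseries_ext with (fun n => RtoC ((-1) ^ n) *
    ((fun z => z * q (t + z ^ 2)) (RtoC (PI / 2 + INR n * PI))))%C.
  { intros n; f_equal; cbv beta; rewrite shifted_quotient; field.
    intros E; apply RtoC_inj in E; pose proof (pos_INR n); nra. }
  apply (alternating_series_odd (fun z => z * q (t + z ^ 2))%C
    (fun z => 1 * q (t + z ^ 2) + z * (q' (t + z ^ 2) * (2 * z)))%C A s); trivial.
  - intros z; apply (cderiv_mult (fun z => z) (fun z => q (t + z ^ 2))%C);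
      [apply cderiv_id | apply quotient_cderiv].
  - intros z.
    apply (ccont_plus (fun z => 1 * q (t + z ^ 2))%C (fun z => z * (q' (t + z ^ 2) * (2 * z)))%C).
    + apply (ccont_mult (fun _ => 1%C) (fun z => q (t + z ^ 2))%C); eapply cderiv_ccont;
        [apply cderiv_const | apply quotient_cderiv].
    + apply (ccont_mult (fun z => z) (fun z => q' (t + z ^ 2) * (2 * z))%C);
        [eapply cderiv_ccont, cderiv_id | apply quotient_derivative_ccont].
  - intros z Hz; eapply Rle_trans; [right | exact (HA z Hz)].
    rewrite shifted_quotient, !Cmod_mult; simpl; field; lra.
  - intros z; cbv beta; replace ((- z) ^ 2)%C with (z ^ 2)%C by (simpl; ring); ring.
Qed.

Lemma quotient_series_even : nu < 1 ->
  is_Cseries (fun n => RtoC ((-1) ^ n) *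
    ((shifted (RtoC (PI + INR n * PI)) - power_series c t) / RtoC (PI + INR n * PI) ^ 2))%C
    (q t / 2)%C.
Proof.
  intros Hnu; destruct (quotient_decay 2) as [s [A [Ps [PA HA]]]]; [lia | simpl; lra |].
  pose proof PI_RGT_0 as Hpi.
  apply is_Cseries_ext with (fun n => RtoC ((-1) ^ n) *
    ((fun z => q (t + z ^ 2)) (RtoC (PI + INR n * PI))))%C.
  { intros n; f_equal; cbv beta; rewrite shifted_quotient; field.
    intros E; apply RtoC_inj in E; pose proof (pos_INR n); nra. }
  replace (q t / 2)%C with ((fun z => q (t + z ^ 2)) 0 / 2)%C
    by (cbv beta; do 2 f_equal; simpl; ring).
  apply (alternating_series_even (fun z => q (t + z ^ 2))%C
    (fun z => q' (t + z ^ 2) * (2 * z))%C A s); trivial.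
  - apply quotient_cderiv.
  - apply quotient_derivative_ccont.
  - intros z Hz; eapply Rle_trans; [right | exact (HA z Hz)].
    rewrite shifted_quotient, !Cmod_mult; simpl; field; lra.
  - intros z; cbv beta; replace ((- z) ^ 2)%C with (z ^ 2)%C by (simpl; ring); ring.
Qed.

End Growth.

(** * The Leibniz series and the alternating sum of inverse squares *)

(** The integral test by the mean value theorem: each term from the second on is at most an
    increment of the antiderivative [f], and these increments telescope. *)
Lemma ex_series_Rpower s : 0 < s -> ex_series (fun n => Rpower (INR (S n)) (- (1 + s))).
Proof.
  intros Hs.
  set (f := fun x => - / s * Rpower x (- s)).
  assert (forall x, 0 < x -> is_derive f x (Rpower x (- (1 + s)))) as D.
  { intros x Hx; unfold f, Rpower; auto_derive; [lra|].
    replace (exp (- (1 + s) * ln x)) with (exp (- s * ln x) * / x).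
    - field; lra.
    - replace (- (1 + s) * ln x) with (- s * ln x + - ln x) by ring.
      rewrite exp_plus, exp_Ropp, exp_ln by lra; trivial. }
  apply ex_series_incr_1.
  apply (ex_series_le (V := R_CompleteNormedModule) _ (fun n => f (INR (S (S n))) - f (INR (S n)))).
  - intros n; unfold norm; simpl norm; unfold abs; simpl abs.
    rewrite Rabs_pos_eq by (left; apply Rpower_pos).
    pose proof (S_INR (S n)) as E; pose proof (lt_0_INR (S n) ltac:(lia)) as P.
    destruct (MVT_gen f (INR (S n)) (INR (S (S n))) (fun x => Rpower x (- (1 + s)))) as [z [Hz M]].
    + intros x Hx; rewrite Rmin_left in Hx by lra; apply D; lra.
    + intros x Hx; rewrite Rmin_left in Hx by lra.
      apply continuity_pt_filterlim, (ex_derive_continuous f); eexists; apply D; lra.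
    + rewrite Rmin_left, Rmax_right in Hz by lra.
      rewrite M; replace (INR (S (S n)) - INR (S n)) with 1 by lra; rewrite Rmult_1_r.
      apply Rpower_neg_le; lra.
  - exists (0 - f (INR 1)).
    change (is_lim_seq (sum_n (fun n => f (INR (S (S n))) - f (INR (S n)))) (0 - f (INR 1))).
    apply (is_lim_seq_ext (fun n => f (INR (S (S n))) - f (INR 1))).
    + induction n as [|n IH]; [now rewrite sum_O|].
      rewrite sum_Sn, <- IH.
      change (f (INR (S (S (S n)))) - f (INR 1) = f (INR (S (S n))) - f (INR 1)
        + (f (INR (S (S (S n)))) - f (INR (S (S n))))); ring.
    + apply is_lim_seq_minus'; [|apply is_lim_seq_const].
      replace (Finite 0) with (Rbar_mult (- / s) 0) by (simpl; f_equal; ring).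
      apply is_lim_seq_scal_l, is_lim_seq_Rpower_neg; trivial.
      apply (is_lim_seq_incr_1 (fun n => INR (S n)) p_infty).
      apply (is_lim_seq_incr_1 INR p_infty), is_lim_seq_INR.
Qed.

Lemma is_Rseries_ext (a b : nat -> R) l :
  (forall n, a n = b n) -> is_series a l -> is_series b l.
Proof. exact (is_series_ext a b l). Qed.

Lemma is_Rseries_scal (k : R) (a : nat -> R) l :
  is_series a l -> is_series (fun n => k * a n) (k * l).
Proof. exact (is_series_scal_l k a l). Qed.

Lemma is_Rseries_plus (a b : nat -> R) l m : is_series a l -> is_series b m ->
  is_series (fun n => a n + b n) (l + m).
Proof. exact (is_series_plus a b l m). Qed.

Lemma is_Rseries_minus (a b : nat -> R) l m : is_series a l -> is_series b m ->
  is_series (fun n => a n - b n) (l - m).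
Proof. exact (is_series_minus a b l m). Qed.

Lemma leibniz_series : is_series (fun n => (-1) ^ n / (INR n + 1 / 2)) (PI / 2).
Proof.
  assert (is_series (tg_alt PI_tg) (PI / 4)) as L.
  { rewrite <- Alt_PI_eq; unfold Alt_PI; destruct exist_PI as [l Hl].
    replace (4 * l / 4) with l by field.
    apply is_series_Reals; exact Hl. }
  apply (is_Rseries_scal 2) in L.
  replace (PI / 2) with (2 * (PI / 4)) by field.
  refine (is_Rseries_ext _ _ _ _ L); intros n.
  unfold tg_alt, PI_tg.
  rewrite plus_INR, mult_INR; pose proof (pos_INR n); simpl INR; field; lra.
Qed.

(** * The complex cosine and its growth *)

Definition cos_coef (n : nat) : C := RtoC (cos_n n).
Definition ccos (z : C) : C := power_series cos_coef (z ^ 2)%C.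
(** Minus the derivative of [ccos], so that only the derivative of [csin] itself requires work. *)
Definition csin (z : C) : C := (- (power_series (deriv_coef cos_coef) (z ^ 2) * (2 * z)))%C.

Lemma cos_series x : is_series (fun n => cos_n n * Rsqr x ^ n) (cos x).
Proof.
  apply is_series_Reals; unfold cos; destruct (exist_cos (Rsqr x)) as [l Hl]; exact Hl.
Qed.

Lemma entire_cos_coef : entire_coef cos_coef.
Proof.
  intros r Hr.
  pose proof (cos_series (sqrt r)) as H; rewrite Rsqr_sqrt in H by lra.
  assert (ex_series (fun n => cos_n n * r ^ n)) as E by now exists (cos (sqrt r)).
  apply ex_series_lim_0 in E; destruct (filterlim_bounded (fun n => cos_n n * r ^ n)) as [M HM];
    [now exists 0|].
  exists M; intros n; specialize (HM n); unfold cos_coef; rewrite Cmod_R.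
  rewrite <- (Rabs_pos_eq (r ^ n)) by (apply pow_le; lra).
  rewrite <- Rabs_mult; exact HM.
Qed.

Lemma ccos_real x : ccos (RtoC x) = RtoC (cos x).
Proof.
  apply is_Cseries_unique with (fun n => cos_coef n * (RtoC x ^ 2) ^ n)%C.
  - apply power_series_correct, entire_cos_coef.
  - apply is_Cseries_ext with (fun n => RtoC (cos_n n * Rsqr x ^ n)).
    + intros n; unfold cos_coef; rewrite RtoC_mult, RtoC_pow; do 2 f_equal.
      unfold Rsqr; rewrite RtoC_mult; simpl; ring.
    + apply is_Cseries_components; split; simpl.
      * exact (cos_series x).
      * apply is_series_zero.
Qed.

Lemma ccos_cderiv z : cderiv ccos z (- csin z)%C.
Proof.
  pose proof (square_cderiv 0 z) as S.
  assert (cderiv (fun w => w ^ 2)%C z (2 * z)%C) as S'.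
  { refine (cderiv_ext _ _ _ _ _ S); intros w; ring. }
  replace (- csin z)%C with (power_series (deriv_coef cos_coef) (z ^ 2) * (2 * z))%C by (unfold csin; ring).
  apply (cderiv_comp (power_series cos_coef) (fun w => w ^ 2)%C); trivial.
  apply power_series_derive, entire_cos_coef.
Qed.

Lemma power_series_deriv_coef_mul c w : entire_coef c ->
  is_Cseries (fun n => RtoC (INR n) * c n * w ^ n)%C (w * power_series (deriv_coef c) w)%C.
Proof.
  intros Hc; apply is_Cseries_decr_1.
  apply is_Cseries_ext with (fun n => w * (deriv_coef c n * w ^ n))%C.
  - intros n; unfold deriv_coef; simpl; ring.
  - replace (w * power_series (deriv_coef c) w - RtoC (INR 0) * c 0%nat * w ^ 0)%C
      with (w * power_series (deriv_coef c) w)%C by (simpl; ring).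
    apply is_Cseries_scal, power_series_correct, entire_deriv_coef, Hc.
Qed.

Lemma cos_n_S n : cos_n (S n) = - cos_n n * / (2 * (INR n + 1) * (2 * INR n + 1)).
Proof.
  unfold cos_n.
  replace (fact (2 * S n)) with ((2 * S n) * ((2 * n + 1) * fact (2 * n)))%nat
    by (replace (2 * S n)%nat with (S (S (2 * n))) by lia; simpl fact; nia).
  rewrite !mult_INR, plus_INR, mult_INR, (S_INR n).
  replace (INR 2) with 2 by (simpl; ring); replace (INR 1) with 1 by (simpl; ring).
  pose proof (INR_fact_neq_0 (2 * n)); pose proof (pos_INR n).
  change ((-1) ^ S n) with (-1 * (-1) ^ n); field; repeat split; trivial; lra.
Qed.

(** The equation [cos'' = - cos] in the variable [w = z ^ 2], read off from the recursion of the
    coefficients. It yields the derivative of [csin], and at [w = 0] the value -1/2 of the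
    derivative. *)
Lemma cos_coef_ode w :
  (2 * power_series (deriv_coef cos_coef) w + 4 * (w * power_series (deriv_coef (deriv_coef cos_coef)) w) = - power_series cos_coef w)%C.
Proof.
  pose proof entire_cos_coef as Hc.
  apply is_Cseries_unique with (fun n => 2 * (deriv_coef cos_coef n * w ^ n)
    + 4 * (RtoC (INR n) * deriv_coef cos_coef n * w ^ n))%C.
  - apply is_Cseries_plus; apply is_Cseries_scal.
    + apply power_series_correct, entire_deriv_coef, Hc.
    + apply power_series_deriv_coef_mul, entire_deriv_coef, Hc.
  - replace (- power_series cos_coef w)%C with (- (1) * power_series cos_coef w)%C by ring.
    apply is_Cseries_ext with (fun n => - (1) * (cos_coef n * w ^ n))%C.
    + intros n; unfold deriv_coef, cos_coef; rewrite cos_n_S, S_INR.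
      generalize (cos_n n); intros a; pose proof (pos_INR n).
      set (d := - a * / (2 * (INR n + 1) * (2 * INR n + 1))).
      replace a with (- ((2 + 4 * INR n) * ((INR n + 1) * d))) by (unfold d; field; lra).
      rewrite RtoC_opp, (RtoC_mult (2 + 4 * INR n)), (RtoC_plus 2), (RtoC_mult 4), (RtoC_mult _ d).
      simpl; ring.
    + apply is_Cseries_scal, power_series_correct, Hc.
Qed.

Lemma csin_cderiv z : cderiv csin z (ccos z).
Proof.
  pose proof (square_cderiv 0 z) as S.
  assert (cderiv (fun w => w ^ 2)%C z (2 * z)%C) as S'.
  { refine (cderiv_ext _ _ _ _ _ S); intros w; ring. }
  pose proof (entire_deriv_coef _ entire_cos_coef) as Hd.
  pose proof (cderiv_mult _ _ z _ _ (cderiv_const (- (2))%C z)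
    (cderiv_mult _ _ z _ _ (cderiv_comp _ _ z _ _ (power_series_derive _ (z ^ 2)%C Hd) S') (cderiv_id z))) as K.
  cbv beta in K.
  replace (ccos z) with (0 * (power_series (deriv_coef cos_coef) (z ^ 2) * z)
    + - (2) * (power_series (deriv_coef (deriv_coef cos_coef)) (z ^ 2) * (2 * z) * z
       + power_series (deriv_coef cos_coef) (z ^ 2) * 1))%C.
  - refine (cderiv_ext _ _ _ _ _ K); intros w; unfold csin; ring.
  - unfold ccos; pose proof (cos_coef_ode (z ^ 2)%C) as E.
    replace (power_series cos_coef (z ^ 2))%C with (- - power_series cos_coef (z ^ 2))%C by ring.
    rewrite <- E; simpl; ring.
Qed.

Lemma csin_real x : csin (RtoC x) = RtoC (sin x).
Proof.
  destruct (cderiv_Re_x _ _ _ _ (ccos_cderiv (RtoC x))) as [H1 H2].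
  assert (- Re (csin (RtoC x)) = - sin x) as E1.
  { rewrite <- (is_derive_unique _ _ _ (is_derive_cos x)).
    transitivity (Derive (fun s => Re (ccos (s, 0))) x).
    - symmetry; apply is_derive_unique, H1.
    - apply Derive_ext; intros s.
      replace ((s, 0) : C) with (RtoC s) by reflexivity; now rewrite ccos_real. }
  assert (- Im (csin (RtoC x)) = 0) as E2.
  { rewrite <- (Derive_const 0 x).
    transitivity (Derive (fun s => Im (ccos (s, 0))) x).
    - symmetry; apply is_derive_unique, H2.
    - apply Derive_ext; intros s.
      replace ((s, 0) : C) with (RtoC s) by reflexivity; now rewrite ccos_real. }
  destruct (csin (RtoC x)) as [a b]; unfold Re, Im in *; simpl in *.
  unfold RtoC; f_equal; lra.
Qed.

Lemma derive_zero_const (f : R -> R) y : (forall s, is_derive f s 0) -> f y = f 0.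
Proof.
  intros H; destruct (MVT_gen f 0 y (fun _ => 0)) as [z [_ E]].
  - intros s _; apply H.
  - intros s _; apply continuity_pt_filterlim, (ex_derive_continuous f); eexists; apply H.
  - lra.
Qed.

Lemma is_derive_mult_R (f g : R -> R) x l m : is_derive f x l -> is_derive g x m ->
  is_derive (fun s => f s * g s) x (l * g x + f x * m).
Proof. intros Hf Hg; apply (is_derive_mult f g); trivial; intros; apply Rmult_comm. Qed.

(* In the direction of the imaginary axis [(ccos, csin)] solves a linear system
   whose first integrals below recover [ccos] from its values on the real axis. *)
Lemma ccos_explicit x y : ccos (x, y) = (cos x * cosh y, - (sin x * sinh y)).
Proof.
  set (c1 := fun s => Re (ccos (x, s))); set (c2 := fun s => Im (ccos (x, s))).
  set (s1 := fun s => Re (csin (x, s))); set (s2 := fun s => Im (csin (x, s))).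
  assert (forall s, is_derive c1 s (s2 s) /\ is_derive c2 s (- s1 s)) as Dc.
  { intros s; destruct (cderiv_Re_y _ _ _ _ (ccos_cderiv (x, s))) as [H1 H2]; split.
    - replace (s2 s) with (- Im (- csin (x, s))%C) by (unfold s2, Im; simpl; ring); exact H1.
    - exact H2. }
  assert (forall s, is_derive s1 s (- c2 s) /\ is_derive s2 s (c1 s)) as Ds.
  { intros s; exact (cderiv_Re_y _ _ _ _ (csin_cderiv (x, s))). }
  assert (c1 0 = cos x /\ c2 0 = 0 /\ s1 0 = sin x /\ s2 0 = 0) as [C1 [C2 [S1 S2]]].
  { unfold c1, c2, s1, s2; replace ((x, 0) : C) with (RtoC x) by reflexivity.
    rewrite ccos_real, csin_real; repeat split. }
  assert (c1 y * cosh y - s2 y * sinh y = cos x) as K1.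
  { rewrite (derive_zero_const (fun s => c1 s * cosh s - s2 s * sinh s) y).
    - rewrite C1, S2, cosh_0; ring.
    - intros s; replace 0 with (minus (s2 s * cosh s + c1 s * sinh s) (c1 s * sinh s + s2 s * cosh s))
        by (unfold minus, plus, opp; simpl; ring).
      apply (is_derive_minus (fun s => c1 s * cosh s) (fun s => s2 s * sinh s));
        apply is_derive_mult_R; try apply Dc; try apply Ds;
        [apply is_derive_cosh | apply is_derive_sinh]. }
  assert (c1 y * sinh y - s2 y * cosh y = 0) as K2.
  { rewrite (derive_zero_const (fun s => c1 s * sinh s - s2 s * cosh s) y).
    - rewrite S2, sinh_0; ring.
    - intros s; replace 0 with (minus (s2 s * sinh s + c1 s * cosh s) (c1 s * cosh s + s2 s * sinh s))
        by (unfold minus, plus, opp; simpl; ring).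
      apply (is_derive_minus (fun s => c1 s * sinh s) (fun s => s2 s * cosh s));
        apply is_derive_mult_R; try apply Dc; try apply Ds;
        [apply is_derive_sinh | apply is_derive_cosh]. }
  assert (c2 y * cosh y + s1 y * sinh y = 0) as K3.
  { rewrite (derive_zero_const (fun s => c2 s * cosh s + s1 s * sinh s) y).
    - rewrite C2, sinh_0; ring.
    - intros s; replace 0 with (plus (- s1 s * cosh s + c2 s * sinh s) (- c2 s * sinh s + s1 s * cosh s))
        by (unfold minus, plus, opp; simpl; ring).
      apply (is_derive_plus (fun s => c2 s * cosh s) (fun s => s1 s * sinh s));
        apply is_derive_mult_R; try apply Dc; try apply Ds;
        [apply is_derive_cosh | apply is_derive_sinh]. }
  assert (c2 y * sinh y + s1 y * cosh y = sin x) as K4.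
  { rewrite (derive_zero_const (fun s => c2 s * sinh s + s1 s * cosh s) y).
    - rewrite S1, sinh_0, cosh_0; ring.
    - intros s; replace 0 with (plus (- s1 s * sinh s + c2 s * cosh s) (- c2 s * cosh s + s1 s * sinh s))
        by (unfold minus, plus, opp; simpl; ring).
      apply (is_derive_plus (fun s => c2 s * sinh s) (fun s => s1 s * cosh s));
        apply is_derive_mult_R; try apply Dc; try apply Ds;
        [apply is_derive_sinh | apply is_derive_cosh]. }
  pose proof (cosh_sinh_sqr y) as Q.
  replace (ccos (x, y)) with ((c1 y, c2 y) : C) by (unfold c1, c2; symmetry; apply surjective_pairing).
  rewrite <- K1, <- K4; f_equal.
  - replace (c1 y) with (c1 y * (cosh y * cosh y - sinh y * sinh y)) at 1 by (rewrite Q; ring).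
    transitivity ((c1 y * cosh y - s2 y * sinh y) * cosh y - (c1 y * sinh y - s2 y * cosh y) * sinh y);
      [ring | rewrite K2; ring].
  - replace (c2 y) with (c2 y * (cosh y * cosh y - sinh y * sinh y)) at 1 by (rewrite Q; ring).
    transitivity ((c2 y * cosh y + s1 y * sinh y) * cosh y - (c2 y * sinh y + s1 y * cosh y) * sinh y);
      [ring | rewrite K3; ring].
Qed.

Lemma ccos_growth z : Cmod (ccos z) <= 2 * exp (Rabs (Im z)).
Proof.
  destruct z as [x y]; rewrite ccos_explicit; simpl Im.
  pose proof (cosh_pos y) as Pc.
  assert (cosh y <= exp (Rabs y) /\ Rabs (sinh y) <= exp (Rabs y)) as [B1 B2].
  { assert (exp y <= exp (Rabs y)) by (apply exp_le, Rle_abs).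
    assert (exp (- y) <= exp (Rabs y)) by (apply exp_le; rewrite <- Rabs_Ropp; apply Rle_abs).
    pose proof (exp_pos y); pose proof (exp_pos (- y)).
    unfold cosh, sinh; split; [lra | apply Rabs_le; lra]. }
  replace ((cos x * cosh y, - (sin x * sinh y)) : C)
    with (RtoC (cos x * cosh y) + Ci * RtoC (- (sin x * sinh y)))%C
    by (unfold Cplus, Cmult, Ci, RtoC; simpl; f_equal; ring).
  eapply Rle_trans; [apply Cmod_triangle|].
  rewrite Cmod_mult, Cmod_Ci, !Cmod_R, Rabs_Ropp, !Rabs_mult, (Rabs_pos_eq (cosh y)) by lra.
  assert (Rabs (cos x) <= 1) by (apply Rabs_le, COS_bound).
  assert (Rabs (sin x) <= 1) by (apply Rabs_le, SIN_bound).
  pose proof (Rabs_pos (cos x)); pose proof (Rabs_pos (sin x)); pose proof (Rabs_pos (sinh y)).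
  nra.
Qed.

Lemma cos_nat_PI n : cos (INR n * PI) = (-1) ^ n.
Proof.
  induction n as [|n IH]; [simpl; rewrite Rmult_0_l; apply cos_0|].
  rewrite S_INR, Rmult_plus_distr_r, Rmult_1_l, neg_cos, IH; simpl; ring.
Qed.

(** For [J = cos] and [b = 0] the value at [k PI] is [(-1) ^ k], so with [k = n + 1] the summand
    [(-1) ^ n * ((-1) ^ k - 1)] equals [- (1 + (-1) ^ n)] and only odd [k] survive. *)
Lemma odd_squares_series (csqrt : C -> C) : (forall w : C, (csqrt w ^ 2)%C = w) ->
  is_series (fun n => (1 + (-1) ^ n) / INR (S n) ^ 2) (PI ^ 2 / 4).
Proof.
  intros Hsqrt; pose proof PI_RGT_0 as Hpi.
  assert (is_Cseries (fun n => RtoC ((-1) ^ n) *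
    ((shifted cos_coef 0 (RtoC (PI + INR n * PI)) - power_series cos_coef 0)
      / RtoC (PI + INR n * PI) ^ 2))%C (power_series (quot_coef cos_coef 0) 0 / 2)%C) as H.
  (* Growth constant 2 and exponent 0, from [ccos_growth]. *)
  { apply (quotient_series_even cos_coef csqrt 2 0); trivial; [apply entire_cos_coef | | lra].
    intros z _; rewrite Rpower_O by (pose proof (Cmod_ge_0 z); lra).
    rewrite Rmult_1_r; apply ccos_growth. }
  assert (power_series cos_coef 0 = 1%C) as E0.
  { replace (power_series cos_coef 0) with (ccos (RtoC 0)).
    - now rewrite ccos_real, cos_0.
    - unfold ccos; f_equal; simpl; ring. }
  assert (power_series (quot_coef cos_coef 0) 0 = RtoC (- (1 / 2))) as E1.
  { rewrite <- power_series_derive_quotient by apply entire_cos_coef.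
    pose proof (cos_coef_ode 0) as E; rewrite E0 in E.
    replace (2 * power_series (deriv_coef cos_coef) 0 + 4 * (0 * power_series (deriv_coef (deriv_coef cos_coef)) 0))%C
      with (2 * power_series (deriv_coef cos_coef) 0)%C in E by ring.
    destruct (power_series (deriv_coef cos_coef) 0) as [a b].
    unfold Cmult, Copp, RtoC in E; simpl in E; injection E; intros Eb Ea.
    unfold RtoC; f_equal; lra. }
  rewrite E0, E1 in H.
  apply (is_Cseries_scal (RtoC (- PI ^ 2))) in H.
  apply is_Cseries_components in H; destruct H as [H _].
  replace (PI ^ 2 / 4) with (Re (RtoC (- PI ^ 2) * (RtoC (- (1 / 2)) / 2))%C).
  - refine (is_Rseries_ext _ _ _ _ H); intros n.
    assert (RtoC (PI + INR n * PI) = RtoC (INR (S n) * PI)) as ->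
      by (f_equal; rewrite S_INR; ring).
    assert (shifted cos_coef 0 (RtoC (INR (S n) * PI)) = RtoC ((-1) ^ S n)) as ->.
    { rewrite <- cos_nat_PI, <- ccos_real; unfold shifted, ccos; f_equal; ring. }
    pose proof (lt_0_INR (S n) ltac:(lia)).
    assert (INR (S n) * PI <> 0) by nra.
    rewrite <- RtoC_pow, <- RtoC_minus, <- RtoC_div, <- !RtoC_mult by now apply pow_nonzero.
    unfold Re, RtoC, fst; pose proof (pow_m1_sqr n) as Sq.
    transitivity (((-1) ^ n + (-1) ^ n * (-1) ^ n) / INR (S n) ^ 2).
    + change ((-1) ^ S n) with (-1 * (-1) ^ n); field; lra.
    + rewrite Sq; f_equal; ring.
  - rewrite <- RtoC_div, <- RtoC_mult by lra; unfold Re, RtoC, fst; field.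
Qed.

Lemma is_series_even_terms (b : nat -> R) l :
  (forall k, b (2 * k)%nat = 0) -> ex_series b ->
  is_series (fun k => b (S (2 * k))) l -> is_series b l.
Proof.
  intros H0 [l' Hb] Hs; replace l with l'; trivial.
  assert (forall n, sum_n b (S (2 * n)) = sum_n (fun k => b (S (2 * k))) n) as E.
  { induction n as [|n IH].
    - rewrite sum_Sn, !sum_O; change (b (2 * 0)%nat + b 1%nat = b 1%nat).
      rewrite H0; ring.
    - replace (S (2 * S n)) with (S (S (S (2 * n)))) by lia.
      rewrite sum_Sn, sum_Sn, IH, sum_Sn.
      replace (S (S (2 * n))) with (2 * S n)%nat by lia.
      rewrite H0; change (sum_n (fun k => b (S (2 * k))) n + 0 + b (S (2 * S n))
        = sum_n (fun k => b (S (2 * k))) n + b (S (2 * S n))); ring. }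
  assert (is_lim_seq (fun n => sum_n b (S (2 * n))) l') as L1.
  { apply (is_lim_seq_subseq (sum_n b) l' (fun n => S (2 * n))); [|exact Hb].
    apply eventually_subseq; intros n; lia. }
  assert (is_lim_seq (fun n => sum_n b (S (2 * n))) l) as L2.
  { apply (is_lim_seq_ext (sum_n (fun k => b (S (2 * k))))); [intros n; now rewrite E | exact Hs]. }
  apply is_lim_seq_unique in L1; apply is_lim_seq_unique in L2.
  rewrite L1 in L2; now injection L2.
Qed.

(** The alternating sum is [zeta - PI ^ 2 / 4]. Adding [zeta] to it leaves twice the even terms,
    that is [zeta / 2]; the resulting equation [2 zeta - PI ^ 2 / 4 = zeta / 2] determines
    [zeta]. *)
Lemma eta_two_series (csqrt : C -> C) : (forall w : C, (csqrt w ^ 2)%C = w) ->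
  is_series (fun n => (-1) ^ S n / INR (S n) ^ 2) (- (PI ^ 2 / 12)).
Proof.
  intros Hsqrt; pose proof (odd_squares_series csqrt Hsqrt) as Hodd.
  assert (ex_series (fun n => / INR (S n) ^ 2)) as [zeta Hz].
  { refine (ex_series_ext _ _ _ (ex_series_Rpower 1 ltac:(lra))); intros n.
    pose proof (lt_0_INR (S n) ltac:(lia)).
    replace (- (1 + 1)) with (- INR 2) by (simpl; ring).
    now rewrite Rpower_Ropp, Rpower_pow. }
  assert (is_series (fun n => (-1) ^ S n / INR (S n) ^ 2) (zeta - PI ^ 2 / 4)) as He.
  { refine (is_Rseries_ext _ _ _ _ (is_Rseries_minus _ _ _ _ Hz Hodd)); intros n.
    pose proof (lt_0_INR (S n) ltac:(lia)).
    change ((-1) ^ S n) with (-1 * (-1) ^ n); field; lra. }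
  assert (is_series (fun n => (1 - (-1) ^ n) / INR (S n) ^ 2) (zeta + (zeta - PI ^ 2 / 4))) as H1.
  { refine (is_Rseries_ext _ _ _ _ (is_Rseries_plus _ _ _ _ Hz He)); intros n.
    pose proof (lt_0_INR (S n) ltac:(lia)).
    change ((-1) ^ S n) with (-1 * (-1) ^ n); field; lra. }
  assert (is_series (fun n => (1 - (-1) ^ n) / INR (S n) ^ 2) (/ 2 * zeta)) as H2.
  { apply is_series_even_terms.
    - intros k; rewrite pow_1_even; unfold Rdiv; ring.
    - now exists (zeta + (zeta - PI ^ 2 / 4)).
    - refine (is_Rseries_ext _ _ _ _ (is_Rseries_scal (/ 2) _ _ Hz)); intros k.
      rewrite pow_1_odd.
      replace (S (S (2 * k))) with (2 * S k)%nat by lia; rewrite mult_INR.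
      pose proof (lt_0_INR (S k) ltac:(lia)); simpl (INR 2); field; lra. }
  apply is_series_unique in H1; apply is_series_unique in H2.
  replace (- (PI ^ 2 / 12)) with (zeta - PI ^ 2 / 4) by lra; exact He.
Qed.

Open Scope C_scope.

(** * Mueller-Schleicher sums *)

Lemma is_Cseries_RtoC (r : nat -> R) l : is_series r l -> is_Cseries (fun n => RtoC (r n)) (RtoC l).
Proof.
  intros H; apply is_Cseries_components; split; [exact H | apply is_series_zero].
Qed.

Lemma is_series_pairs (a : nat -> R) l :
  is_series a l -> is_series (fun k => (a (2 * k)%nat + a (S (2 * k)))%R) l.
Proof.
  intros H.
  change (is_lim_seq (sum_n (fun k => (a (2 * k)%nat + a (S (2 * k)))%R)) l).
  apply (is_lim_seq_ext (fun n => sum_n a (S (2 * n)))).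
  - induction n as [|n IH].
    + rewrite sum_Sn, !sum_O; reflexivity.
    + replace (S (2 * S n)) with (S (S (S (2 * n)))) by lia.
      rewrite sum_Sn, sum_Sn, IH, sum_Sn.
      replace (S (S (2 * n))) with (2 * S n)%nat by lia.
      symmetry; apply (plus_assoc (G := R_AbelianMonoid)).
  - apply (is_lim_seq_subseq (sum_n a) l (fun n => S (2 * n))); [|exact H].
    apply eventually_subseq; intros n; lia.
Qed.

Lemma is_Cseries_pairs (a : nat -> C) l :
  is_Cseries a l -> is_Cseries (fun k => a (2 * k)%nat + a (S (2 * k))) l.
Proof.
  intros H; apply is_Cseries_components in H; destruct H as [H1 H2].
  apply is_Cseries_components; split;
    [exact (is_series_pairs _ _ H1) | exact (is_series_pairs _ _ H2)].
Qed.

Section AlternatingSums.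

Variables (c : nat -> C) (csqrt : C -> C) (K nu : R) (t : C).
Hypothesis Hc : entire_coef c.
Hypothesis Hsqrt : forall w : C, csqrt w ^ 2 = w.
Hypothesis Hgrowth : forall z : C, (0 < Re z)%R ->
  (Cmod (power_series c (z ^ 2)%C)%C <= K * exp (Rabs (Im z)) * Rpower (1 + Cmod z) nu)%R.

Definition alternating_term_odd (n : nat) : C :=
  RtoC ((-1) ^ n / (INR n + 1 / 2)) * power_series c (t + RtoC (PI ^ 2 * (INR n + 1 / 2) ^ 2)).

Definition alternating_term_even (n : nat) : C :=
  RtoC ((-1) ^ S n / INR (S n) ^ 2) * power_series c (t + RtoC (PI ^ 2 * INR (S n) ^ 2)).

Lemma alternating_sum_odd : (nu < 0)%R ->
  is_Cseries alternating_term_odd (RtoC (PI / 2) * power_series c t).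
Proof.
  intros Hnu; pose proof PI_RGT_0 as Hpi.
  pose proof (quotient_series_odd c csqrt K nu t Hc Hsqrt Hgrowth Hnu) as H.
  apply (is_Cseries_scal (RtoC PI)) in H.
  pose proof (is_Cseries_plus _ _ _ _ H
    (is_Cseries_scal (power_series c t) _ _ (is_Cseries_RtoC _ _ leibniz_series))) as H'.
  replace (RtoC PI * RtoC 0 + power_series c t * RtoC (PI / 2)) with (RtoC (PI / 2) * power_series c t)
    in H' by ring.
  refine (is_Cseries_ext _ _ _ _ H'); intros n; cbv beta; unfold alternating_term_odd, shifted.
  pose proof (pos_INR n).
  replace (RtoC (PI / 2 + INR n * PI) ^ 2) with (RtoC (PI ^ 2 * (INR n + 1 / 2) ^ 2))
    by (rewrite <- RtoC_pow; f_equal; field).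
  generalize (power_series c (t + RtoC (PI ^ 2 * (INR n + 1 / 2) ^ 2))); intros w.
  replace (PI / 2 + INR n * PI)%R with (PI * (INR n + 1 / 2))%R by field.
  unfold Cdiv; rewrite <- RtoC_inv by nra.
  replace ((-1) ^ n / (INR n + 1 / 2))%R
    with (PI * ((-1) ^ n * / (PI * (INR n + 1 / 2))))%R by (field; lra).
  rewrite !RtoC_mult; ring.
Qed.

Lemma alternating_sum_even : (nu < 1)%R ->
  is_Cseries alternating_term_even
    (- (RtoC (PI ^ 2 / 12) * power_series c t) - RtoC (PI ^ 2 / 4) * (2 * power_series (deriv_coef c) t)).
Proof.
  intros Hnu; pose proof PI_RGT_0 as Hpi.
  pose proof (quotient_series_even c csqrt K nu t Hc Hsqrt Hgrowth Hnu) as H.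
  (* The factor [PI ^ 2] clears the denominators [(PI (n + 1)) ^ 2]; the sign accounts for
     [(-1) ^ n] standing where [(-1) ^ (n + 1)] is wanted. *)
  apply (is_Cseries_scal (RtoC (- PI ^ 2))) in H.
  pose proof (is_Cseries_plus _ _ _ _ H
    (is_Cseries_scal (power_series c t) _ _ (is_Cseries_RtoC _ _ (eta_two_series csqrt Hsqrt)))) as H'.
  rewrite <- power_series_derive_quotient in H' by trivial.
  replace (RtoC (- PI ^ 2) * (power_series (deriv_coef c) t / 2) + power_series c t * RtoC (- (PI ^ 2 / 12)))
    with (- (RtoC (PI ^ 2 / 12) * power_series c t) - RtoC (PI ^ 2 / 4) * (2 * power_series (deriv_coef c) t)) in H'.
  2: { replace (- PI ^ 2)%R with (- (PI ^ 2 / 4) * 4)%R by field.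
       rewrite RtoC_mult, !RtoC_opp; field; intros E; apply RtoC_inj in E; lra. }
  refine (is_Cseries_ext _ _ _ _ H'); intros n; cbv beta; unfold alternating_term_even, shifted.
  pose proof (lt_0_INR (S n) ltac:(lia)).
  replace (PI + INR n * PI)%R with (PI * INR (S n))%R by (rewrite S_INR; ring).
  replace (RtoC (PI * INR (S n)) ^ 2) with (RtoC (PI ^ 2 * INR (S n) ^ 2))
    by (rewrite <- RtoC_pow; f_equal; ring).
  generalize (power_series c (t + RtoC (PI ^ 2 * INR (S n) ^ 2))); intros w.
  assert (0 < PI * INR (S n))%R by now apply Rmult_lt_0_compat.
  unfold Cdiv; rewrite <- RtoC_inv by nra.
  replace ((-1) ^ S n / INR (S n) ^ 2)%R
    with (- PI ^ 2 * ((-1) ^ n * / (PI ^ 2 * INR (S n) ^ 2)))%R.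
  2: { change ((-1) ^ S n)%R with (-1 * (-1) ^ n)%R; field; lra. }
  rewrite !RtoC_mult; ring.
Qed.

Definition ms_term (p : nat) (z : C) : C := power_series c (t + (RtoC (2 * PI) * z) ^ 2) / z ^ p.

Lemma ms_term_summable p w : (nu < INR p - 1)%R -> (0 < Re (w + 1)%C)%R ->
  ex_series (fun k => Cmod (ms_term p (RtoC (INR (S k)) + w))%C).
Proof.
  intros Hnu Hw.
  destruct (shifted_div_growth c csqrt K nu t Hc Hsqrt Hgrowth p Hnu) as [s [K2 [Ps [PK2 H]]]].
  assert (-1 < Re w)%R as Hw' by (destruct w; unfold Re in *; simpl in *; lra).
  pose proof PI2_3_2 as Hpi.
  set (M := ((2 * PI) ^ p * (K2 * exp (Rabs (2 * PI * Im w))))%R).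
  assert (0 < (2 * PI) ^ p)%R as Pp by (apply pow_lt; lra).
  assert (0 <= M)%R as PM.
  { apply Rmult_le_pos; [lra|]; apply Rmult_le_pos; [trivial | left; apply exp_pos]. }
  apply ex_series_incr_1.
  apply (ex_series_le (V := R_CompleteNormedModule) _
    (fun k => M * Rpower (INR (S k)) (- (1 + 2 * s)))%R).
  2: { destruct (ex_series_Rpower (2 * s)) as [l Hl]; [lra|].
       exists (M * l)%R; now apply is_Rseries_scal. }
  intros k; unfold norm; simpl norm; unfold abs; simpl abs.
  rewrite Rabs_pos_eq by apply Cmod_ge_0.
  set (z := RtoC (INR (S (S k))) + w).
  assert (1 <= INR (S k))%R as Hk by (apply (le_INR 1); lia).
  assert (INR (S k) <= Re z)%R as Hz.
  { unfold z; rewrite (S_INR (S k)); destruct w; unfold Re in *; simpl in *; lra. }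
  assert (INR (S k) <= Cmod z)%R as Mz.
  { eapply Rle_trans; [exact Hz|]; eapply Rle_trans; [apply Rle_abs | apply re_le_Cmod]. }
  specialize (H (RtoC (2 * PI) * z)).
  rewrite Cmod_mult, Cmod_R, (Rabs_pos_eq (2 * PI)) in H by lra.
  specialize (H ltac:(nra)).
  replace (Im (RtoC (2 * PI) * z)%C) with (2 * PI * Im w)%R in H
    by (unfold z, Im; destruct w; simpl; ring).
  unfold ms_term; rewrite Cmod_div by (apply Cpow_nz, Cmod_gt_0_neq; lra).
  rewrite Cmod_pow.
  assert (0 < Cmod z ^ p)%R as Pz by (apply pow_lt; lra).
  change (power_series c (t + (RtoC (2 * PI) * z) ^ 2)) with (shifted c t (RtoC (2 * PI) * z)).
  set (N := Cmod (shifted c t (RtoC (2 * PI) * z))%C) in *.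
  rewrite Rpow_mult_distr in H.
  replace (N / Cmod z ^ p)%R with ((2 * PI) ^ p * (N / ((2 * PI) ^ p * Cmod z ^ p)))%R
    by (field; lra).
  unfold M; rewrite Rmult_assoc; apply Rmult_le_compat_l; [lra|].
  eapply Rle_trans; [exact H|]; apply Rmult_le_compat_l.
  - apply Rmult_le_pos; [trivial | left; apply exp_pos].
  - apply Rpower_neg_le; [lra | nra].
Qed.

End AlternatingSums.

Lemma is_MS_sum_of_summable (f : C -> C) (x y s : C) :
  (forall w, (0 < Re (w + 1)%C)%R -> ex_series (fun k => Cmod (f (RtoC (INR (S k)) + w))%C)) ->
  (0 < Re x)%R -> (0 < Re (y + 1)%C)%R ->
  is_Cseries (fun k => f (RtoC (INR (S k)) + (x - 1)) - f (RtoC (INR (S k)) + y)) s ->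
  is_MS_sum right_half_plane f x y s.
Proof.
  intros Hsum Hx Hy Hs.
  set (T := fun w => Cseries (fun k => f (RtoC (INR (S k)) + w))).
  assert (forall w, (0 < Re (w + 1)%C)%R ->
    is_Cseries (fun k => f (RtoC (INR (S k)) + w)) (T w)) as HT.
  { intros w Hw; apply Cseries_correct with (fun k => Cmod (f (RtoC (INR (S k)) + w))%C).
    - intros n; apply Rle_refl.
    - now apply Hsum. }
  assert (forall z, right_half_plane z -> right_half_plane (z + 1)) as HU.
  { intros [u v]; unfold right_half_plane, Re; simpl; lra. }
  split; [exact HU|]; split; [unfold right_half_plane; simpl; lra|].
  split; [exact Hx|]; split; [exact Hy|].
  (* [Q w] is the sum of [f k - f (k + w)] over [k >= 1]. Its functional equation amounts to
     [T w = T (w + 1) + f (w + 1)], the removal of the first term of a series. *)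
  exists (fun _ _ => 0), (fun w => T 0 - T w); repeat split.
  - exists 0%nat; intros n; exists (fun _ => 0); intros z; rewrite sum_O; simpl; ring.
  - intros w Hw.
    assert (is_Cseries (fun k => f (RtoC (INR (S k)) + w) - f (RtoC (INR (S k))))
      (- (T 0 - T w))) as H.
    { replace (- (T 0 - T w)) with (T w - T 0) by ring.
      apply is_Cseries_minus; [now apply HT|].
      apply is_Cseries_ext with (fun k => f (RtoC (INR (S k)) + 0)).
      - intros n; now rewrite Cplus_0_r.
      - apply HT; simpl; lra. }
    apply filterlim_locally; intros eps.
    destruct (proj1 (filterlim_locally _ _) H eps) as [N HN].
    (* The sum over [1, ..., n + 1] is the partial sum with last index [n] of the series reindexed
       from 0. *)
    exists (S N); intros [|n] Hn; [lia|].
    specialize (HN n ltac:(lia)).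
    assert (forall z : C, z - 0 = z) as E0 by (intros z; ring).
    rewrite E0, <- sum_n_m_S; exact HN.
  - intros w Hw.
    assert (T w = T (w + 1) + f (w + 1)) as E.
    { apply is_Cseries_unique with (fun k => f (RtoC (INR (S k)) + w)); [now apply HT|].
      apply is_Cseries_decr_1.
      replace (T (w + 1) + f (w + 1) - f (RtoC (INR 1) + w)) with (T (w + 1)).
      - apply is_Cseries_ext with (fun k => f (RtoC (INR (S k)) + (w + 1))).
        + intros n; f_equal; rewrite (S_INR (S n)), RtoC_plus; ring.
        + apply HT, HU, Hw.
      - replace (RtoC (INR 1) + w) with (w + 1) by (simpl; ring); ring. }
    rewrite E; ring.
  - apply (is_Cseries_unique _ _ _ Hs).
    replace (T 0 - T y - (T 0 - T (x - 1))) with (T (x - 1) - T y) by ring.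
    apply is_Cseries_minus; apply HT; trivial.
    replace (x - 1 + 1) with x by ring; exact Hx.
Qed.

(** * The derivative of [J] and its quotient by the variable *)

Lemma C_lim_unique_eps (f : C -> C) z l :
  (forall eps : R, (0 < eps)%R -> exists d : R, (0 < d)%R /\ forall h : R, h <> 0%R ->
    (Rabs h < d)%R -> (Cmod (f (z + RtoC h) - l)%C <= eps)%R) ->
  C_lim f z = l.
Proof.
  (* [C_lim] takes limits along the horizontal line through [z], so real increments suffice. *)
  intros H; destruct z as [x y], l as [l1 l2]; unfold C_lim; simpl.
  assert (forall s : R, (x, y) + RtoC (s - x) = (s, y)) as shift
    by (intros s; unfold Cplus, RtoC; simpl; f_equal; ring).
  assert (forall eps : posreal, locally' x (fun s =>
    (Cmod (f (s, y) - (l1, l2))%C < eps)%R)) as L.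
  { intros eps; pose proof (cond_pos eps).
    destruct (H (eps / 2)%R) as [d [Hd Hf]]; [lra|].
    exists (mkposreal d Hd); intros s Hs Hsx.
    specialize (Hf (s - x)%R (Rminus_eq_contra _ _ Hsx) Hs).
    rewrite shift in Hf; eapply Rle_lt_trans; [exact Hf | lra]. }
  f_equal.
  - replace l1 with (real (Finite l1)) by reflexivity; f_equal.
    apply is_lim_unique, is_lim_spec; intros eps; generalize (L eps); apply filter_imp.
    intros s Hs; eapply Rle_lt_trans; [|exact Hs].
    exact (re_le_Cmod (f (s, y) - (l1, l2))).
  - replace l2 with (real (Finite l2)) by reflexivity; f_equal.
    apply is_lim_unique, is_lim_spec; intros eps; generalize (L eps); apply filter_imp.
    intros s Hs; eapply Rle_lt_trans; [|exact Hs].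
    exact (im_le_Cmod (f (s, y) - (l1, l2))).
Qed.

Lemma C_derive_of_cderiv f z l : cderiv f z l -> C_derive f z = l.
Proof.
  intros Hf; apply C_lim_unique_eps; intros eps Heps.
  destruct (Hf eps Heps) as [d [Hd H]]; exists d; split; trivial; intros h Hh0 Hh.
  rewrite <- Cmod_R in Hh; specialize (H (RtoC h) Hh).
  assert (RtoC h <> 0) as Hc by (intros E; apply RtoC_inj in E; contradiction).
  assert (0 < Cmod (RtoC h)%C)%R as Ph by now apply Cmod_gt_0.
  apply Rmult_le_reg_r with (Cmod (RtoC h)%C); trivial.
  rewrite <- Cmod_mult.
  replace (((f (z + RtoC h) - f z) / (z + RtoC h - z) - l) * RtoC h)
    with (f (z + RtoC h) - f z - l * RtoC h); [exact H|].
  replace (z + RtoC h - z) with (RtoC h) by ring; field; exact Hc.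
Qed.

(** The chain rule for [J z = j (z ^ 2)] gives [J' z = 2 z j' (z ^ 2)]; dividing by [z] leaves a
    continuous function, which also settles the value at 0. *)
Lemma derive_over_id_even c (J : C -> C) b : entire_coef c ->
  (forall z, J z = power_series c (z ^ 2)) -> derive_over_id J b = 2 * power_series (deriv_coef c) (b ^ 2).
Proof.
  intros Hc HJ.
  assert (forall z, cderiv (fun w => w ^ 2) z (2 * z)) as Hsq.
  { intros z; refine (cderiv_ext _ _ _ _ _ (square_cderiv 0 z)); intros w; ring. }
  assert (forall z, C_derive J z = power_series (deriv_coef c) (z ^ 2) * (2 * z)) as HD.
  { intros z; apply C_derive_of_cderiv.
    apply cderiv_ext with (fun w => power_series c (w ^ 2)); [now intros w|].
    apply (cderiv_comp (power_series c) (fun w => w ^ 2)); [now apply power_series_derive | apply Hsq]. }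
  unfold derive_over_id; destruct (Ceq_dec b 0) as [-> | Hb].
  - apply C_lim_unique_eps; intros eps Heps.
    assert (ccont (fun w => 2 * power_series (deriv_coef c) (w ^ 2)) 0) as Hcont.
    { apply (ccont_mult (fun _ => 2) (fun w => power_series (deriv_coef c) (w ^ 2))).
      - eapply cderiv_ccont, cderiv_const.
      - apply (ccont_comp (power_series (deriv_coef c)) (fun w => w ^ 2)).
        + now apply power_series_ccont, entire_deriv_coef.
        + eapply cderiv_ccont, Hsq. }
    destruct (Hcont eps Heps) as [d [Hd H]]; exists d; split; trivial; intros h Hh0 Hh.
    rewrite <- Cmod_R in Hh; specialize (H (RtoC h) Hh).
    assert (RtoC h <> 0) as Hne by (intros E; apply RtoC_inj in E; contradiction).
    rewrite HD, Cplus_0_l in *.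
    replace (power_series (deriv_coef c) (RtoC h ^ 2) * (2 * RtoC h) / RtoC h)
      with (2 * power_series (deriv_coef c) (RtoC h ^ 2)) by (field; exact Hne).
    exact H.
  - rewrite HD; field; exact Hb.
Qed.

Lemma Cpow_double (z : C) n : z ^ (2 * n) = (z ^ 2) ^ n.
Proof.
  induction n as [|n IH]; [reflexivity|].
  replace (2 * S n)%nat with (S (S (2 * n))) by lia.
  change (z ^ S (S (2 * n))) with (z * (z * z ^ (2 * n))); rewrite IH; simpl; ring.
Qed.

(* csqrt is an arbitrary, possibly discontinuous, choice of square roots. *)
Theorem corollary3p3
  (a : nat -> C) (J : C -> C) (csqrt : C -> C) (nu_a nu_J K : R) (b : C)
  (hsqrt : forall w : C, csqrt w ^ 2 = w)
  (hJ : forall z : C,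
     is_series (V := C_NormedModule)
       (fun n : nat => a (2 * n)%nat / RtoC (INR (fact (2 * n))) * z ^ (2 * n)) (J z))
  (h1 : forall n : nat, Nat.Even n ->
     (Cmod (a n)%C <= K * Rpower (1 + INR n) nu_a)%R)
  (h2 : forall z : C, (0 < Re z)%R ->
     (Cmod (J z)%C <= K * exp (Rabs (Im z)) * Rpower (1 + Cmod z) nu_J)%R) :
  ((nu_a < 0)%R -> (nu_J < 0)%R ->
     is_MS_sum right_half_plane
       (fun n : C => J (csqrt (b ^ 2 + (RtoC (2 * PI)%R * n) ^ 2)) / n)
       (RtoC (1 / 4)%R) (RtoC (- 1 / 4)%R)
       (RtoC PI * J b)
     /\
     is_series (V := C_NormedModule)
       (fun n : nat =>
          RtoC ((-1) ^ n / (INR n + 1 / 2))%R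
          * J (csqrt (b ^ 2 + RtoC (PI ^ 2 * (INR n + 1 / 2) ^ 2)%R)))
       (RtoC (PI / 2)%R * J b))
  /\
  ((nu_a < 1)%R -> (nu_J < 1)%R ->
     is_MS_sum right_half_plane
       (fun n : C => J (csqrt (b ^ 2 + (RtoC (2 * PI)%R * n) ^ 2)) / n ^ 2)
       (RtoC 1) (RtoC (- 1 / 2)%R)
       (- (RtoC (PI ^ 2 / 3)%R * J b) - RtoC (PI ^ 2)%R * derive_over_id J b)
     /\
     (* the sum over n >= 1, reindexed to start at 0 *)
     is_series (V := C_NormedModule)
       (fun n : nat =>
          RtoC ((-1) ^ S n / INR (S n) ^ 2)%R
          * J (csqrt (b ^ 2 + RtoC (PI ^ 2 * INR (S n) ^ 2)%R)))
       (- (RtoC (PI ^ 2 / 12)%R * J b) - RtoC (PI ^ 2 / 4)%R * derive_over_id J b)).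
Proof.
  set (c := fun n : nat => a (2 * n)%nat / RtoC (INR (fact (2 * n)))).
  (* Only even powers of [csqrt w] occur, so the choice of root drops out; and as [w] is arbitrary,
     the series in [w] converges on the whole plane. *)
  assert (forall w, is_Cseries (fun n => c n * w ^ n) (J (csqrt w))) as Hj.
  { intros w; refine (is_Cseries_ext _ _ _ _ (hJ (csqrt w))); intros n.
    unfold c; cbv beta; now rewrite Cpow_double, hsqrt. }
  assert (entire_coef c) as Hc by exact (entire_coef_of_series c _ Hj).
  assert (forall w, J (csqrt w) = power_series c w) as Ej.
  { intros w; exact (is_Cseries_unique _ _ _ (Hj w) (power_series_correct c w Hc)). }
  assert (forall z, J z = power_series c (z ^ 2)) as EJ.
  { intros z; apply (is_Cseries_unique (fun n => c n * (z ^ 2) ^ n)).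
    - refine (is_Cseries_ext _ _ _ _ (hJ z)); intros n; unfold c; cbv beta; now rewrite Cpow_double.
    - now apply power_series_correct. }
  assert (forall z, (0 < Re z)%R ->
    (Cmod (power_series c (z ^ 2)%C)%C <= K * exp (Rabs (Im z)) * Rpower (1 + Cmod z) nu_J)%R) as Hg.
  { intros z Hz; rewrite <- EJ; now apply h2. }
  pose proof PI_RGT_0 as Hpi.
  split; intros _ Hnu.
  - pose proof (alternating_sum_odd c csqrt K nu_J (b ^ 2) Hc hsqrt Hg Hnu) as HS.
    rewrite <- EJ in HS; split.
    + apply is_MS_sum_of_summable; try (simpl; lra).
      * intros w Hw.
        refine (ex_series_ext _ _ _ (ms_term_summable c csqrt K nu_J (b ^ 2) Hc hsqrt Hg 1 w _ Hw)).
        -- intros n; unfold ms_term; rewrite Ej; do 2 f_equal; simpl; ring.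
        -- simpl; lra.
      (* Since [2 PI (n + 1/4) = PI (2 n + 1/2)] and [2 PI (n + 3/4) = PI (2 n + 1 + 1/2)], the two
         terms at step [n] of the fractional sum are those of index [2 n] and [2 n + 1] of the
         alternating series; the denominators differ by the factor 2. *)
      * apply is_Cseries_pairs, (is_Cseries_scal 2) in HS.
        replace (2 * (RtoC (PI / 2) * J b)) with (RtoC PI * J b) in HS.
        2: { replace PI with (2 * (PI / 2))%R at 1 by field; rewrite RtoC_mult; ring. }
        refine (is_Cseries_ext _ _ _ _ HS); intros n; cbv beta.
        rewrite !Ej; unfold alternating_term_odd; pose proof (pos_INR n).
        replace (RtoC (INR (S n)) + (RtoC (1 / 4) - 1)) with (RtoC (INR n + 1 / 4))
          by (rewrite S_INR, <- RtoC_minus, <- RtoC_plus; f_equal; field).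
        replace (RtoC (INR (S n)) + RtoC (- 1 / 4)) with (RtoC (INR n + 3 / 4))
          by (rewrite S_INR, <- RtoC_plus; f_equal; field).
        replace ((RtoC (2 * PI) * RtoC (INR n + 1 / 4)) ^ 2)
          with (RtoC (PI ^ 2 * (INR (2 * n) + 1 / 2) ^ 2)).
        2: { rewrite <- RtoC_mult, <- RtoC_pow, mult_INR; f_equal; simpl; field. }
        replace ((RtoC (2 * PI) * RtoC (INR n + 3 / 4)) ^ 2)
          with (RtoC (PI ^ 2 * (INR (S (2 * n)) + 1 / 2) ^ 2)).
        2: { rewrite <- RtoC_mult, <- RtoC_pow, S_INR, mult_INR; f_equal; simpl; field. }
        generalize (power_series c (b ^ 2 + RtoC (PI ^ 2 * (INR (2 * n) + 1 / 2) ^ 2)));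
        generalize (power_series c (b ^ 2 + RtoC (PI ^ 2 * (INR (S (2 * n)) + 1 / 2) ^ 2))).
        intros u v; unfold Cdiv; rewrite <- !RtoC_inv, pow_1_even, pow_1_odd by lra.
        rewrite S_INR, mult_INR; replace (INR 2) with 2%R by (simpl; ring).
        replace (/ (INR n + 1 / 4))%R with (2 * (1 / (2 * INR n + 1 / 2)))%R by (field; lra).
        replace (/ (INR n + 3 / 4))%R with (- (2 * (-1 / (2 * INR n + 1 + 1 / 2))))%R by (field; lra).
        rewrite RtoC_opp, !RtoC_mult; ring.
    + refine (is_Cseries_ext _ _ _ _ HS); intros n; now rewrite Ej.
  - pose proof (alternating_sum_even c csqrt K nu_J (b ^ 2) Hc hsqrt Hg Hnu) as HS.
    rewrite <- EJ, <- (derive_over_id_even c J b Hc EJ) in HS; split.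
    + apply is_MS_sum_of_summable; try (simpl; lra).
      * intros w Hw.
        refine (ex_series_ext _ _ _ (ms_term_summable c csqrt K nu_J (b ^ 2) Hc hsqrt Hg 2 w _ Hw)).
        -- intros n; unfold ms_term; now rewrite Ej.
        -- simpl; lra.
      (* Here [2 PI (n + 1/2) = PI (2 n + 1)] enters with a minus sign and
         [2 PI (n + 1) = PI (2 n + 2)] with a plus sign, and the squared denominators give the
         factor 4. *)
      * apply is_Cseries_pairs, (is_Cseries_scal 4) in HS.
        replace (4 * (- (RtoC (PI ^ 2 / 12) * J b) - RtoC (PI ^ 2 / 4) * derive_over_id J b))
          with (- (RtoC (PI ^ 2 / 3) * J b) - RtoC (PI ^ 2) * derive_over_id J b) in HS.
        2: { replace (PI ^ 2 / 3)%R with (4 * (PI ^ 2 / 12))%R by field.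
             replace (RtoC (PI ^ 2)) with (RtoC (4 * (PI ^ 2 / 4))) by (f_equal; field).
             rewrite !(RtoC_mult 4); ring. }
        refine (is_Cseries_ext _ _ _ _ HS); intros n; cbv beta.
        rewrite !Ej; unfold alternating_term_even; pose proof (pos_INR n).
        replace (RtoC (INR (S n)) + (RtoC 1 - 1)) with (RtoC (INR n + 1))
          by (rewrite S_INR; ring).
        replace (RtoC (INR (S n)) + RtoC (- 1 / 2)) with (RtoC (INR n + 1 / 2))
          by (rewrite S_INR, <- RtoC_plus; f_equal; field).
        replace ((RtoC (2 * PI) * RtoC (INR n + 1)) ^ 2)
          with (RtoC (PI ^ 2 * INR (S (S (2 * n))) ^ 2)).
        2: { rewrite <- RtoC_mult, <- RtoC_pow, (S_INR (S _)), S_INR, mult_INR; f_equal; simpl; field. }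
        replace ((RtoC (2 * PI) * RtoC (INR n + 1 / 2)) ^ 2)
          with (RtoC (PI ^ 2 * INR (S (2 * n)) ^ 2)).
        2: { rewrite <- RtoC_mult, <- RtoC_pow, S_INR, mult_INR; f_equal; simpl; field. }
        generalize (power_series c (b ^ 2 + RtoC (PI ^ 2 * INR (S (S (2 * n))) ^ 2)));
        generalize (power_series c (b ^ 2 + RtoC (PI ^ 2 * INR (S (2 * n)) ^ 2))).
        intros u v; unfold Cdiv; rewrite <- !RtoC_pow, <- !RtoC_inv by nra.
        rewrite pow_1_odd; change ((-1) ^ S (S (2 * n)))%R with (-1 * (-1) ^ S (2 * n))%R.
        rewrite pow_1_odd, (S_INR (S _)), S_INR, mult_INR; replace (INR 2) with 2%R by (simpl; ring).
        replace (/ (INR n + 1) ^ 2)%R with (4 * (-1 * -1 / (2 * INR n + 1 + 1) ^ 2))%R by (field; lra).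
        replace (/ (INR n + 1 / 2) ^ 2)%R with (- (4 * (-1 / (2 * INR n + 1) ^ 2)))%R by (field; lra).
        rewrite RtoC_opp, !(RtoC_mult 4); ring.
    + refine (is_Cseries_ext _ _ _ _ HS); intros n; now rewrite Ej.
Qed.
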